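(* Let $(n,N,\tau)$ be one of the following triples: $(2,2k,2k-1)$ with $k\ge 1$; $(2,2k+1,2k)$ with $k\ge 1$; $(n,N,1)$ with $2\le N\le n$; $(n,n+1,2)$; $(n,2n,3)$; $(5,16,3)$; $(6,27,4)$; $(7,56,5)$; $(21,112,3)$; $(21,162,3)$; $(22,100,3)$; $(22,275,4)$; $(22,891,5)$; $(23,552,5)$; $(23,4600,7)$. Let $C\subset\mathbb{S}^{n-1}$ be a sharp code with these parameters, i.e. a spherical $\tau$-design with $|C|=N$ such that the set $\{x\cdot y: x,y\in C,\ x\neq y\}$ has exactly $\lfloor(\tau+1)/2\rfloor$ elements. Write $\tau=2k-1+\epsilon$ with $k\in\mathbb{N}$, $\epsilon\in\{0,1\}$, and let $\{\alpha_i\}_{i=1-\epsilon}^{k}$ and $\{\rho_i\}_{i=1-\epsilon}^{k}$ be the nodes and weights defined in the context. Then there exists a point $\widetilde{x}\in\mathbb{S}^{n-1}$ such that $\{\widetilde{x}\cdot y: y\in C\}=\{\alpha_i\}_{i=1-\epsilon}^k$ and, for each $i$, exactly $N\rho_i$ points $y\in C$ satisfy $\widetilde{x}\cdot y=\alpha_i$. Consequently, for every function $h:[-1,1]\to[0,+\infty]$ that is continuous on $[-1,1]$, finite on $(-1,1)$, and whose derivative $h^{(\tau+1)}$ exists and satisfies $h^{(\tau+1)}\ge 0$ on $(-1,1)$, one has $$\inf_{x\in\mathbb{S}^{n-1}}\sum_{y\in C}h(x\cdot y)=N\sum_{i=1-\epsilon}^{k}\rho_i h(\alpha_i),$$ the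 infimum being attained at $\widetilde{x}$.
   Context: $\mathbb{S}^{n-1}$ is the unit sphere in $\mathbb{R}^n$. A spherical $\tau$-design is a finite $C\subset\mathbb{S}^{n-1}$ such that the average over $C$ of every polynomial of degree at most $\tau$ in $n$ variables equals its average over $\mathbb{S}^{n-1}$ with respect to surface measure. Let $d\mu_n(t)=\gamma_n(1-t^2)^{(n-3)/2}dt$ on $[-1,1]$, with $\gamma_n$ chosen so that $\mu_n$ is a probability measure. For $a,b\in\{0,1\}$, $P_j^{(a,b)}(t)$ denotes the Jacobi polynomial of degree $j$ with parameters $\alpha=a+(n-3)/2$, $\beta=b+(n-3)/2$ (orthogonal on $[-1,1]$ with respect to $(1-t)^\alpha(1+t)^\beta$), normalized by $P_j^{(a,b)}(1)=1$. The nodes $\alpha_{1-\epsilon}<\dots<\alpha_k$ are the zeros of the polynomial $(1+t)^{\epsilon}P_k^{(0,\epsilon)}(t)$ (so $\alpha_0=-1$ when $\epsilon=1$), and $\rho_i=\int_{-1}^1\ell_i(t)\,d\mu_n(t)$, where $\ell_i$ are the Lagrange basis polynomials for these nodes ($\ell_i(\alpha_j)=\delta_{ij}$). *)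

(* Defs.v *)
From HB Require Import structures.
From mathcomp Require Import all_boot all_order all_algebra.
From mathcomp Require Import all_classical all_reals all_analysis.
Set Implicit Arguments. Unset Strict Implicit. Unset Printing Implicit Defensive.
Import Order.TTheory GRing.Theory Num.Theory.
Import numFieldNormedType.Exports.
Local Open Scope classical_set_scope.
Local Open Scope ring_scope.

Section Defs.
Variable R : realType.

Definition dotp (n : nat) (x y : 'rV[R]_n) : R := \sum_(i < n) x 0 i * y 0 i.
Definition sphere (n : nat) : set 'rV[R]_n := [set x | dotp x x = 1].

Fixpoint iter_integral (m : nat) (F : seq R -> R) : R :=
  match m with
  | 0 => F [::]
  | m'.+1 => Rintegral lebesgue_measure setT
               (fun t => iter_integral m' (fun s => F (t :: s)))
  end.

Definition Rn_integral (n : nat) (f : 'rV[R]_n -> R) : R :=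
  iter_integral n (fun s => f (\row_(i < n) nth 0 s i)).

Definition eucl_norm (n : nat) (x : 'rV[R]_n) : R := Num.sqrt (dotp x x).

(** Average over S^{n-1} w.r.t. normalized surface measure, realized as the
    cone measure: sigma(A) = vol({r a : a in A, 0 < r <= 1}) / vol(unit ball). *)
Definition sphere_avg (n : nat) (f : 'rV[R]_n -> R) : R :=
  Rn_integral (fun x => if (0 < eucl_norm x <= 1) then f ((eucl_norm x)^-1 *: x)
                        else 0)
  / Rn_integral (fun x : 'rV[R]_n => if (0 < eucl_norm x <= 1) then 1 else 0).

Definition mpoly_terms (n : nat) := seq (R * {ffun 'I_n -> nat}).
Definition eval_poly (n : nat) (p : mpoly_terms n) (x : 'rV[R]_n) : R :=
  \sum_(c <- p) c.1 * \prod_(i < n) x 0 i ^+ c.2 i.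
Definition poly_deg_le (n : nat) (tau : nat) (p : mpoly_terms n) : Prop :=
  forall c, c \in p -> (\sum_(i < n) c.2 i <= tau)%N.

Definition spherical_design (n tau : nat) (C : seq 'rV[R]_n) : Prop :=
  {subset C <= @sphere n} /\
  forall p : mpoly_terms n, poly_deg_le tau p ->
    (size C)%:R^-1 * \sum_(y <- C) eval_poly p y = sphere_avg (eval_poly p).

Definition inner_products (n : nat) (C : seq 'rV[R]_n) : seq R :=
  undup [seq dotp x y | x <- C, y <- [seq y <- C | y != x]].

Definition sharp_code (n N tau : nat) (C : seq 'rV[R]_n) : Prop :=
  uniq C /\ size C = N /\ spherical_design tau C /\
  size (inner_products C) = (tau.+1)./2.

Definition mu_weight (n : nat) (t : R) : R := (1 - t ^+ 2) `^ ((n%:R - 3) / 2).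
Definition mu_integral (n : nat) (f : R -> R) : R :=
  Rintegral lebesgue_measure `[-1, 1] (fun t => f t * mu_weight n t)
  / Rintegral lebesgue_measure `[-1, 1] (mu_weight n).

Definition jacobi_weight (n a b : nat) (t : R) : R :=
  (1 - t) `^ (a%:R + (n%:R - 3) / 2) * (1 + t) `^ (b%:R + (n%:R - 3) / 2).
Definition is_jacobi (n a b j : nat) (P : {poly R}) : Prop :=
  size P = j.+1 /\ P.[1] = 1 /\
  forall q : {poly R}, (size q <= j)%N ->
    Rintegral lebesgue_measure `[-1, 1]
      (fun t => P.[t] * q.[t] * jacobi_weight n a b t) = 0.

Definition lagrange_basis (alpha : seq R) (i : nat) (t : R) : R :=
  \prod_(j < size alpha | j != i :> nat) ((t - alpha`_j) / (alpha`_i - alpha`_j)).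

Definition sharp_params (n N tau : nat) : Prop :=
  (n = 2 /\ exists k, (1 <= k)%N /\ N = k.*2 /\ tau = k.*2.-1) \/
  (n = 2 /\ exists k, (1 <= k)%N /\ N = k.*2.+1 /\ tau = k.*2) \/
  (tau = 1 /\ (2 <= N <= n)%N) \/
  (N = n.+1 /\ tau = 2) \/
  (N = n.*2 /\ tau = 3) \/
  (n, N, tau) = (5, 16, 3)%N \/
  (n, N, tau) = (6, 27, 4)%N \/
  (n, N, tau) = (7, 56, 5)%N \/
  (n, N, tau) = (21, 112, 3)%N \/
  (n, N, tau) = (21, 162, 3)%N \/
  (n, N, tau) = (22, 100, 3)%N \/
  (n, N, tau) = (22, 275, 4)%N \/
  (n, N, tau) = (22, 891, 5)%N \/
  (n, N, tau) = (23, 552, 5)%N \/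
  (n, N, tau) = (23, 4600, 7)%N.

End Defs.

(* Main.v *)
Require Import Defs.
From HB Require Import structures.
From mathcomp Require Import all_boot all_order all_algebra.
From mathcomp Require Import all_classical all_reals all_analysis.
From mathcomp Require Import measurable_realfun.
From mathcomp Require Import ring lra zify.
Import Order.TTheory GRing.Theory Num.Theory.
Import numFieldNormedType.Exports.
Local Open Scope classical_set_scope.
Local Open Scope ring_scope.

(* Idea.  A spherical design has the same power moments in every direction as
   [mu_n], so the average of a polynomial of degree at most [tau] in [x.y] over
   [y] in the code is its integral.  Suppose some unit [x] has at most [k] inner
   products with the code (besides -1, when [tau] is even).  The corresponding
   nodal polynomial is orthogonal to all lower degrees, hence proportional to the
   Jacobi polynomial; thus the inner products are the quadrature nodes, the
   multiplicities are read off the Lagrange basis, and [h] dominates its Hermite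
   interpolant at the nodes, whose sum over the code does not depend on [x].

   For even [tau] take [x = - y] with [y] in the code.  For odd [tau] a vector
   with few inner products is found from the parameters alone: after scaling,
   the code is integral, and [x] is a vector taking only small odd values (shortest
   solution of a linear system over F_2), or a suitable combination of a few code
   points, or, for 112, 552 and 891 points, a combination of one, three or one
   code points and of the blocks of their neighbours (triangles or antipodal pairs)
   chosen by a word over F_3 or F_2 with prescribed products; such a word exists
   by comparing sums of a function of the weight over all words and over the
   orthogonal complement of a self-orthogonal system.  Regular polygons come from
   the vanishing of a Fejer kernel sum. *)

(** * Integrals of homogeneous functions over the unit ball *)

(** No coordinates of the exceptional codes are at hand, only moments and the number of inner
    products. So each local structure (inner products, neighbours, lines, antipodes) is forced by
    one device: a polynomial of degree at most [tau], nonnegative on the values still possible, has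
    a known sum over the code; comparing it with the terms already known either produces a further
    point or makes every other term vanish. The same device certifies the final vector: once its
    products with the code lie in a discrete set such as the integers, an identity between its even
    moments leaves only the required values.

    On the analytic side, [sphere_avg] is an iterated integral of a homogeneous function that is not
    a polynomial. A layer-cake formula in the radius keeps all partial integrals inside one explicit
    family, and only ratios are compared, so no volume or Gamma value is computed. At the endpoints
    [h] may be infinite; -1 is a node exactly for even [tau], which is when the sign of the
    interpolation error bounds [h] there. *)

Section Integrals.
Context {R : realType}.
Local Notation mu := (@lebesgue_measure R).

(** Negation swaps the positive and negative parts; when one of them has an infinite integral,
    [fine] sends both sides to 0. *)
Lemma RintegralN (f : R -> R) : Rintegral mu setT (fun t => - f t) = - Rintegral mu setT f.
Proof.
rewrite /Rintegral [in LHS]integralE [in RHS]integralE.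
have -> : (fun x => (- f x)%:E)^\+%E = (fun x => (f x)%:E)^\-%E.
  by rewrite -funeposN; congr funepos; apply/funext => x; rewrite EFinN.
have -> : (fun x => (- f x)%:E)^\-%E = (fun x => (f x)%:E)^\+%E.
  by rewrite -funenegN; congr funeneg; apply/funext => x; rewrite EFinN.
have := @integral_ge0 _ _ _ mu setT _ (fun x _ => funepos_ge0 (fun x => (f x)%:E) x).
have := @integral_ge0 _ _ _ mu setT _ (fun x _ => funeneg_ge0 (fun x => (f x)%:E) x).
move: (integral _ _ _) (integral _ _ _) => [a| |] [b| |] //=; rewrite ?oppr0 //.
by rewrite opprB.
Qed.

Lemma RintegralZ (k : R) (f : R -> R) : measurable_fun setT f -> (forall t, 0 <= f t) ->
  Rintegral mu setT (fun t => k * f t) = k * Rintegral mu setT f.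
Proof.
move=> mf f0.
wlog k0 : k / 0 <= k => [hw|].
  have [/hw//|k0] := leP 0 k.
  rewrite -[k]opprK.
  under [in LHS]eq_Rintegral do rewrite mulNr.
  rewrite RintegralN hw ?mulNr //.
  by rewrite oppr_ge0 ltW.
rewrite /Rintegral.
under eq_integral do rewrite EFinM.
rewrite ge0_integralZl_EFin //; last 2 first.
- by move=> x _; rewrite lee_fin.
- exact/measurable_EFinP.
have := @integral_ge0 _ _ _ mu setT (fun x => (f x)%:E) (fun x _ => f0 x).
move: (integral _ _ _) => [a| |] //= _.
have [->|k1] := eqVneq k 0; first by rewrite mul0e mul0r.
by rewrite gt0_muley ?mulr0 // lte_fin lt_neqAle eq_sym k1.
Qed.

(** Reflection exchanges the positive and negative parts, so their integrals agree; if both are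
    infinite, [fine] still reads the difference as 0. *)
Lemma Rintegral_odd (f : R -> R) : measurable_fun setT f -> (forall t, f (- t) = - f t) ->
  Rintegral mu setT f = 0.
Proof.
move=> mf fN.
rewrite /Rintegral integralE.
suff -> : (\int[mu]_x (fun x0 : R => (f x0)%:E)^\+ x)%E = (\int[mu]_x (fun x0 : R => (f x0)%:E)^\- x)%E.
  have := @integral_ge0 _ _ _ mu setT _ (fun x _ => funeneg_ge0 (fun x => (f x)%:E) x).
  by move: (integral _ _ _) => [a| |] //= _; rewrite subrr.
transitivity (\int[pushforward mu (-%R : R -> measurableTypeR R)]_x (fun x0 : R => (f x0)%:E)^\+ x)%E.
  by apply: eq_measure_integral => //= A mA _; apply/esym/lebesgue_measureN.
rewrite ge0_integral_pushforward //=; last first.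
  by apply: measurable_funepos; apply/measurable_EFinP.
apply: eq_integral => x _ /=.
by rewrite funeposE funenegE /= fN.
Qed.

(** Uniqueness of Lebesgue measure: the image under dilation, rescaled by [c], has the right value
    on half-open intervals. *)
Lemma integral_dilate (c : R) (f : R -> \bar R) : 0 < c ->
  measurable_fun setT f -> (forall t, (0 <= f t)%E) ->
  (c%:E * \int[mu]_t f (c * t)%R = \int[mu]_t f t)%E.
Proof.
move=> c0 mf f0.
have mc : measurable_fun [set: measurableTypeR R] (fun t : measurableTypeR R => c * t : measurableTypeR R).
  by apply: measurable_funM.
pose nu0 : {measure set (measurableTypeR R) -> \bar R} := mscale (NngNum (ltW c0))
  (pushforward mu (fun t : measurableTypeR R => c * t : measurableTypeR R)).
pose nu := nu0 mc.
transitivity (\int[nu]_t f t)%E; last first.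
  apply: eq_measure_integral => //= A mA _.
  apply/esym/lebesgue_measure_unique => //= _ [[a b]] _ <-.
  rewrite /mscale /= /pushforward /=.
  have -> : (fun t : R => c * t) @^-1` `]a, b] = `]a / c, b / c]%classic.
    by apply/seteqP; split => x /=; rewrite !in_itv /= ltr_pdivrMr // ler_pdivlMr // ![x * c]mulrC.
  rewrite !lebesgue_measure_itv /= !lte_fin ltr_pM2r ?invr_gt0 //.
  case: ifP => // _; last by rewrite mule0.
  rewrite -!EFinB -EFinM; congr (_ %:E).
  by field; rewrite gt_eqF.
rewrite /nu ge0_integral_mscale //= ge0_integral_pushforward //.
Qed.

(** The truncated power x_+^(m/2). For [m = 0] it is the indicator of [0 <= x], so that
    [tpow 0 (r - s)] cuts out a ball; integrating out a coordinate with exponent [a] raises [m] by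
    [a + 1], whence the half-integer exponents. *)
Definition tpow (m : nat) (x : R) : R := if 0 <= x then Num.sqrt x ^+ m else 0.

Lemma tpow_ge0 m x : 0 <= tpow m x.
Proof. by rewrite /tpow; case: ifP => // _; rewrite exprn_ge0 // sqrtr_ge0. Qed.

Lemma measurable_tpow m : measurable_fun setT (tpow m).
Proof.
apply: measurable_fun_ifT => //.
- by apply: measurable_fun_ler.
- apply: measurable_funX; apply: continuous_measurable_fun; exact: sqrt_continuous.
Qed.

(** For even [a], the Beta value B((a+1)/2, m/2+1). *)
Definition betac (a m : nat) : R := Rintegral mu setT (fun t => t ^+ a * tpow m (1 - t ^+ 2)).

Lemma even_expr_ge0 a (t : R) : ~~ odd a -> 0 <= t ^+ a.
Proof. exact: exprn_even_ge0. Qed.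

Lemma measurable_sq1 m a : measurable_fun setT (fun t : R => t ^+ a * tpow m (1 - t ^+ 2)).
Proof.
apply: measurable_funM; first exact: measurable_funX.
apply: (measurableT_comp (measurable_tpow m)).
by apply: measurable_funB => //; exact: measurable_funX.
Qed.

Lemma betac_fin a m : ~~ odd a -> (\int[mu]_t (t ^+ a * tpow m (1 - t ^+ 2))%:E)%E = (betac a m)%:E.
Proof.
move=> ea; rewrite /betac /Rintegral fineK // ge0_fin_numE; last first.
  by apply: integral_ge0 => t _; rewrite lee_fin mulr_ge0 ?tpow_ge0 ?even_expr_ge0.
apply: (@le_lt_trans _ _ (\int[mu]_t (\1_(`[-1, 1]%classic) t)%:E)%E); last first.
  rewrite integral_indic // setIT /= lebesgue_measure_itv /= lte_fin.
  by case: ifP => // _; rewrite -EFinB ltry.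
apply: ge0_le_integral => //.
- by move=> t _; rewrite lee_fin mulr_ge0 ?tpow_ge0 ?even_expr_ge0.
- by apply/measurable_EFinP; exact: measurable_sq1.
- apply/measurable_EFinP; exact: measurable_indic.
move=> t _; rewrite lee_fin indicE /tpow.
case: ifP => ht; last by rewrite mulr0 ler0n.
have ht1 : `|t| <= 1 by rewrite -(@ler_pXn2r _ 2) ?nnegrE // expr1n real_normK ?num_real // -subr_ge0.
rewrite mem_set /=; last by rewrite in_itv /= -ler_norml.
rewrite -[X in _ <= X]mulr1; apply: ler_pM; first exact: even_expr_ge0.
- by rewrite exprn_ge0 // sqrtr_ge0.
- by rewrite (le_trans (ler_norm _)) // normrX exprn_ile1.
- rewrite exprn_ile1 ?sqrtr_ge0 // -[X in _ <= X]sqrtr1 ler_wsqrtr // gerBl sqr_ge0 //.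
Qed.

Lemma integral_tpow a m (r : R) : ~~ odd a ->
  (\int[mu]_t (t ^+ a * tpow m (r - t ^+ 2))%:E)%E = (betac a m * tpow (m + a).+1 r)%:E.
Proof.
move=> ea.
have mf : measurable_fun setT (fun t : R => t ^+ a * tpow m (r - t ^+ 2)).
  apply: measurable_funM; first exact: measurable_funX.
  apply: (measurableT_comp (measurable_tpow m)).
  by apply: measurable_funB => //; exact: measurable_funX.
have [r0|r0] := leP r 0.
  have -> : tpow (m + a).+1 r = 0.
    rewrite /tpow; case: ifP => // r0'.
    by rewrite (_ : r = 0) ?sqrtr0 ?expr0n //; apply/eqP; rewrite eq_le r0.
  rewrite mulr0.
  (* For [r = 0] and [m = a = 0] the integrand is 1 at [t = 0], so this null set is split off before
     showing that the rest vanishes. *)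
  rewrite -(setUv [set (0:R)]) ge0_integral_setU //=; last 4 first.
  - by apply: measurableC.
  - by apply/measurable_EFinP; rewrite setUv.
  - by move=> t _; rewrite lee_fin mulr_ge0 ?tpow_ge0 ?even_expr_ge0.
  - by apply/disj_setPCl.
  rewrite integral_set1 add0e integral0_eq // => t /= t0.
  rewrite /tpow ifF ?mulr0 //; apply/negbTE; rewrite -ltNge.
  rewrite subr_lt0 (le_lt_trans r0) // exprn_even_gt0 //=.
  by apply/eqP.
set c := Num.sqrt r.
have c0 : 0 < c by rewrite sqrtr_gt0.
have c2 : c ^+ 2 = r by rewrite sqr_sqrtr // ltW.
rewrite -(integral_dilate _ _ c0) //; last 2 first.
- by apply/measurable_EFinP.
- by move=> t; rewrite lee_fin mulr_ge0 ?tpow_ge0 ?even_expr_ge0.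
transitivity (c%:E * \int[mu]_t ((c ^+ (m + a))%:E * (t ^+ a * tpow m (1 - t ^+ 2))%:E))%E.
  congr (_ * _)%E; apply: eq_integral => t _; rewrite -EFinM; congr (_ %:E).
  rewrite exprMn (_ : r - _ = r * (1 - t ^+ 2)); last by rewrite -c2; ring.
  rewrite /tpow pmulr_rge0 // sqrtrM; last exact: ltW.
  rewrite -/c.
  by case: ifP => _; [rewrite exprMn exprD; ring|rewrite !mulr0].
rewrite ge0_integralZl_EFin //; last 3 first.
- by move=> t _; rewrite lee_fin mulr_ge0 ?tpow_ge0 ?even_expr_ge0.
- by apply/measurable_EFinP; exact: measurable_sq1.
- by rewrite exprn_ge0 // ltW.
rewrite betac_fin // -!EFinM; congr (_ %:E).
by rewrite /tpow ltW // -/c exprS; ring.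
Qed.

End Integrals.

(** * Layer-cake representation of homogeneous functions on the ball *)

Section Integrals.
Context {R : realType}.
Local Notation mu := (@lebesgue_measure R).

Definition shell (d : nat) (rho : R) : R := if 0 < rho <= 1 then d%:R * rho ^- d.+1 else 0.

(** A superposition of truncated powers over the radii rho in (0,1], with [shell] as density, plus a
    unit mass at radius 1. Since s^(-d/2) = 1 + int_(sqrt s)^1 d rho^(-d-1) drho, the case [m = 0]
    is |x|^(-d) on the punctured unit ball ([cone0]), and integrating out a coordinate only changes
    [m] and a constant ([integral_cone]). *)
Definition cone (d m : nat) (s : R) : \bar R :=
  ((tpow m (1 - s))%:E + \int[mu]_rho (shell d rho * tpow m (rho ^+ 2 - s))%:E)%E.

Definition radial (d : nat) (s : R) : R := if 0 < s <= 1 then Num.sqrt s ^- d else 0.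

Lemma shell_ge0 d rho : 0 <= shell d rho.
Proof.
by rewrite /shell; case: ifP => // /andP[r0 _]; rewrite mulr_ge0 // invr_ge0 exprn_ge0 // ltW.
Qed.

Lemma measurable_shell d : measurable_fun setT (shell d).
Proof.
have -> : shell d = fun rho => if (0 < rho) && (rho <= 1) then d%:R * rho `^ (- d.+1%:R) else 0.
  apply/funext => x; rewrite /shell; case: ifP => // /andP[x0 _].
  by rewrite powRN powR_mulrn // ltW.
apply: measurable_fun_ifT => //.
  by apply: measurable_and; [exact: measurable_fun_ltr|exact: measurable_fun_ler].
by apply: measurable_funM => //; exact: measurable_powR.
Qed.

Lemma is_derive_NVexp d (x : R) : 0 < x ->
  is_derive x 1 (fun x : R => - x ^- d) (d%:R * x ^- d.+1).
Proof.
move=> x0; have x0' : x != 0 by rewrite gt_eqF.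
have xd0 : x ^+ d != 0 by rewrite expf_neq0.
have hX : is_derive x 1 (fun x : R => x ^+ d) ((d%:R * x ^+ d.-1) *: 1).
  by apply: DeriveDef; [exact: exprn_derivable|rewrite exp_derive].
have h := @is_deriveV R (fun x => x ^+ d) x _ 1 xd0 hX.
have hN := @is_deriveN _ _ _ _ _ _ _ h.
apply: (is_derive_eq hN).
rewrite /GRing.scale /= !mulr1 mulNr opprK.
case: d xd0 {hX h hN} => [|d] xd0; first by rewrite !mul0r mulr0.
rewrite /= mulrCA; congr (_ * _).
have xd1 : x ^+ d != 0 by rewrite expf_neq0.
by rewrite !exprS expr0; field; rewrite x0' xd1.
Qed.

Lemma integral_shell d (s : R) : 0 < s <= 1 ->
  (\int[mu]_(x in `[s, 1%R]) (d%:R * x ^- d.+1)%:E = (s ^- d - 1)%:E)%E.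
Proof.
move=> /andP[s0]; rewrite le_eqVlt => /predU1P[->|s1].
  by rewrite set_itv1 integral_set1 expr1n invr1 subrr.
have dF (x : R) : 0 < x -> derivable (fun x : R => - x ^- d) x 1.
  by move=> x0; have [] := is_derive_NVexp d _ x0.
have cF (x : R) : 0 < x -> {for x, continuous (fun x : R => - x ^- d)}.
  by move=> x0; apply/differentiable_continuous/derivable1_diffP/dF.
rewrite (@continuous_FTC2 _ _ (fun x => - x ^- d)) //.
- by rewrite -EFinB expr1n invr1 opprK addrC.
- apply: continuous_in_subspaceT => x; rewrite inE /= in_itv /= => /andP[sx _].
  have x0 := lt_le_trans s0 sx.
  apply: cvgM; first exact: cvg_cst.
  apply: cvgV; first by rewrite expf_neq0 // gt_eqF.
  exact: exprn_continuous.
- split.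
  + by move=> x; rewrite in_itv /= => /andP[sx _]; apply: dF; exact: lt_trans sx.
  + by apply: cvg_at_right_filter; exact: cF.
  + by apply: cvg_at_left_filter; apply: cF.
- move=> x; rewrite in_itv /= => /andP[sx _].
  by rewrite derive1E (@derive_val _ _ _ _ _ _ _ (is_derive_NVexp d x (lt_trans s0 sx))).
Qed.

Lemma cone0 d s : 0 < s -> cone d 0 s = (radial d s)%:E.
Proof.
move=> s0; rewrite /cone /radial s0 /= {1}/tpow subr_ge0 expr0.
case: ifPn => s1.
  rewrite (_ : (fun rho => _) = (fun x => (d%:R * x ^- d.+1)%:E) \_ `[Num.sqrt s, 1%R]).
    rewrite -integral_mkcond integral_shell; last first.
      by rewrite sqrtr_gt0 s0 /= -[X in _ <= X]sqrtr1 ler_wsqrtr.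
    by rewrite -EFinD; congr (_ %:E); rewrite addrC subrK.
  apply/funext => x; rewrite patchE /shell /tpow expr0.
  have [x0|x0] /= := ltP 0 x; last first.
    rewrite mul0r ifF //; apply/negbTE/negP; rewrite inE /= in_itv /= => /andP[sx _].
    by have := le_trans sx x0; rewrite leNgt sqrtr_gt0 s0.
  have -> : (0 <= x ^+ 2 - s) = (Num.sqrt s <= x).
    by rewrite subr_ge0 -[in LHS](sqr_sqrtr (ltW s0)) ler_pXn2r // nnegrE ?sqrtr_ge0 // ltW.
  rewrite mem_setE in_itv /=; case: ifP => x1; rewrite ?mul0r ?andbF // andbT.
  by case: ifP; rewrite ?mulr1 ?mulr0.
rewrite integral0_eq ?adde0 // => x _; rewrite /shell; case: ifP; last by rewrite mul0r.
move=> /andP[x0 x1]; rewrite /tpow ifF ?mulr0 //; apply/negbTE; rewrite -ltNge subr_lt0.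
by rewrite (le_lt_trans _ (_ : 1 < s)) ?ltNge // exprn_ile1 // ltW.
Qed.

Lemma measurable_cone_integrand d m s : measurable_fun setT (fun rho : R => shell d rho * tpow m (rho ^+ 2 - s)).
Proof.
apply: measurable_funM; first exact: measurable_shell.
apply: (measurableT_comp (measurable_tpow m)).
by apply: measurable_funB => //; exact: measurable_funX.
Qed.

Lemma cone_integrand_ge0 d m (s rho : R) : 0 <= shell d rho * tpow m (rho ^+ 2 - s).
Proof. by rewrite mulr_ge0 ?shell_ge0 ?tpow_ge0. Qed.

Lemma cone_ge0 d m s : (0 <= cone d m s)%E.
Proof.
rewrite /cone adde_ge0 ?lee_fin ?tpow_ge0 // integral_ge0 // => x _.
by rewrite lee_fin cone_integrand_ge0.
Qed.

Lemma tpow_le m (x : R) : x <= 1 -> tpow m x <= tpow 0 x.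
Proof.
move=> x1; rewrite /tpow; case: ifP => // x0.
by rewrite expr0 exprn_ile1 ?sqrtr_ge0 // -[X in _ <= X]sqrtr1 ler_wsqrtr.
Qed.

Lemma cone_fin d m s : 0 < s -> cone d m s \is a fin_num.
Proof.
move=> s0; rewrite ge0_fin_numE ?cone_ge0 //.
apply: (@le_lt_trans _ _ (cone d 0 s)); last by rewrite cone0 // ltry.
apply: leeD.
  by rewrite lee_fin tpow_le // gerBl ltW.
apply: ge0_le_integral => //.
- by move=> x _; rewrite lee_fin cone_integrand_ge0.
- by apply/measurable_EFinP; exact: measurable_cone_integrand.
- by apply/measurable_EFinP; exact: measurable_cone_integrand.
move=> x _; rewrite lee_fin /shell; case: ifP => [/andP[x0 x1]|]; last by rewrite !mul0r.
rewrite ler_wpM2l //; first by rewrite mulr_ge0 // invr_ge0 exprn_ge0 // ltW.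
by rewrite tpow_le // (le_trans _ (exprn_ile1 2 (ltW x0) x1)) // gerBl ltW.
Qed.

Lemma betac_ge0 a m : ~~ odd a -> 0 <= betac a m :> R.
Proof.
move=> ea; rewrite /betac; apply: Rintegral_ge0 => t _.
by rewrite mulr_ge0 ?even_expr_ge0 ?tpow_ge0.
Qed.

Lemma measurable_cone2 a d m (s : R) : measurable_fun setT (fun z : R * R =>
  (z.1 ^+ a * (shell d z.2 * tpow m (z.2 ^+ 2 - (s + z.1 ^+ 2))))%:E).
Proof.
apply/measurable_EFinP; apply: measurable_funM.
  by apply: measurable_funX; exact: measurable_fst.
apply: measurable_funM.
  by apply: (measurableT_comp (measurable_shell d)); exact: measurable_snd.
apply: (measurableT_comp (measurable_tpow m)).
apply: measurable_funB.
  by apply: measurable_funX; exact: measurable_snd.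
apply: measurable_funD => //.
by apply: measurable_funX; exact: measurable_fst.
Qed.

Lemma cone_split a d m (s t : R) : ~~ odd a ->
  ((t ^+ a)%:E * cone d m (s + t ^+ 2) =
  (t ^+ a * tpow m (1 - s - t ^+ 2))%:E +
   \int[mu]_rho (t ^+ a * (shell d rho * tpow m (rho ^+ 2 - (s + t ^+ 2))))%:E)%E.
Proof.
move=> ea; rewrite /cone muleDr; last 2 first.
- by [].
- rewrite ge0_adde_def // inE ?lee_fin ?tpow_ge0 // integral_ge0 // => x _.
  by rewrite lee_fin cone_integrand_ge0.
congr (_ + _)%E; first by rewrite -EFinM opprD addrA.
rewrite -ge0_integralZl_EFin //.
- by move=> x _; rewrite lee_fin cone_integrand_ge0.
- by apply/measurable_EFinP; exact: measurable_cone_integrand.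
- exact: even_expr_ge0.
Qed.

Lemma measurable_cone a d m (s : R) : ~~ odd a ->
  measurable_fun setT (fun t : R => ((t ^+ a)%:E * cone d m (s + t ^+ 2))%E).
Proof.
move=> ea; under eq_fun do rewrite cone_split //.
apply: emeasurable_funD.
  apply/measurable_EFinP; apply: measurable_funM; first exact: measurable_funX.
  apply: (measurableT_comp (measurable_tpow m)).
  by apply: measurable_funB => //; exact: measurable_funX.
apply: (@measurable_fun_fubini_tonelli_F _ _ _ _ _ mu _ (measurable_cone2 a d m s)).
by move=> x; rewrite lee_fin mulr_ge0 ?cone_integrand_ge0 ?even_expr_ge0.
Qed.

(** Tonelli exchanges the coordinate with the radius, and [integral_tpow] then applies at each
    radius. *)
Lemma integral_cone a d m (s : R) : ~~ odd a ->
  (\int[mu]_t ((t ^+ a)%:E * cone d m (s + t ^+ 2)) =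
   (betac a m)%:E * cone d (m + a).+1 s)%E.
Proof.
move=> ea; under eq_integral do rewrite cone_split //.
rewrite ge0_integralD //; last 4 first.
- by move=> t _; rewrite lee_fin mulr_ge0 ?even_expr_ge0 ?tpow_ge0.
- apply/measurable_EFinP; apply: measurable_funM; first exact: measurable_funX.
  apply: (measurableT_comp (measurable_tpow m)).
  by apply: measurable_funB => //; exact: measurable_funX.
- move=> t _; apply: integral_ge0 => x _.
  by rewrite lee_fin mulr_ge0 ?cone_integrand_ge0 ?even_expr_ge0.
- apply: (@measurable_fun_fubini_tonelli_F _ _ _ _ _ mu _ (measurable_cone2 a d m s)).
  by move=> x; rewrite lee_fin mulr_ge0 ?cone_integrand_ge0 ?even_expr_ge0.
rewrite integral_tpow // (@fubini_tonelli _ _ _ _ _ mu mu _ (measurable_cone2 a d m s)); last first.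
  by move=> x; rewrite lee_fin mulr_ge0 ?cone_integrand_ge0 ?even_expr_ge0.
rewrite /cone muleDr //.
congr (_ + _)%E.
rewrite -ge0_integralZl_EFin ?betac_ge0 //; last 2 first.
- by move=> x _; rewrite lee_fin cone_integrand_ge0.
- by apply/measurable_EFinP; exact: measurable_cone_integrand.
apply: eq_integral => rho _ /=.
transitivity (\int[mu]_x ((shell d rho)%:E * (x ^+ a * tpow m (rho ^+ 2 - s - x ^+ 2))%:E))%E.
  by apply: eq_integral => x _; rewrite -EFinM opprD addrA mulrCA.
rewrite ge0_integralZl_EFin //; last 3 first.
- by move=> t _; rewrite lee_fin mulr_ge0 ?even_expr_ge0 ?tpow_ge0.
- apply/measurable_EFinP; apply: measurable_funM; first exact: measurable_funX.
  apply: (measurableT_comp (measurable_tpow m)).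
  by apply: measurable_funB => //; exact: measurable_funX.
- exact: shell_ge0.
by rewrite integral_tpow // -!EFinM mulrCA.
Qed.

End Integrals.

Section Integrals.
Context {R : realType}.
Local Notation mu := (@lebesgue_measure R).

Lemma integral_off0 (f : R -> \bar R) : measurable_fun [set~ (0 : R)] f ->
  (\int[mu]_(t in [set~ (0%R : R)]) f t = \int[mu]_t f t)%E.
Proof.
move=> mf; rewrite -[in RHS](@integral_setD1 _ _ 0 setT); last 2 first.
- by rewrite setTD; exact: measurableC.
- by rewrite setTD.
by rewrite setTD.
Qed.

(** The inner integrals are identified only where [s + t ^+ 2] is positive; for [s = 0] this leaves
    out the null set [t = 0]. *)
Lemma eq_integral_off0 (f g : R -> \bar R) : measurable_fun setT g ->
  (forall t, t != 0 -> f t = g t) -> (\int[mu]_t f t = \int[mu]_t g t)%E.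
Proof.
move=> mg fg.
have fg' : {in [set~ (0:R)], g =1 f} by move=> t; rewrite inE /= => /eqP t0; rewrite fg.
have mg' : measurable_fun [set~ (0:R)] g by apply: measurable_funS mg.
rewrite -integral_off0; last first.
  by apply: eq_measurable_fun mg'.
rewrite -[RHS]integral_off0 //.
by apply: eq_integral => t ht; rewrite fg'.
Qed.

Lemma fineMl (r : R) (x : \bar R) : 0 <= r -> (0 <= x)%E -> fine (r%:E * x) = r * fine x.
Proof.
move=> r0; case: x => [x| |] // _.
move: r0; rewrite le_eqVlt => /predU1P[<-|r0]; first by rewrite mul0e mul0r.
by rewrite gt0_muley ?lte_fin // mulr0.
Qed.

Lemma measurable_fine_cone a d m (s : R) : ~~ odd a ->
  measurable_fun setT (fun t : R => t ^+ a * fine (cone d m (s + t ^+ 2))).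
Proof.
move=> ea.
have -> : (fun t : R => t ^+ a * fine (cone d m (s + t ^+ 2))) =
   fine \o (fun t : R => ((t ^+ a)%:E * cone d m (s + t ^+ 2))%E).
  by apply/funext => t /=; rewrite fineMl ?cone_ge0 ?even_expr_ge0.
apply: (measurableT_comp (@fine_measurable _ setT _)) => //.
exact: measurable_cone.
Qed.

Lemma addr_sqr_gt0 (s t : R) : 0 <= s -> t != 0 -> 0 < s + t ^+ 2.
Proof. by move=> s0 t0; rewrite ltr_wpDl // exprn_even_gt0. Qed.

Lemma Rintegral_cone a d m (s : R) : ~~ odd a -> 0 <= s ->
  Rintegral mu setT (fun t => t ^+ a * fine (cone d m (s + t ^+ 2))) =
  betac a m * fine (cone d (m + a).+1 s).
Proof.
move=> ea s0; rewrite /Rintegral.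
rewrite -fineMl ?betac_ge0 ?cone_ge0 // -integral_cone //.
congr fine; apply: eq_integral_off0; first exact: measurable_cone.
move=> t t0; rewrite EFinM fineK // cone_fin // addr_sqr_gt0 //.
Qed.

Lemma eq_Rintegral_off0 (f g : R -> R) : measurable_fun setT g ->
  (forall t, t != 0 -> f t = g t) -> Rintegral mu setT f = Rintegral mu setT g.
Proof.
move=> mg fg; rewrite /Rintegral; congr fine; apply: eq_integral_off0.
  exact/measurable_EFinP.
by move=> t t0; rewrite fg.
Qed.

Fixpoint mono (l : seq nat) (ts : seq R) : R :=
  if l is a :: l' then if ts is t :: ts' then t ^+ a * mono l' ts' else 1 else 1.

Fixpoint sumsq (ts : seq R) : R := if ts is t :: ts' then t ^+ 2 + sumsq ts' else 0.

Definition msize (l : seq nat) : nat := (sumn l + size l)%N.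

Fixpoint betas (l : seq nat) : R := if l is a :: l' then betac a (msize l') * betas l' else 1.

Lemma eq_iter_integral m (F G : seq R -> R) : (forall s, size s = m -> F s = G s) ->
  iter_integral m F = iter_integral m G.
Proof.
elim: m F G => [|m IH] F G FG /=; first exact: FG.
by apply: eq_Rintegral => t _; apply: IH => s sm; apply: FG; rewrite /= sm.
Qed.

(** The nested integrals are evaluated from the inside: each coordinate contributes a Beta factor
    and moves [cone d m] to the next [m]. The side condition excludes [s = 0] with no coordinate
    left, where [cone d 0] differs from [radial d]. *)
Lemma iter_integral_even d l (s k : R) : all (fun a => ~~ odd a) l ->
  0 <= s -> (0 < s) || (l != [::]) ->
  iter_integral (size l) (fun ts => k * (mono l ts * radial d (s + sumsq ts))) =
  k * (betas l * fine (cone d (msize l) s)).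
Proof.
elim: l s k => [|a l IH] s k /=.
  by move=> _ s0; rewrite orbF => s1; rewrite addr0 !mul1r cone0.
move=> /andP[ea el] s0 _.
rewrite (@eq_Rintegral_off0 _ (fun t => (k * betas l) * (t ^+ a * fine (cone d (msize l) (s + t ^+ 2))))); last 2 first.
- by apply: measurable_funM => //; exact: measurable_fine_cone.
- move=> t t0.
  rewrite (_ : k * betas l * _ = (k * t ^+ a) * (betas l * fine (cone d (msize l) (s + t ^+ 2)))); last by ring.
  rewrite -IH //; last 2 first.
  + by rewrite addr_ge0 // sqr_ge0.
  + by rewrite addr_sqr_gt0.
  by apply: eq_iter_integral => ts _; rewrite addrA; ring.
rewrite RintegralZ //; last 2 first.
- exact: measurable_fine_cone.
- by move=> t; rewrite mulr_ge0 ?even_expr_ge0 // fine_ge0 // cone_ge0.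
rewrite Rintegral_cone // /msize /=.
rewrite (_ : (sumn l + size l + a).+1 = (a + sumn l + (size l).+1)%N); last by lia.
ring.
Qed.

(** At the innermost odd exponent the remaining integral is an even function of that variable, so
    the integrand is odd in it. *)
Lemma iter_integral_odd d l (s k : R) : has odd l -> 0 <= s ->
  iter_integral (size l) (fun ts => k * (mono l ts * radial d (s + sumsq ts))) = 0.
Proof.
elim: l s k => [|a l IH] s k //= oal s0.
have eqF t : iter_integral (size l) (fun s1 => k * (t ^+ a * mono l s1 * radial d (s + (t ^+ 2 + sumsq s1)))) =
  iter_integral (size l) (fun s1 => (k * t ^+ a) * (mono l s1 * radial d ((s + t ^+ 2) + sumsq s1))).
  by apply: eq_iter_integral => ts _; rewrite addrA; ring.
under eq_Rintegral do rewrite eqF.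
have [ol|/negbTE ol] := boolP (has odd l).
  under eq_Rintegral do rewrite IH ?addr_ge0 ?sqr_ge0 //.
  by rewrite /Rintegral integral0.
have el : all (fun a => ~~ odd a) l by rewrite all_predC ol.
have oa : odd a by move: oal; rewrite ol orbF.
pose G t := (k * betas l) * (t * (t ^+ a.-1 * fine (cone d (msize l) (s + t ^+ 2)))).
have ea : ~~ odd a.-1 by case: (a) oa => //= n; rewrite negbK.
have mG : measurable_fun setT G.
  apply: measurable_funM => //; apply: measurable_funM => //; exact: measurable_fine_cone.
rewrite (@eq_Rintegral_off0 _ G) //; last first.
  move=> t t0; rewrite iter_integral_even //; last 2 first.
  + by rewrite addr_ge0 // sqr_ge0.
  + by rewrite addr_sqr_gt0.
  rewrite /G (_ : t ^+ a = t * t ^+ a.-1); first by ring.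
  by rewrite -exprS prednK //; case: (a) oa.
apply: Rintegral_odd => // t.
rewrite /G sqrrN; have -> : (- t) ^+ a.-1 = t ^+ a.-1.
  by rewrite exprNn -signr_odd (negbTE ea) mul1r.
ring.
Qed.

End Integrals.

(** * Moments of [mu_n] *)

Section Integrals.
Context {R : realType}.
Local Notation mu := (@lebesgue_measure R).
Local Notation chord := (fun t : R => Num.sqrt (1 - t ^+ 2)).

Lemma chord_in (t : R) : (0 <= 1 - t ^+ 2) = (t \in `[-1, 1]).
Proof.
by rewrite in_itv /= -ler_norml subr_ge0 -[leRHS](expr1n _ 2) -real_normK ?num_real // ler_pXn2r ?nnegrE.
Qed.

Lemma tpow_chord a m : (fun t => t ^+ a * tpow m (1 - t ^+ 2)) =
  (fun t => t ^+ a * chord t ^+ m) \_ `[-1, 1].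
Proof.
apply/funext => t; rewrite patchE mem_setE /tpow chord_in.
by case: ifP => //; rewrite mulr0.
Qed.

Lemma betacE a m : betac a m = Rintegral mu `[-1, 1] (fun t => t ^+ a * chord t ^+ m).
Proof. by rewrite /betac tpow_chord -Rintegral_mkcond. Qed.

Lemma continuous_chord : continuous chord.
Proof.
move=> t; apply: (@continuous_comp _ _ _ (fun t : R => 1 - t ^+ 2)); last exact: sqrt_continuous.
apply: cvgB; first exact: cvg_cst.
exact: exprn_continuous.
Qed.

Lemma continuous_chordX a m : continuous (fun t : R => t ^+ a * chord t ^+ m).
Proof.
move=> t; apply: cvgM; first exact: exprn_continuous.
apply: (@continuous_comp _ _ _ chord (fun x => x ^+ m)); first exact: continuous_chord.
exact: exprn_continuous.
Qed.

Lemma integrable_chordX a m : mu.-integrable `[-1, 1] (EFin \o (fun t : R => t ^+ a * chord t ^+ m)).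
Proof.
apply: continuous_compact_integrable; first exact: segment_compact.
by apply: continuous_subspaceT; exact: continuous_chordX.
Qed.

Lemma betac_split a m : betac a m.+2 = betac a m - betac a.+2 m :> R.
Proof.
rewrite !betacE -RintegralB //; try exact: integrable_chordX.
apply: eq_Rintegral => t; rewrite mem_setE -chord_in => t1.
by rewrite -(addn2 m) exprD sqr_sqrtr // -(addn2 a) exprD; ring.
Qed.

(** It vanishes at both endpoints, so its derivative [dantichord] integrates to 0, which is the
    recursion [betac_rec]. *)
Definition antichord a m (t : R) := t ^+ a.+1 * chord t ^+ m.+2.
Definition dantichord a m (t : R) := a.+1%:R * (t ^+ a * chord t ^+ m.+2) - m.+2%:R * (t ^+ a.+2 * chord t ^+ m).

Lemma is_derive_chordX m (t : R) : 0 < 1 - t ^+ 2 ->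
  is_derive t 1 (fun t => chord t ^+ m.+2) (- (m.+2%:R * (t * chord t ^+ m))).
Proof.
move=> t1.
have h1 : is_derive t 1 (fun t : R => 1 - t ^+ 2) (- (2 * t)).
  have hX : is_derive t 1 (fun x : R => x ^+ 2) ((2%:R * t ^+ 1) *: 1).
    by apply: DeriveDef; [exact: exprn_derivable|rewrite exp_derive].
  apply: (is_derive_eq (is_deriveB _ hX)).
  by rewrite sub0r expr1 /GRing.scale /= mulr1.
have h2 := @is_derive1_sqrt R _ t1.
have h3 := @is_derive1_comp R Num.sqrt (fun t => 1 - t ^+ 2) t _ _ h2 h1.
have h4 : is_derive (chord t) 1 (fun x : R => x ^+ m.+2) ((m.+2%:R * chord t ^+ m.+1) *: 1).
  by apply: DeriveDef; [exact: exprn_derivable|rewrite exp_derive].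
apply: (is_derive_eq (@is_derive1_comp R (fun x => x ^+ m.+2) chord t _ _ h4 h3)).
rewrite /GRing.scale /= mulr1 exprS.
have c0 : chord t != 0 by rewrite gt_eqF // sqrtr_gt0.
field.
exact: c0.
Qed.

Lemma is_derive_antichord a m (t : R) : 0 < 1 - t ^+ 2 ->
  is_derive t 1 (antichord a m) (dantichord a m t).
Proof.
move=> t1.
have hX : is_derive t 1 (fun x : R => x ^+ a.+1) ((a.+1%:R * t ^+ a) *: 1).
  by apply: DeriveDef; [exact: exprn_derivable|rewrite exp_derive].
apply: (is_derive_eq (is_deriveM hX (is_derive_chordX m t t1))).
rewrite /dantichord /GRing.scale /= !exprS; ring.
Qed.

Lemma continuous_dantichord a m : continuous (dantichord a m).
Proof.
move=> t; apply: cvgB; (apply: cvgM; [exact: cvg_cst|exact: continuous_chordX]).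
Qed.

Lemma betac_rec a m : a.+1%:R * betac a m.+2 = m.+2%:R * betac a.+2 m :> R.
Proof.
have c1 : chord 1 = 0 by rewrite expr1n subrr sqrtr0.
have cN1 : chord (-1) = 0 by rewrite sqrrN expr1n subrr sqrtr0.
have h : (\int[mu]_(t in `[(-1)%R, 1%R]) (dantichord a m t)%:E = 0)%E.
  rewrite (@continuous_FTC2 _ _ (antichord a m)) //.
  - by rewrite /antichord c1 cN1 !expr0n !mulr0 subee.
  - by apply: continuous_subspaceT; exact: continuous_dantichord.
  - split.
    + move=> x x1; have [] // := is_derive_antichord a m x _.
      move: x1; rewrite in_itv /= -ltr_norml => x1.
      by rewrite subr_gt0 -[ltRHS](expr1n _ 2) -real_normK ?num_real // ltr_pXn2r ?nnegrE.
    + by apply: cvg_at_right_filter; exact: continuous_chordX.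
    + by apply: cvg_at_left_filter; exact: continuous_chordX.
  - move=> x x1; rewrite derive1E.
    apply: (@derive_val _ _ _ _ _ _ _ (is_derive_antichord a m x _)).
    move: x1; rewrite in_itv /= -ltr_norml => x1.
    by rewrite subr_gt0 -[ltRHS](expr1n _ 2) -real_normK ?num_real // ltr_pXn2r ?nnegrE.
have iZ (b j k : nat) : mu.-integrable `[-1, 1] (EFin \o (fun t : R => k%:R * (t ^+ b * chord t ^+ j))).
  apply: continuous_compact_integrable; first exact: segment_compact.
  by apply: continuous_subspaceT => t; apply: cvgM; [exact: cvg_cst|exact: continuous_chordX].
have : Rintegral mu `[-1, 1] (dantichord a m) = 0 by rewrite /Rintegral h.
rewrite /dantichord RintegralB // !RintegralZl //; try exact: integrable_chordX.
by rewrite -!betacE => /eqP; rewrite subr_eq0 => /eqP.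
Qed.

Lemma betac_step a m : (a + m + 3)%:R * betac a.+2 m = a.+1%:R * betac a m :> R.
Proof.
have := betac_rec a m.
by rewrite betac_split -(addn1 a) -(addn2 m) !natrD; lra.
Qed.

Lemma betac_stepm a m : (a + m + 3)%:R * betac a m.+2 = m.+2%:R * betac a m :> R.
Proof.
have := betac_step a m; have := betac_split a m.
by rewrite -(addn1 a) -(addn2 m) !natrD => ->; lra.
Qed.

Lemma is_derive_antichord1 a (t : R) : 0 < 1 - t ^+ 2 ->
  is_derive t 1 (fun t => t ^+ a.+1 * chord t) (a.+1%:R * (t ^+ a * chord t) - t ^+ a.+2 / chord t).
Proof.
move=> t1.
have h1 : is_derive t 1 (fun t : R => 1 - t ^+ 2) (- (2 * t)).
  have hX : is_derive t 1 (fun x : R => x ^+ 2) ((2%:R * t ^+ 1) *: 1).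
    by apply: DeriveDef; [exact: exprn_derivable|rewrite exp_derive].
  apply: (is_derive_eq (is_deriveB _ hX)).
  by rewrite sub0r expr1 /GRing.scale /= mulr1.
have h2 := @is_derive1_sqrt R _ t1.
have h3 := @is_derive1_comp R Num.sqrt (fun t => 1 - t ^+ 2) t _ _ h2 h1.
have hX : is_derive t 1 (fun x : R => x ^+ a.+1) ((a.+1%:R * t ^+ a) *: 1).
  by apply: DeriveDef; [exact: exprn_derivable|rewrite exp_derive].
apply: (is_derive_eq (is_deriveM hX h3)).
have c0 : chord t != 0 by rewrite gt_eqF // sqrtr_gt0.
rewrite /GRing.scale /=; set c := Num.sqrt _ in c0 *.
rewrite !exprS; field.
exact: c0.
Qed.

Lemma sqr_lt1 (x : R) : -1 < x < 1 -> 0 < 1 - x ^+ 2.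
Proof.
rewrite -ltr_norml => x1.
by rewrite subr_gt0 -[ltRHS](expr1n _ 2) -real_normK ?num_real // ltr_pXn2r ?nnegrE.
Qed.

Lemma continuous_chordV a (x : R) : -1 < x < 1 -> {for x, continuous (fun t : R => t ^+ a / chord t)}.
Proof.
move=> x1; apply: cvgM; first exact: exprn_continuous.
apply: cvgV; last exact: continuous_chord.
by rewrite gt_eqF // sqrtr_gt0 sqr_lt1.
Qed.

Lemma powR_half2 (t : R) : t \in `[-1, 1] -> (1 - t ^+ 2) `^ ((2%:R - 3) / 2) = (chord t)^-1.
Proof.
rewrite -chord_in => t1; rewrite (_ : (2%:R - 3) / 2 = - 2^-1); last by field.
by rewrite powRN powR12_sqrt.
Qed.

Lemma measurable_powR_sq (r : R) : measurable_fun setT (fun t : R => (1 - t ^+ 2) `^ r).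
Proof.
apply: (measurableT_comp (measurable_powR r)).
by apply: measurable_funB => //; exact: measurable_funX.
Qed.

Lemma measurable_chordV a (D : set R) : measurable D -> D `<=` `[-1, 1] ->
  measurable_fun D (fun t : R => t ^+ a / chord t).
Proof.
move=> mD D1.
apply: (eq_measurable_fun (fun t : R => t ^+ a * (1 - t ^+ 2) `^ ((2%:R - 3) / 2))).
  by move=> t; rewrite inE => /D1 t1; rewrite powR_half2.
apply: (measurable_funS measurableT) => //.
by apply: measurable_funM; [exact: measurable_funX|exact: measurable_powR_sq].
Qed.

(** For [n = 2] the weight (1-t^2)^(-1/2) blows up at the endpoints. The fundamental theorem is
    therefore applied on the intervals from [- cut i] to [cut i], and monotone convergence passes to
    the limit. *)
Let cut (i : nat) : R := 1 - i.+2%:R^-1.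

Let cut_gt0 i : 0 < cut i.
Proof. by rewrite subr_gt0 invf_lt1 ?ltr0n // ltr1n. Qed.

Let cut_lt1 i : cut i < 1.
Proof. by rewrite gtrBl invr_gt0 ltr0n. Qed.

Let cvg_cut : cut i @[i --> \oo] --> (1 : R).
Proof.
rewrite -[X in _ --> X]subr0; apply: cvgB; first exact: cvg_cst.
have := @cvg_harmonic R; rewrite -(cvg_shiftS _) /harmonic /=.
by [].
Qed.

Let bigcup_cut : \bigcup_i `[- cut i, cut i]%classic = `]-1, 1[%classic.
Proof.
apply/seteqP; split => x /=.
  move=> [i _] /=; rewrite !in_itv /= => /andP[x1 x2].
  by rewrite (lt_le_trans _ x1) ?ltrN2 ?cut_lt1 // (le_lt_trans x2) // cut_lt1.
rewrite in_itv /= -ltr_norml => x1.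
have e0 : 0 < 1 - `|x| by rewrite subr_gt0.
have := @near_infty_natSinv_lt R (PosNum e0).
move=> [N _ /= hN]; exists N => //=.
rewrite in_itv /= -ler_norml /cut.
have := hN N (leqnn N) => /= hN'.
rewrite lerBrDr -lerBrDl ltW // (le_lt_trans _ hN') // lef_pV2 ?posrE ?ltr0n // ler_nat //.
Qed.

Let cutE (i : nat) : set R := `[- cut i, cut i]%classic.

Let sub_cutE i x : cutE i x -> -1 < x < 1.
Proof.
move=> xi; have : (\bigcup_i cutE i) x by exists i.
by rewrite bigcup_cut /= in_itv.
Qed.

Let nd_cutE : nondecreasing_seq cutE.
Proof.
move=> i j ij; rewrite subsetEset => x; rewrite /cutE /= !in_itv /= -!ler_norml => /le_trans; apply.
by rewrite lerD2l lerN2 lef_pV2 ?posrE ?ltr0n // ler_nat.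
Qed.

Let integral_cutE a i : (\int[mu]_(x in cutE i) (x ^+ a.+2 / chord x)%:E =
  \int[mu]_(x in cutE i) (a.+1%:R * (x ^+ a * chord x ^+ 1))%:E
   - ((cut i) ^+ a.+1 * chord (cut i) - (- cut i) ^+ a.+1 * chord (- cut i))%:E)%E.
Proof.
have i1 : mu.-integrable (cutE i) (EFin \o (fun x : R => a.+1%:R * (x ^+ a * chord x ^+ 1))).
  apply: continuous_compact_integrable; first exact: segment_compact.
  by apply: continuous_subspaceT => t; apply: cvgM; [exact: cvg_cst|exact: continuous_chordX].
have cV x : x \in `[- cut i, cut i] -> {for x, continuous (fun t : R => t ^+ a.+2 / chord t)}.
  by move=> xi; apply: continuous_chordV; apply: (sub_cutE i).
have i2 : mu.-integrable (cutE i) (EFin \o (fun x : R => x ^+ a.+2 / chord x)).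
  apply: continuous_compact_integrable; first exact: segment_compact.
  by apply: continuous_in_subspaceT => x; rewrite inE; exact: cV.
rewrite EFinB -(@continuous_FTC2 _ (fun x => a.+1%:R * (x ^+ a * chord x ^+ 1) - x ^+ a.+2 / chord x)
   (fun t => t ^+ a.+1 * chord t)) //.
- rewrite integralB_EFin //.
  have := integrable_fin_num _ i1; have := integrable_fin_num _ i2.
  move=> /(_ (measurable_itv _)) f2 /(_ (measurable_itv _)) f1.
  rewrite -(fineK f1) -(fineK f2) -!EFinB; congr (_ %:E); ring.
- by rewrite gtrN.
- apply: continuous_in_subspaceT => x; rewrite inE => xi; apply: cvgB; last exact: cV.
  by apply: cvgM; [exact: cvg_cst|exact: continuous_chordX].
- split.
  + move=> x xi; have [] // := is_derive_antichord1 a x _.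
    by apply/sqr_lt1/(sub_cutE i); apply: subset_itv_oo_cc xi.
  + by apply: cvg_at_right_filter; exact: (continuous_chordX a.+1 1).
  + by apply: cvg_at_left_filter; exact: (continuous_chordX a.+1 1).
- move=> x xi; rewrite derive1E expr1.
  apply: (@derive_val _ _ _ _ _ _ _ (is_derive_antichord1 a x _)).
  by apply/sqr_lt1/(sub_cutE i); apply: subset_itv_oo_cc xi.
Qed.

Lemma integral_chordV a : ~~ odd a ->
  (\int[mu]_(x in `](-1)%R, 1%R[) (x ^+ a.+2 / chord x)%:E = (a.+1%:R * betac a 1)%:E)%E.
Proof.
move=> ea.
have lhs : (\int[mu]_(x in cutE i) (x ^+ a.+2 / chord x)%:E @[i --> \oo] -->
   \int[mu]_(x in `](-1)%R, 1%R[) (x ^+ a.+2 / chord x)%:E)%E.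
  rewrite -bigcup_cut; apply: ge0_nondecreasing_set_cvg_integral => //.
  - by move=> i; apply: measurable_itv.
  - move=> i; apply/measurable_EFinP; apply: measurable_chordV; first exact: measurable_itv.
    move=> x /sub_cutE /andP[x1 x2]; rewrite /= in_itv /= !ltW //.
  - move=> i x _; rewrite lee_fin mulr_ge0 ?invr_ge0 ?sqrtr_ge0 //.
    by rewrite exprn_even_ge0 //= negbK.
have rhs1 : (\int[mu]_(x in cutE i) (a.+1%:R * (x ^+ a * chord x ^+ 1))%:E @[i --> \oo] -->
   (a.+1%:R * betac a 1)%:E)%E.
  have -> : (a.+1%:R * betac a 1)%:E = (\int[mu]_(x in `](-1)%R, 1%R[) (a.+1%:R * (x ^+ a * chord x ^+ 1))%:E)%E.
    rewrite -(@integral_itv_bndoo _ _ _ _ true false); last first.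
      apply/measurable_EFinP; apply: measurable_funM => //; apply: (measurable_funS measurableT) => //.
      by apply: continuous_measurable_fun; exact: continuous_chordX.
    rewrite betacE -RintegralZl //; last exact: integrable_chordX.
    rewrite /Rintegral fineK //.
    have := integrable_fin_num _ (integrableZl _ a.+1%:R (integrable_chordX a 1)).
    by move=> /(_ (measurable_itv _) (measurable_itv _)); under eq_integral do rewrite /= -EFinM.
  rewrite -bigcup_cut; apply: ge0_nondecreasing_set_cvg_integral => //.
  - by move=> i; apply: measurable_itv.
  - move=> i; apply/measurable_EFinP; apply: measurable_funM => //; apply: (measurable_funS measurableT) => //.
    by apply: continuous_measurable_fun; exact: continuous_chordX.
  - move=> i x _; rewrite lee_fin mulr_ge0 // mulr_ge0 //.
    exact: even_expr_ge0.
have rhs2 : ((cut i) ^+ a.+1 * chord (cut i) - (- cut i) ^+ a.+1 * chord (- cut i))%:E @[i --> \oo] --> 0%E.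
  have c1 : chord 1 = 0 by rewrite expr1n subrr sqrtr0.
  have cN1 : chord (-1) = 0 by rewrite sqrrN expr1n subrr sqrtr0.
  apply: cvg_EFin; first exact: nearW.
  rewrite (_ : 0 = (1:R) ^+ a.+1 * chord 1 - (-1) ^+ a.+1 * chord (-1)); last by rewrite c1 cN1 !mulr0 subr0.
  apply: cvgB.
    apply: (cvg_comp cut (fun t => t ^+ a.+1 * chord t)); first exact: cvg_cut.
    exact: (continuous_chordX a.+1 1).
  apply: (cvg_comp (fun i => - cut i) (fun t => t ^+ a.+1 * chord t)); first by apply: cvgN; exact: cvg_cut.
  exact: (continuous_chordX a.+1 1).
have := cvgeB _ rhs1 rhs2.
move=> /(_ _ isT); rewrite sube0 => rhs.
apply: (cvg_unique _ lhs) => //.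
apply: cvg_trans rhs; apply: near_eq_cvg; apply: nearW => i.
by rewrite -integral_cutE.
Qed.

End Integrals.

Section Integrals.
Context {R : realType}.
Local Notation mu := (@lebesgue_measure R).
Local Notation chord := (fun t : R => Num.sqrt (1 - t ^+ 2)).

Lemma betac_gt0 m : 0 < betac 0 m :> R.
Proof.
set e : R := Num.sqrt (3 / 4) ^+ m.
have e0 : 0 < e by rewrite exprn_gt0 // sqrtr_gt0 divr_gt0.
suff h : e <= betac 0 m by exact: lt_le_trans h.
rewrite -lee_fin -betac_fin //.
pose D : set R := `[- (1 / 2), 1 / 2]%classic.
have -> : e%:E = (\int[mu]_(x in D) (cst e%:E) x)%E.
  rewrite integral_cst; last exact: measurable_itv.
  rewrite /= /D lebesgue_measure_itv /= lte_fin gtrN ?divr_gt0 // -EFinB -EFinM; congr (_ %:E).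
  by field.
apply: (@le_trans _ _ (\int[mu]_(x in D) (x ^+ 0 * tpow m (1 - x ^+ 2))%:E)%E).
  apply: ge0_le_integral => //=.
  - exact: measurable_itv.
  - by move=> x _; rewrite lee_fin ltW.
  - apply/measurable_EFinP; apply: measurable_funTS; exact: measurable_sq1.
  - move=> x; rewrite /D /= in_itv /= -ler_norml => xD.
    have x34 : 3 / 4 <= 1 - x ^+ 2.
      have : `|x| ^+ 2 <= (1 / 2) ^+ 2 by rewrite ler_pXn2r ?nnegrE.
      rewrite real_normK ?num_real //; lra.
    have x0 : 0 <= 1 - x ^+ 2 by lra.
    rewrite lee_fin expr0 mul1r /tpow x0 /e.
    by apply: lerXn2r; rewrite ?nnegrE ?sqrtr_ge0 // ler_wsqrtr.
apply: ge0_subset_integral => //=.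
- exact: measurable_itv.
- by apply/measurable_EFinP; exact: measurable_sq1.
- by move=> x _; rewrite lee_fin expr0 mul1r tpow_ge0.
Qed.

Lemma mu_weightE n (t : R) : t \in `[-1, 1] -> mu_weight n.+3 t = chord t ^+ n.
Proof.
rewrite -chord_in => t1; rewrite /mu_weight.
have -> : (n.+3%:R - 3) / 2 = 2^-1 * n%:R :> R by rewrite -addn3 natrD; field.
by rewrite powRrM powR12_sqrt // powR_mulrn // sqrtr_ge0.
Qed.

Definition wmom n a : R := Rintegral mu `[-1, 1] (fun t => t ^+ a * mu_weight n t).

Lemma wmom3 n a : wmom n.+3 a = betac a n.
Proof.
rewrite betacE; apply: eq_Rintegral => t; rewrite mem_setE => t1.
by rewrite mu_weightE.
Qed.

Lemma measurable_wmom n a : measurable_fun setT (fun t : R => t ^+ a * mu_weight n t).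
Proof. by apply: measurable_funM; [exact: measurable_funX|exact: measurable_powR_sq]. Qed.

(** With c^2 = 1 - t^2 one has t^a / c = t^a c + t^(a+2) / c. *)
Lemma integral_chordV0 a : ~~ odd a ->
  (\int[mu]_(x in `](-1)%R, 1%R[) (x ^+ a / chord x)%:E = (a.+2%:R * betac a 1)%:E)%E.
Proof.
move=> ea.
have mV b : measurable_fun (`]-1, 1[%classic : set R) (fun t : R => t ^+ b / chord t).
  by apply: measurable_chordV => // x; apply: subset_itv_oo_cc.
transitivity (\int[mu]_(x in `](-1)%R, 1%R[) ((x ^+ a * chord x ^+ 1)%:E + (x ^+ a.+2 / chord x)%:E))%E.
  apply: eq_integral => x; rewrite mem_setE in_itv /= => /sqr_lt1 x1.
  rewrite -EFinD; congr (_ %:E).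
  have c0 : chord x != 0 by rewrite gt_eqF // sqrtr_gt0.
  have c2 : chord x ^+ 2 = 1 - x ^+ 2 by rewrite sqr_sqrtr // ltW.
  rewrite -(addn2 a) exprD; move: c0 c2; set c := chord x => c0 c2.
  rewrite (_ : x ^+ 2 = 1 - c ^+ 2); last by rewrite c2; ring.
  by field.
rewrite ge0_integralD //; last 4 first.
- move=> x _; rewrite lee_fin mulr_ge0 ?expr1 ?sqrtr_ge0 //; exact: even_expr_ge0.
- apply/measurable_EFinP; apply: measurable_funTS; apply: continuous_measurable_fun.
  exact: continuous_chordX.
- move=> x _; rewrite lee_fin mulr_ge0 ?invr_ge0 ?sqrtr_ge0 //.
  by apply: even_expr_ge0; rewrite /= negbK.
- by apply/measurable_EFinP; exact: mV.
rewrite integral_chordV // -(@integral_itv_bndoo _ _ _ _ true false); last first.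
  apply/measurable_EFinP; apply: measurable_funTS; apply: continuous_measurable_fun.
  exact: continuous_chordX.
have h : (\int[mu]_(z in `[(-1)%R, 1%R]) (z ^+ a * chord z ^+ 1)%:E)%E = (betac a 1)%:E.
  rewrite betacE /Rintegral fineK //.
  exact: (integrable_fin_num _ (integrable_chordX a 1)).
rewrite h -EFinD; congr (_ %:E).
by rewrite -(addn1 a.+1) natrD; ring.
Qed.

Lemma wmom2_fin a : ~~ odd a ->
  (\int[mu]_(x in `[(-1)%R, 1%R]) (x ^+ a * mu_weight 2 x)%:E = (a.+2%:R * betac a 1)%:E)%E.
Proof.
move=> ea; rewrite -integral_chordV0 // (@integral_itv_bndoo _ _ _ _ true false); last first.
  apply/measurable_EFinP; apply: measurable_funTS; exact: measurable_wmom.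
apply: eq_integral => x; rewrite mem_setE => /subset_itv_oo_cc x1.
by rewrite /mu_weight powR_half2.
Qed.

Lemma wmom2 a : ~~ odd a -> wmom 2 a = a.+2%:R * betac a 1.
Proof. by move=> ea; rewrite /wmom /Rintegral wmom2_fin. Qed.

Lemma integrable_wmom n a : (2 <= n)%N ->
  mu.-integrable `[-1, 1] (EFin \o (fun t : R => t ^+ a * mu_weight n t)).
Proof.
case: n => [//|[//|[_|n _]]]; last first.
  apply: le_integrable (integrable_chordX a n); first exact: measurable_itv.
    by apply/measurable_EFinP; apply: measurable_funTS; exact: measurable_wmom.
  by move=> t t1; rewrite /= mu_weightE.
have i0 : mu.-integrable `[-1, 1] (EFin \o (fun t : R => t ^+ 0 * mu_weight 2 t)).
  apply/integrableP; split.
    by apply/measurable_EFinP; apply: measurable_funTS; exact: measurable_wmom.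
  rewrite (_ : integral _ _ _ = (2%:R * betac 0 1)%:E) ?ltry // -(wmom2_fin 0) //.
  apply: eq_integral => x _; rewrite /= ger0_norm // expr0 mul1r powR_ge0 //.
apply: le_integrable i0; first exact: measurable_itv.
  by apply/measurable_EFinP; apply: measurable_funTS; exact: measurable_wmom.
move=> x; rewrite /= in_itv /= -ler_norml => x1.
rewrite lee_fin !normrM ler_wpM2r // normrX expr0 normr1.
by rewrite exprn_ile1.
Qed.

Lemma wmom_odd n a : odd a -> wmom n a = 0.
Proof.
move=> oa; rewrite /wmom Rintegral_mkcond Rintegral_odd //.
  by apply/(measurable_restrictT _ _).1 => //; apply: measurable_funTS; exact: measurable_wmom.
move=> t; rewrite !patchE !mem_setE !in_itv /= lerNl opprK lerNl andbC.
case: ifP => _; last by rewrite oppr0.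
rewrite /mu_weight sqrrN (_ : (- t) ^+ a = - t ^+ a) ?mulNr //.
by rewrite exprNn -signr_odd oa expr1 mulN1r.
Qed.

(** For [n] at least 3 this is [betac_step] with m = n - 3. For [n = 2] the factor [a.+2] in [wmom2]
    brings the step for m = 1 into the same form. *)
Lemma wmom_rec n a : (2 <= n)%N -> (n + a)%:R * wmom n a.+2 = a.+1%:R * wmom n a.
Proof.
have [oa|ea] := boolP (odd a).
  by rewrite !wmom_odd ?mulr0 //= negbK.
case: n => [//|[//|[_|n _]]]; last first.
  by rewrite !wmom3 -betac_step; congr (_%:R * _); lia.
have h := @betac_step R a 1.
rewrite !wmom2 //=; last by rewrite negbK.
rewrite mulrA mulrAC (_ : (a.+4 = a + 1 + 3)%N) //; last by lia.
by rewrite -mulrA [_ * (a + 1 + 3)%:R]mulrC h add2n; ring.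
Qed.

Lemma wmom0 n : (2 <= n)%N -> wmom n 0 != 0.
Proof.
case: n => [//|[//|[_|n _]]].
  by rewrite wmom2 // mulf_neq0 // gt_eqF // betac_gt0.
by rewrite wmom3 gt_eqF // betac_gt0.
Qed.

End Integrals.

Set Implicit Arguments. Unset Strict Implicit. Unset Printing Implicit Defensive.

Section Moments.
Context {R : realType}.
Local Notation mu := (@lebesgue_measure R).

(** The moments of mu_n, by their recursion: 1*3*...*(m-1) / (n(n+2)...(n+m-2)) for even [m], 0 for
    odd [m]. *)
Fixpoint mom (n m : nat) : R :=
  match m with 0 => 1 | 1 => 0 | m'.+2 => m'.+1%:R / (n + m')%:R * mom n m' end.

Lemma mom_odd n m : odd m -> mom n m = 0.
Proof.
elim/ltn_ind: m => -[|[|m]] IH //=; rewrite negbK => om.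
by rewrite IH ?mulr0.
Qed.

Definition Emom n (f : {poly R}) : R := \sum_(i < size f) f`_i * mom n i.

Lemma wmomE n m : (2 <= n)%N -> wmom n m = mom n m * wmom n 0 :> R.
Proof.
move=> n2; elim/ltn_ind: m => -[|[|m]] IH; first by rewrite mul1r.
  by rewrite wmom_odd // mul0r.
have := wmom_rec n m n2 (R := R); rewrite (IH m) //= => h.
have nm0 : (n + m)%:R != 0 :> R by rewrite pnatr_eq0; lia.
apply: (mulfI nm0); rewrite h.
by move: nm0 {h}; move: (n + m)%:R => q q0; field.
Qed.

Lemma mu_integral_poly n (f : {poly R}) : (2 <= n)%N -> mu_integral n (fun t => f.[t]) = Emom n f.
Proof.
move=> n2; rewrite /mu_integral /Emom.
have -> : Rintegral mu `[-1, 1] (mu_weight n) = wmom n 0.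
  by apply: eq_Rintegral => t _; rewrite expr0 mul1r.
have w0 := wmom0 n n2 (R := R).
apply: (mulIf w0); rewrite divfK //.
suff h k (c : nat -> R) : Rintegral mu `[-1, 1] (fun t => (\sum_(i < k) c i * t ^+ i) * mu_weight n t) =
    \sum_(i < k) c i * wmom n i.
  rewrite -[RHS](_ : \sum_(i < size f) f`_i * wmom n i = _).
    by rewrite -h; apply: eq_Rintegral => t _; rewrite horner_coef.
  by rewrite mulr_suml; apply: eq_bigr => i _; rewrite wmomE // mulrA.
have iZ i : mu.-integrable `[-1, 1] (EFin \o (fun t : R => c i * (t ^+ i * mu_weight n t))).
  have := integrableZl _ (c i) (integrable_wmom n i n2) => /(_ (measurable_itv _)).
  by apply: le_integrable; [exact: measurable_itv
   |apply/measurable_EFinP; apply: measurable_funM => //; apply: measurable_funTS; exact: measurable_wmom|].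
suff [_ ->] : mu.-integrable `[-1, 1] (EFin \o (fun t : R => (\sum_(i < k) c i * t ^+ i) * mu_weight n t)) /\
   Rintegral mu `[-1, 1] (fun t => (\sum_(i < k) c i * t ^+ i) * mu_weight n t) =
    \sum_(i < k) c i * wmom n i by [].
elim: k => [|k [IHi IH]].
  split.
    rewrite (_ : EFin \o _ = cst 0%E) ?integrable0 //.
    by apply/funext => t /=; rewrite big_ord0 mul0r.
  under eq_Rintegral do rewrite big_ord0 mul0r.
  by rewrite big_ord0 /Rintegral integral0.
have eqf : (fun t : R => (\sum_(i < k.+1) c i * t ^+ i) * mu_weight n t) =
   fun t : R => (\sum_(i < k) c i * t ^+ i) * mu_weight n t + c k * (t ^+ k * mu_weight n t).
  by apply/funext => t; rewrite big_ord_recr /= mulrDl mulrA.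
rewrite eqf; split.
  have := integrableD _ IHi (iZ k); apply; exact: measurable_itv.
rewrite RintegralD; [|exact: measurable_itv|exact: IHi|exact: iZ].
rewrite RintegralZl; [|exact: measurable_itv|exact: integrable_wmom].
by rewrite IH big_ord_recr.
Qed.

Lemma EmomE n k (f : {poly R}) : (size f <= k)%N -> Emom n f = \sum_(i < k) f`_i * mom n i.
Proof.
move=> fk; rewrite /Emom (big_ord_widen k (fun i => f`_i * mom n i) fk) big_mkcond /=.
apply: eq_bigr => i _; case: ltnP => // h.
by rewrite nth_default ?mul0r.
Qed.

Lemma EmomD n (f g : {poly R}) : Emom n (f + g) = Emom n f + Emom n g.
Proof.
pose k := maxn (size f) (size g).
rewrite (@EmomE _ k (f + g)) ?size_polyD // (@EmomE _ k f) ?leq_maxl // (@EmomE _ k g) ?leq_maxr //.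
by rewrite -big_split; apply: eq_bigr => i _; rewrite coefD mulrDl.
Qed.

Lemma EmomZ n c (f : {poly R}) : Emom n (c *: f) = c * Emom n f.
Proof.
rewrite (@EmomE _ (size f)) ?size_scale_leq // /Emom mulr_sumr.
by apply: eq_bigr => i _; rewrite coefZ mulrA.
Qed.

Lemma EmomN n (f : {poly R}) : Emom n (- f) = - Emom n f.
Proof. by rewrite -scaleN1r EmomZ mulN1r. Qed.

End Moments.

(** * Moments of a spherical design *)

Section Moments.
Context {R : realType}.

(** Two more at exponent [i] act on the factor of that coordinate through its exponent
    ([betac_step]) and on the factors before it through their power ([betac_stepm]); the resulting
    ratios telescope. *)
Lemma betas_incr (l : seq nat) i : (i < size l)%N ->
  (msize l + 2)%:R * betas (set_nth 0%N l i (nth 0%N l i).+2) = (nth 0%N l i).+1%:R * betas l :> R.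
Proof.
elim: l i => [|a l IH] [|i] //= hi.
  have -> : (msize (a :: l) + 2 = a + msize l + 3)%N by rewrite /msize /=; lia.
  by rewrite !mulrA betac_step.
have il := IH i hi.
set l' := set_nth _ _ _ _.
have ml' : msize l' = (msize l).+2.
  have hi' : (i < size l)%N := hi.
  rewrite /msize sumn_set_nth size_set_nth (maxn_idPr hi') hi'.
  have : (nth 0 l i <= sumn l)%N.
    by rewrite (perm_sumn (perm_to_rem (mem_nth 0%N hi'))) /= leq_addr.
  by lia.
rewrite ml'.
have h1 := betac_stepm a (msize l) (R := R).
have -> : (msize (a :: l) + 2 = a + msize l + 3)%N by rewrite /msize /=; lia.
rewrite mulrA h1 -addn2 mulrAC il; ring.
Qed.

Lemma mono_prod (l : seq nat) (ts : seq R) : size ts = size l ->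
  mono l ts = \prod_(i < size l) ts`_i ^+ nth 0%N l i.
Proof.
elim: l ts => [|a l IH] [|t ts] //= => [_|[hs]]; first by rewrite big_ord0.
by rewrite big_ord_recl IH.
Qed.

Lemma sumsq_sum n (ts : seq R) : size ts = n -> sumsq ts = \sum_(i < n) ts`_i ^+ 2.
Proof.
elim: ts n => [|t ts IH] [|n] //= => [_|[hs]]; first by rewrite big_ord0.
by rewrite big_ord_recl (IH n).
Qed.

Definition expo n (a : 'I_n -> nat) : seq nat := [seq a i | i <- enum 'I_n].

Lemma size_expo n (a : 'I_n -> nat) : size (expo a) = n.
Proof. by rewrite size_map size_enum_ord. Qed.

Lemma nth_expo n (a : 'I_n -> nat) (i : 'I_n) : nth 0%N (expo a) i = a i.
Proof. by rewrite (nth_map i) ?size_enum_ord // nth_ord_enum. Qed.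

Lemma sumn_expo n (a : 'I_n -> nat) : sumn (expo a) = (\sum_i a i)%N.
Proof. by rewrite sumnE big_map big_enum. Qed.

(** By homogeneity a monomial of degree d at x/|x| is its value at x times |x|^(-d), the factor that
    [radial] encodes. *)
Lemma Rn_integral_mono n (a : {ffun 'I_n -> nat}) :
  Rn_integral (fun x : 'rV[R]_n => if (0 < eucl_norm x <= 1)
     then eval_poly [:: (1, a)] ((eucl_norm x)^-1 *: x) else 0) =
  iter_integral (size (expo a)) (fun ts => 1 * (mono (expo a) ts * radial (\sum_i a i) (0 + sumsq ts))).
Proof.
rewrite /Rn_integral size_expo; apply: eq_iter_integral => s sn.
set x := \row_(i < n) s`_i.
have xx : dotp x x = sumsq s.
  by rewrite (sumsq_sum sn) /dotp; apply: eq_bigr => i _; rewrite !mxE -expr2.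
have ss0 : 0 <= sumsq s by rewrite (sumsq_sum sn) sumr_ge0 // => i _; rewrite sqr_ge0.
rewrite /eucl_norm xx mul1r add0r /radial sqrtr_gt0.
have -> : (Num.sqrt (sumsq s) <= 1) = (sumsq s <= 1).
  by rewrite -{1}(@sqrtr1 R) ler_psqrt ?nnegrE.
case: ifP => // _; last by rewrite mulr0.
rewrite /eval_poly big_seq1 /= mul1r mono_prod ?size_expo //.
under eq_bigr do rewrite mxE exprMn.
rewrite big_split /= mulrC; congr (_ * _).
  by apply: eq_bigr => i _; rewrite mxE nth_expo.
by rewrite -exprVn expr_sum.
Qed.

Definition bump2 n (i : 'I_n) (a : {ffun 'I_n -> nat}) : {ffun 'I_n -> nat} :=
  [ffun j => a j + (if j == i then 2 else 0)]%N.

Lemma expo_bump2 n (i : 'I_n) (a : {ffun 'I_n -> nat}) :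
  expo (bump2 i a) = set_nth 0%N (expo a) i (nth 0%N (expo a) i).+2.
Proof.
apply: (@eq_from_nth _ 0%N).
  by rewrite size_set_nth !size_expo; apply/esym/maxn_idPr.
move=> j; rewrite size_expo => jn; rewrite nth_set_nth /=.
rewrite -[j]/(val (Ordinal jn)) !nth_expo ffunE -val_eqE /=.
by case: eqP => [e|_]; rewrite ?addn0 // addn2; congr (a _).+2; apply: val_inj.
Qed.

Lemma sum_bump2 n (i : 'I_n) (a : {ffun 'I_n -> nat}) : (\sum_j bump2 i a j = \sum_j a j + 2)%N.
Proof.
under eq_bigr do rewrite ffunE.
by rewrite big_split /= -big_mkcond /= big_pred1_eq.
Qed.

Lemma bump2_odd n (i : 'I_n) (a : {ffun 'I_n -> nat}) : has odd (expo (bump2 i a)) = has odd (expo a).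
Proof.
rewrite !has_map; apply: eq_has => j /=; rewrite ffunE oddD.
by case: ifP; rewrite /= addbF.
Qed.

Section Design.
Variables (n tau : nat) (C : seq 'rV[R]_n).
Hypotheses (n0 : (0 < n)%N) (C0 : (0 < size C)%N) (hC : spherical_design tau C).

Definition xmom (a : 'I_n -> nat) : R := \sum_(y <- C) \prod_i y 0 i ^+ a i.

Lemma xmom_avg (a : {ffun 'I_n -> nat}) : (\sum_i a i <= tau)%N ->
  xmom a = (size C)%:R * sphere_avg (eval_poly [:: (1, a)]).
Proof.
move=> ha; have [_ /(_ [:: (1, a)])] := hC.
rewrite /poly_deg_le => <-; last by move=> c; rewrite inE => /eqP ->.
rewrite mulVKf ?pnatr_eq0 -?lt0n //.
by apply: eq_bigr => y _; rewrite /eval_poly big_seq1 mul1r.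
Qed.

Lemma xmom_odd (a : {ffun 'I_n -> nat}) : (\sum_i a i <= tau)%N -> has odd (expo a) -> xmom a = 0.
Proof.
move=> ha oa; rewrite xmom_avg // /sphere_avg Rn_integral_mono iter_integral_odd //.
by rewrite mul0r mulr0.
Qed.

Lemma xmom_sum (a : {ffun 'I_n -> nat}) : \sum_i xmom (bump2 i a) = xmom a.
Proof.
rewrite /xmom exchange_big /=; apply: eq_big_seq => y yC.
have y1 : dotp y y = 1 by have [/(_ y yC)] := hC; rewrite inE.
transitivity (dotp y y * \prod_i y 0 i ^+ a i); last by rewrite y1 mul1r.
rewrite /dotp mulr_suml; apply: eq_bigr => i _.
rewrite [in RHS](bigD1 i) //= [LHS](bigD1 i) //= !ffunE eqxx exprD expr2.
rewrite (eq_bigr (fun j => y 0 j ^+ a j)); first by ring.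
by move=> j /negbTE ji; rewrite ffunE ji addn0.
Qed.

(** The constant [K], which gathers the volume and the radial integral, is common to all
    coordinates. Summing over the coordinates and using that code points are unit vectors
    ([xmom_sum]) expresses [K] through [xmom a], so it is eliminated instead of computed. *)
Lemma xmom_bump2 (a : {ffun 'I_n -> nat}) i : (\sum_i a i + 2 <= tau)%N ->
  (n + \sum_i a i)%:R * xmom (bump2 i a) = (a i).+1%:R * xmom a.
Proof.
move=> ha; have [oa|ea] := boolP (has odd (expo a)).
  rewrite !xmom_odd ?mulr0 ?bump2_odd ?sum_bump2 //.
  by apply: leq_trans ha; rewrite leq_addr.
pose d := (\sum_i a i)%N.
have n0' : expo a != [::] by rewrite -size_eq0 size_expo -lt0n.
pose K : R := (size C)%:R * (betas (expo a) * fine (cone (d + 2) (d + 2 + n) (0 : R))) /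
   Rn_integral (fun x : 'rV[R]_n => if (0 < eucl_norm x <= 1) then 1 else 0).
have msz : msize (expo a) = (d + n)%N by rewrite /msize size_expo sumn_expo.
have hK j : (n + d + 2)%:R * xmom (bump2 j a) = (a j).+1%:R * K.
  rewrite xmom_avg ?sum_bump2 // /sphere_avg Rn_integral_mono iter_integral_even //; last 2 first.
  - by rewrite all_predC bump2_odd.
  - by rewrite orbC -size_eq0 size_expo -lt0n n0.
  rewrite mul1r sum_bump2 -/d.
  have -> : msize (expo (bump2 j a)) = (d + 2 + n)%N by rewrite /msize size_expo sumn_expo sum_bump2.
  have := @betas_incr (expo a) j; rewrite size_expo => /(_ (ltn_ord j)).
  rewrite -expo_bump2 nth_expo msz => h.
  rewrite /K (_ : (n + d + 2 = d + n + 2)%N); last by lia.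
  move: (Rn_integral _) (fine _) => V F.
  transitivity ((size C)%:R * (((d + n + 2)%:R * betas (expo (bump2 j a))) * F) / V); first by ring.
  by rewrite h; ring.
have hS : (n + d + 2)%:R * xmom a = (n + d)%:R * K.
  rewrite -xmom_sum mulr_sumr; under eq_bigr do rewrite hK.
  rewrite -mulr_suml -natr_sum; congr (_%:R * _).
  by under eq_bigr do rewrite -addn1; rewrite big_split /= sum1_card card_ord addnC.
have nd : (n + d + 2)%:R != 0 :> R by rewrite pnatr_eq0; lia.
apply: (mulfI nd); rewrite mulrCA hK [RHS]mulrCA hS; ring.
Qed.

End Design.
End Moments.

(** * Inner products, and moments of a design along one direction *)

Section Moments.
Context {R : realType}.

Lemma dotpC n (x y : 'rV[R]_n) : dotp x y = dotp y x.
Proof. by apply: eq_bigr => i _; rewrite mulrC. Qed.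

Lemma dotpDl n (x y z : 'rV[R]_n) : dotp (x + y) z = dotp x z + dotp y z.
Proof. by rewrite /dotp -big_split; apply: eq_bigr => i _; rewrite mxE mulrDl. Qed.

Lemma dotpZl n a (x z : 'rV[R]_n) : dotp (a *: x) z = a * dotp x z.
Proof. by rewrite /dotp mulr_sumr; apply: eq_bigr => i _; rewrite mxE mulrA. Qed.

Lemma dotpNl n (x z : 'rV[R]_n) : dotp (- x) z = - dotp x z.
Proof. by rewrite -scaleN1r dotpZl mulN1r. Qed.

Lemma dotpBl n (x y z : 'rV[R]_n) : dotp (x - y) z = dotp x z - dotp y z.
Proof. by rewrite dotpDl dotpNl. Qed.

Lemma dotp0l n (z : 'rV[R]_n) : dotp 0 z = 0.
Proof. by rewrite -(scale0r z) dotpZl mul0r. Qed.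

Lemma dotpDr n (x y z : 'rV[R]_n) : dotp z (x + y) = dotp z x + dotp z y.
Proof. by rewrite dotpC dotpDl !(dotpC z). Qed.

Lemma dotpZr n a (x z : 'rV[R]_n) : dotp z (a *: x) = a * dotp z x.
Proof. by rewrite dotpC dotpZl dotpC. Qed.

Lemma dotpNr n (x z : 'rV[R]_n) : dotp z (- x) = - dotp z x.
Proof. by rewrite dotpC dotpNl dotpC. Qed.

Lemma dotpBr n (x y z : 'rV[R]_n) : dotp z (x - y) = dotp z x - dotp z y.
Proof. by rewrite dotpDr dotpNr. Qed.

Lemma dotp0r n (z : 'rV[R]_n) : dotp z 0 = 0.
Proof. by rewrite dotpC dotp0l. Qed.

Lemma dotp_suml n I (r : seq I) (P : pred I) (F : I -> 'rV[R]_n) z :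
  dotp (\sum_(i <- r | P i) F i) z = \sum_(i <- r | P i) dotp (F i) z.
Proof.
elim/big_rec2: _ => [|i x y _ <-]; first by rewrite dotp0l.
by rewrite dotpDl.
Qed.

Lemma dotp_sumr n I (r : seq I) (P : pred I) (F : I -> 'rV[R]_n) z :
  dotp z (\sum_(i <- r | P i) F i) = \sum_(i <- r | P i) dotp z (F i).
Proof. by rewrite dotpC dotp_suml; apply: eq_bigr => i _; rewrite dotpC. Qed.

Lemma dotp_ge0 n (x : 'rV[R]_n) : 0 <= dotp x x.
Proof. by apply: sumr_ge0 => i _; rewrite -expr2 sqr_ge0. Qed.

Lemma dotp_eq0 n (x : 'rV[R]_n) : (dotp x x == 0) = (x == 0).
Proof.
apply/eqP/eqP => [h|->]; last exact: dotp0l.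
apply/rowP => i; rewrite mxE.
have /psumr_eq0P h' : dotp x x = 0 by [].
have xx k : true -> 0 <= x 0 k * x 0 k by rewrite -expr2 sqr_ge0.
by have /eqP := h' xx i isT; rewrite -expr2 sqrf_eq0 => /eqP.
Qed.

Lemma dotp_gt0 n (x : 'rV[R]_n) : x != 0 -> 0 < dotp x x.
Proof. by move=> x0; rewrite lt_neqAle eq_sym dotp_eq0 x0 dotp_ge0. Qed.

Definition bump1 n (i : 'I_n) (b : {ffun 'I_n -> nat}) : {ffun 'I_n -> nat} := [ffun j => b j + (j == i)]%N.
Definition drop1 n (i : 'I_n) (b : {ffun 'I_n -> nat}) : {ffun 'I_n -> nat} := [ffun j => b j - (j == i)]%N.

Lemma sum_bump1 n (i : 'I_n) (a : {ffun 'I_n -> nat}) : (\sum_j bump1 i a j = (\sum_j a j).+1)%N.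
Proof.
under eq_bigr do rewrite ffunE.
by rewrite big_split /= -big_mkcond /= sum1_card card1 addn1.
Qed.

Section Design.
Variables (n tau : nat) (C : seq 'rV[R]_n).
Hypotheses (n0 : (0 < n)%N) (C0 : (0 < size C)%N) (hC : spherical_design tau C).

Definition wxmom (u : 'rV[R]_n) m (b : 'I_n -> nat) : R :=
  \sum_(y <- C) dotp u y ^+ m * \prod_i y 0 i ^+ b i.

Lemma wxmom0 u b : wxmom u 0 b = xmom C b.
Proof. by apply: eq_bigr => y _; rewrite mul1r. Qed.

Lemma wxmomS u m (b : {ffun 'I_n -> nat}) : wxmom u m.+1 b = \sum_j u 0 j * wxmom u m (bump1 j b).
Proof.
rewrite /wxmom; under [RHS]eq_bigr do rewrite mulr_sumr.
rewrite [RHS]exchange_big /=; apply: eq_bigr => y _.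
rewrite exprS {1}/dotp !mulr_suml; apply: eq_bigr => j _.
rewrite (bigD1 j) //= [in RHS](bigD1 j) //= ffunE eqxx exprD expr1.
rewrite (eq_bigr (fun k => y 0 k ^+ bump1 j b k)); first by ring.
by move=> k /negbTE kj; rewrite ffunE kj addn0.
Qed.

(** Integration by parts on the sphere, in discrete form. The case [m = 0] is [xmom_bump2], and the
    induction expands one factor u.y into coordinates. Where [drop1] or [m.-1] truncates, the
    coefficient in front is 0. *)
Lemma wxmom_rec u m (b : {ffun 'I_n -> nat}) i : (m + \sum_j b j < tau)%N ->
  ((n + m + \sum_j b j)%:R - 1) * wxmom u m (bump1 i b) =
  (b i)%:R * wxmom u m (drop1 i b) + m%:R * u 0 i * wxmom u m.-1 b.
Proof.
elim: m b i => [|m IH] b i hb.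
  rewrite mul0r mul0r addr0 !wxmom0.
  case bi : (b i) => [|c].
    rewrite mul0r (xmom_odd C0 hC) ?mulr0 ?sum_bump1 //.
    rewrite has_map; apply/hasP; exists i; first by rewrite mem_enum.
    by rewrite /= ffunE eqxx bi.
  pose b' := drop1 i b.
  have bE : b = bump1 i b'.
    by apply/ffunP => j; rewrite /b' !ffunE; case: (j =P i) => [->|_]; rewrite ?bi /=; lia.
  have -> : bump1 i b = bump2 i b'.
    by apply/ffunP => j; rewrite /b' !ffunE; case: (j =P i) => [->|_]; rewrite ?bi /=; lia.
  have hs : (\sum_j b j = (\sum_j b' j).+1)%N by rewrite {1}bE sum_bump1.
  have h2 : (\sum_j b' j + 2 <= tau)%N by move: hb; rewrite hs; lia.
  have b'i : b' i = c by rewrite ffunE eqxx bi subn1.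
  rewrite -/b' -[in RHS]b'i -(xmom_bump2 n0 C0 hC i h2).
  by rewrite hs addn0 addnS -natr1 addrK.
rewrite wxmomS mulr_sumr.
have step j : ((n + m.+1 + \sum_j b j)%:R - 1) * (u 0 j * wxmom u m (bump1 j (bump1 i b))) =
   u 0 j * ((b i)%:R * wxmom u m (bump1 j (drop1 i b)) + (j == i)%:R * wxmom u m b +
     m%:R * u 0 i * wxmom u m.-1 (bump1 j b)).
  rewrite mulrCA; congr (_ * _).
  have -> : bump1 j (bump1 i b) = bump1 i (bump1 j b).
    by apply/ffunP => k; rewrite !ffunE addnAC.
  have := IH (bump1 j b) i; rewrite sum_bump1 addnS -addSn => /(_ hb).
  rewrite addnS -addSn -addnS => ->; congr (_ + _).
  rewrite ffunE eq_sym natrD mulrDl; congr (_ + _).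
    case bi : (b i) => [|c]; first by rewrite !mul0r.
    have -> // : drop1 i (bump1 j b) = bump1 j (drop1 i b).
    by apply/ffunP => k; rewrite !ffunE; case: (k =P i) => [->|_]; rewrite ?bi; lia.
  case: (j =P i) => [->|_]; last by rewrite !mul0r.
  have -> // : drop1 i (bump1 i b) = b.
  by apply/ffunP => k; rewrite !ffunE addnK.
rewrite (eq_bigr _ (fun j _ => step j)).
under eq_bigr do rewrite !mulrDr.
rewrite !big_split /= -addrA; congr (_ + _).
  by rewrite wxmomS mulr_sumr; apply: eq_bigr => j _; rewrite mulrCA.
have -> : \sum_(j < n) u 0 j * ((j == i)%:R * wxmom u m b) = u 0 i * wxmom u m b.
  rewrite (bigD1 i) //= eqxx mul1r big1 ?addr0 // => j /negbTE ->.
  by rewrite mul0r mulr0.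
have -> : \sum_(j < n) u 0 j * (m%:R * u 0 i * wxmom u m.-1 (bump1 j b)) = m%:R * u 0 i * wxmom u m b.
  case: (m) => [|k]; first by rewrite !mul0r big1 // => j _; rewrite !mul0r mulr0.
  by rewrite wxmomS mulr_sumr; apply: eq_bigr => j _; rewrite mulrCA.
by rewrite -natr1; ring.
Qed.

Lemma dot_moment_rec u m : (m < tau)%N ->
  ((n + m)%:R - 1) * (\sum_(y <- C) dotp u y ^+ m.+1) = m%:R * dotp u u * (\sum_(y <- C) dotp u y ^+ m.-1).
Proof.
move=> hm; pose z : {ffun 'I_n -> nat} := [ffun=> 0%N].
have sz : (\sum_j z j = 0)%N by apply: big1 => j _; rewrite ffunE.
have wz k : \sum_(y <- C) dotp u y ^+ k = wxmom u k z.
  by apply: eq_bigr => y _; rewrite big1 ?mulr1 // => j _; rewrite ffunE.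
rewrite !wz wxmomS mulr_sumr.
have h j : ((n + m)%:R - 1) * (u 0 j * wxmom u m (bump1 j z)) = m%:R * (u 0 j * u 0 j) * wxmom u m.-1 z.
  have := @wxmom_rec u m z j; rewrite sz !addn0 => /(_ hm); rewrite ffunE mul0r add0r => h.
  by rewrite mulrCA h; ring.
under eq_bigr do rewrite h.
by rewrite -mulr_suml -mulr_sumr.
Qed.

Lemma dot_moment u m : (2 <= n)%N -> (m <= tau)%N ->
  \sum_(y <- C) dotp u y ^+ m = (size C)%:R * mom n m * dotp u u ^+ m./2.
Proof.
move=> n2; elim/ltn_ind: m => -[|[|m]] IH hm.
- by rewrite big_const_seq count_predT iter_addr addr0 !mulr1.
- have := @dot_moment_rec u 0 hm; rewrite !mul0r addn0 => /eqP.
  rewrite mulf_eq0 subr_eq0 => /orP[|/eqP->]; last by rewrite mulr0 mul0r.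
  by rewrite -[1]/(1%:R) eqr_nat; lia.
have mt : (m <= tau)%N by lia.
have := @dot_moment_rec u m.+1 hm; rewrite /= (IH m) //.
rewrite addnS -natr1 addrK => h.
have nm : (n + m)%:R != 0 :> R by rewrite pnatr_eq0; lia.
apply: (mulfI nm); rewrite h exprS.
by move: nm; move: (n + m)%:R => q q0; field.
Qed.

End Design.
End Moments.

(** * Orthogonality and the nodes *)

Section General.
Context {R : realType}.

Lemma CauchySchwarz n (x y : 'rV[R]_n) : dotp x y ^+ 2 <= dotp x x * dotp y y.
Proof.
have [->|y0] := eqVneq y 0; first by rewrite !dotp0r mulr0 expr0n.
have yy := dotp_gt0 y0.
have := dotp_ge0 (dotp y y *: x - dotp x y *: y).
rewrite !dotpBl !dotpBr !dotpZl !dotpZr [dotp y x]dotpC.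
set a := dotp x x; set b := dotp x y; set c := dotp y y in yy *.
have -> : c * (c * a) - c * (b * b) - (b * (c * b) - b * (b * c)) = c * (a * c - b ^+ 2) by ring.
by rewrite pmulr_rge0 // subr_ge0.
Qed.

Lemma dotp_unit_itv n (x y : 'rV[R]_n) : dotp x x = 1 -> dotp y y = 1 -> -1 <= dotp x y <= 1.
Proof.
move=> x1 y1; have := CauchySchwarz x y; rewrite x1 y1 mulr1.
by rewrite -ler_norml -[leRHS](expr1n _ 2) -real_normK ?num_real // ler_pXn2r ?nnegrE.
Qed.

Lemma normalize n (v : 'rV[R]_n) : v != 0 -> dotp ((Num.sqrt (dotp v v))^-1 *: v) ((Num.sqrt (dotp v v))^-1 *: v) = 1.
Proof.
move=> v0; have vv := dotp_gt0 v0.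
have s0 : Num.sqrt (dotp v v) != 0 by rewrite gt_eqF // sqrtr_gt0.
rewrite dotpZl dotpZr -[X in _ * (_ * X)](sqr_sqrtr (ltW vv)).
by move: s0; move: (Num.sqrt _) => s s0; field.
Qed.

Lemma exists_orthogonal m n (A : 'M[R]_(m, n)) : (m < n)%N ->
  exists2 v : 'rV[R]_n, v != 0 & forall i, dotp v (row i A) = 0.
Proof.
move=> mn; have : kermx A^T != 0.
  rewrite -mxrank_eq0 mxrank_ker -lt0n subn_gt0 (leq_ltn_trans _ mn) //.
  by rewrite rank_leq_col.
move=> /rowV0Pn[v /sub_kermxP vA v0]; exists v => // i.
have /matrixP/(_ 0 i) := vA; rewrite !mxE => <-.
by apply: eq_bigr => j _; rewrite !mxE.
Qed.

Lemma unit_with_dotp n (y : 'rV[R]_n) (t : R) : (2 <= n)%N -> dotp y y = 1 -> -1 <= t <= 1 ->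
  exists2 u : 'rV[R]_n, dotp u u = 1 & dotp u y = t.
Proof.
move=> n2 y1 t1.
have [v v0 /(_ 0)] := @exists_orthogonal 1 n y n2.
rewrite row_id => vy.
have [w w1 wy] : exists2 w : 'rV[R]_n, dotp w w = 1 & dotp w y = 0.
  by exists ((Num.sqrt (dotp v v))^-1 *: v); [exact: normalize|rewrite dotpZl vy mulr0].
have t2 : 0 <= 1 - t ^+ 2 by rewrite chord_in in_itv.
exists (t *: y + Num.sqrt (1 - t ^+ 2) *: w).
  rewrite !dotpDl !dotpDr !dotpZl !dotpZr (dotpC y w) wy y1 w1.
  rewrite !mulr0 addr0 add0r !mulr1 -!expr2 sqr_sqrtr //; ring.
by rewrite dotpDl !dotpZl wy y1; ring.
Qed.

Lemma poly_zero_itv (f : {poly R}) : (forall t, -1 <= t <= 1 -> f.[t] = 0) -> f = 0.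
Proof.
move=> hf; apply/eqP; apply/negPn/negP => f0.
pose s := [seq (i%:R / (size f)%:R : R) | i <- iota 0 (size f)].
have sf : (size f)%:R != 0 :> R by rewrite pnatr_eq0 size_poly_eq0.
have us : uniq s.
  rewrite map_inj_uniq ?iota_uniq // => i j /(mulIf _).
  by rewrite invr_eq0 => /(_ sf)/eqP; rewrite eqr_nat => /eqP.
have := max_poly_roots f0 _ us; rewrite size_map size_iota ltnn => h; apply: notF.
apply: h; apply/allP => _ /mapP[i + ->]; rewrite mem_iota add0n => /= hi.
apply/rootP/hf; apply/andP; split.
  by apply: le_trans (_ : 0 <= _); rewrite ?lerN10 // divr_ge0.
have sf0 : 0 < (size f)%:R :> R by rewrite ltr0n (leq_ltn_trans _ hi).
by rewrite ler_pdivrMr // mul1r ler_nat ltnW.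
Qed.

Section Design.
Variables (n tau : nat) (C : seq 'rV[R]_n).
Hypotheses (n2 : (2 <= n)%N) (C0 : (0 < size C)%N) (hC : spherical_design tau C).

Lemma design_unit y : y \in C -> dotp y y = 1.
Proof. by have [h _] := hC => /h; rewrite inE. Qed.

Lemma sum_poly (u : 'rV[R]_n) (f : {poly R}) : dotp u u = 1 -> (size f <= tau.+1)%N ->
  \sum_(y <- C) f.[dotp u y] = (size C)%:R * Emom n f.
Proof.
move=> u1 sf; under eq_bigr do rewrite horner_coef.
rewrite exchange_big /Emom mulr_sumr /=; apply: eq_bigr => i _.
rewrite -mulr_sumr (dot_moment (ltnW n2) C0 hC) //.
  by rewrite u1 expr1n mulr1 mulrCA.
by rewrite -ltnS (leq_trans _ sf).
Qed.

(** For a code point y and any t in [-1,1] some unit u has u.y = t; the values of [f] at the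
    products with u are nonnegative and sum to 0, hence f(t) = 0. *)
Lemma nonneg_Emom0 (f : {poly R}) : (size f <= tau.+1)%N ->
  (forall t, -1 <= t <= 1 -> 0 <= f.[t]) -> Emom n f = 0 -> f = 0.
Proof.
move=> sf f0 Ef; apply: poly_zero_itv => t t1.
case: C C0 hC (sum_poly) => [//|y C'] _ hC' sp.
have y1 : dotp y y = 1 by have [h _] := hC'; have := h y (mem_head _ _); rewrite inE.
have [u u1 <-] := unit_with_dotp n2 y1 t1.
have := sp u f u1 sf; rewrite Ef mulr0 big_cons => /eqP.
rewrite paddr_eq0; first by case/andP => /eqP.
  by apply/f0/dotp_unit_itv.
rewrite big_seq; apply: sumr_ge0 => z zC; apply/f0/dotp_unit_itv => //.
by have [h _] := hC'; have := h z; rewrite inE zC orbT inE; apply.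
Qed.

(** The facts about nodes below come from this by exhibiting a nonzero test polynomial, nonnegative
    on [-1,1], of degree at most [tau], that would vanish on all products with [x]. *)
Lemma nonneg_vanish (f : {poly R}) (x : 'rV[R]_n) : dotp x x = 1 -> (size f <= tau.+1)%N ->
  (forall t, -1 <= t <= 1 -> 0 <= f.[t]) -> (forall y, y \in C -> f.[dotp x y] = 0) -> f = 0.
Proof.
move=> x1 sf f0 fx; apply: nonneg_Emom0 => //.
have := sum_poly x1 sf; rewrite big_seq big1 //.
move=> /esym/eqP; rewrite mulf_eq0 pnatr_eq0 => /orP[|/eqP //].
by rewrite eqn0Ngt C0.
Qed.

Section Nodes.
Variables (P : {poly R}).
Let k := (tau.+1)./2.
Let eps : nat := ~~ odd tau.
Hypothesis hP : is_jacobi n 0 eps k P.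
Let F := ('X + 1) ^+ eps * P.

Let tauE : (tau.+1 = k.*2 + eps)%N.
Proof. by rewrite /k /eps -[LHS]odd_double_half addnC. Qed.

Lemma jacobi_orth (q : {poly R}) : (size q <= k)%N -> Emom n (F * q) = 0.
Proof.
move=> sq; have [_ [_ /(_ q sq)]] := hP.
rewrite -mu_integral_poly // /mu_integral => h.
rewrite -[X in X / _ = _](_ : 0 = _) ?mul0r // -h.
apply: eq_Rintegral => t; rewrite mem_setE => t1.
have [t1l t1r] : 0 <= 1 - t /\ 0 <= 1 + t.
  by move: t1; rewrite in_itv /= => /andP[? ?]; split; lra.
rewrite /F !hornerM horner_exp hornerD hornerX hornerC /jacobi_weight add0r.
suff -> : (1 - t) `^ ((n%:R - 3) / 2) * (1 + t) `^ (eps%:R + (n%:R - 3) / 2) =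
    (t + 1) ^+ eps * mu_weight n t by ring.
rewrite /mu_weight (_ : 1 - t ^+ 2 = (1 - t) * (1 + t)); last by ring.
rewrite powRM // mulrCA; congr (_ * _).
rewrite /eps; case: (odd tau) => /=; first by rewrite add0r expr0 mul1r.
rewrite expr1 addrC [t + 1]addrC.
have [->|t0] := eqVneq (1 + t) 0.
  rewrite mul0r powR0 //.
  have : 2%:R <= n%:R :> R by rewrite ler_nat.
  by move=> n2'; apply/eqP => e; lra.
rewrite powRD ?powRr1 1?mulrC //.
by apply/implyP.
Qed.

(* Uniqueness of the orthogonal polynomial of degree [k], with positivity read off the design instead of the weight. *)
Lemma jacobi_unique (Q : {poly R}) : size Q = k.+1 ->
  (forall q : {poly R}, (size q <= k)%N -> Emom n (('X + 1) ^+ eps * Q * q) = 0) ->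
  exists2 c, c != 0 & P = c *: Q.
Proof.
move=> sQ hQ; have [sP _] := hP.
have Q0 : Q != 0 by rewrite -size_poly_eq0 sQ.
have P0 : P != 0 by rewrite -size_poly_eq0 sP.
pose c := lead_coef P / lead_coef Q.
have c0 : c != 0 by rewrite mulf_neq0 ?invr_eq0 ?lead_coef_eq0.
exists c => //; apply/eqP; rewrite -subr_eq0.
set g := P - c *: Q.
have sg : (size g <= k)%N.
  have sg' : (size g <= k.+1)%N.
    by rewrite (leq_trans (size_polyD _ _)) // size_polyN size_scale // sP sQ maxnn.
  apply/leq_sizeP => j; rewrite leq_eqVlt => /predU1P[<-|kj].
    rewrite coefB coefZ.
    have -> : P`_k = lead_coef P by rewrite lead_coefE sP.
    have -> : Q`_k = lead_coef Q by rewrite lead_coefE sQ.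
    by rewrite divfK ?subrr // lead_coef_eq0.
  by rewrite nth_default // (leq_trans sg').
have hg : ('X + 1) ^+ eps * g * g = 0.
  apply: nonneg_Emom0.
  - have [->|g0] := eqVneq g 0; first by rewrite mulr0 size_poly0.
    have X0 : ('X + 1 : {poly R}) ^+ eps != 0.
      by rewrite expf_neq0 // -size_poly_eq0 -[1]/(1%:P) size_XaddC.
    rewrite !size_mul ?mulf_neq0 //.
    have : (size (('X + 1 : {poly R}) ^+ eps) <= eps.+1)%N.
      by rewrite /eps; case: (odd tau); rewrite ?expr0 ?size_poly1 // expr1 -[1]/(1%:P) size_XaddC.
    move: sg tauE; move: (size _) (size _) => a b; move: k eps => k' e'; lia.
  - move=> t /andP[t1 t2]; rewrite -mulrA !hornerM horner_exp hornerD hornerX hornerC.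
    by rewrite mulr_ge0 -?expr2 ?sqr_ge0 // exprn_ge0 //; lra.
  - have -> : ('X + 1) ^+ eps * g * g = F * g - c *: (('X + 1) ^+ eps * Q * g).
      by rewrite scalerAl -mulrBl; congr (_ * _); rewrite mulrBr scalerAr.
    by rewrite EmomD EmomN EmomZ jacobi_orth // hQ // mulr0 subr0.
apply/eqP; move: hg => /eqP; rewrite -mulrA mulf_eq0 => /orP[|].
  by rewrite expf_eq0 => /andP[_]; rewrite -size_poly_eq0 -[1]/(1%:P) size_XaddC.
by rewrite -expr2 sqrf_eq0 => /eqP.
Qed.

(** For q of degree below [k] the product of q with the vanishing polynomial has degree at most
    [tau] and sum 0 over the code, so [Q] is orthogonal to all lower degrees and proportional to
    [P]. *)
Lemma jacobi_vanish (x : 'rV[R]_n) (Q : {poly R}) : dotp x x = 1 -> size Q = k.+1 ->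
  (forall y, y \in C -> (('X + 1) ^+ eps * Q).[dotp x y] = 0) ->
  forall y, y \in C -> F.[dotp x y] = 0.
Proof.
move=> x1 sQ hQ y yC.
have [q sq|c c0 PE] := jacobi_unique sQ.
  have h : (size (('X + 1) ^+ eps * Q * q)%R <= tau.+1)%N.
    apply: leq_trans (size_polyMleq _ _) _.
    apply: leq_trans (_ : (size (('X + 1 : {poly R}) ^+ eps * Q)%R + k).-1 <= _)%N.
      by rewrite -!subn1 leq_sub2r // leq_add2l.
    have h1 : (size (('X + 1 : {poly R}) ^+ eps)%R <= eps.+1)%N.
      by rewrite /eps; case: (odd tau); rewrite ?expr0 ?size_poly1 // expr1 -[1]/(1%:P) size_XaddC.
    have := size_polyMleq (('X + 1 : {poly R}) ^+ eps) Q; rewrite sQ tauE.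
    move: h1; move: (size _) (size _) => a b; move: k eps => k' e'; lia.
  have := sum_poly x1 h; rewrite big_seq big1; last first.
    by move=> z zC; rewrite hornerM hQ // mul0r.
  move=> /esym/eqP; rewrite mulf_eq0 pnatr_eq0 => /orP[|/eqP //].
  by rewrite eqn0Ngt C0.
by rewrite /F PE -scalerAr hornerZ hQ // mulr0.
Qed.

End Nodes.
End Design.
End General.

(** * Nodes and multiplicities read off the design *)

Section Nodes.
Context {R : realType}.

Lemma sum_lagrange_basis (alpha : seq R) (T : eqType) (C : seq T) (f : T -> R) (i : nat) : uniq alpha ->
  (i < size alpha)%N -> (forall y, y \in C -> f y \in alpha) ->
  \sum_(y <- C) lagrange_basis alpha i (f y) = (count (fun y => f y == alpha`_i) C)%:R.
Proof.
move=> ua hi hf; rewrite -sum1_count natr_sum [RHS]big_mkcond /=.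
apply: eq_big_seq => y yC; rewrite /lagrange_basis.
have := hf y yC => fy; have jl : (index (f y) alpha < size alpha)%N by rewrite index_mem.
case: eqP => [->|/eqP fi].
  rewrite big1 // => j ji; rewrite divff // subr_eq0 nth_uniq //.
  by rewrite eq_sym.
rewrite (bigD1 (Ordinal jl)) /=; last first.
  by apply: contraNneq fi => <-; rewrite nth_index.
by rewrite nth_index // subrr mul0r mul0r.
Qed.

Definition lagrange_poly (alpha : seq R) (i : nat) : {poly R} :=
  \prod_(j < size alpha | j != i :> nat) ((alpha`_i - alpha`_j)^-1 *: ('X - (alpha`_j)%:P)).

Lemma horner_lagrange_poly alpha i t : (lagrange_poly alpha i).[t] = lagrange_basis alpha i t.
Proof.
rewrite /lagrange_poly /lagrange_basis horner_prod; apply: eq_bigr => j _.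
by rewrite hornerZ hornerXsubC mulrC.
Qed.

Lemma size_lagrange_poly alpha i : (i < size alpha)%N -> (size (lagrange_poly alpha i) <= size alpha)%N.
Proof.
move=> hi.
have h (P : pred 'I_(size alpha)) : (size (\prod_(j < size alpha | P j)
   ((alpha`_i - alpha`_j)^-1 *: ('X - (alpha`_j)%:P)))%R <= #|P|.+1)%N.
  apply: leq_trans (size_prod_leq _ _) _; rewrite leq_subLR.
  apply: leq_trans (_ : (\sum_(j | P j) 2).+1 <= _)%N.
    by rewrite ltnS leq_sum // => j _; rewrite (leq_trans (size_scale_leq _ _)) // size_XsubC.
  have -> : (\sum_(j | P j) 2 = #|P| * 2)%N by rewrite -sum_nat_const; apply: eq_bigl.
  by rewrite muln2 -addnn addnS.
apply: leq_trans (h _) _.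
have := cardC1 (Ordinal hi); rewrite card_ord => e.
rewrite (@eq_card _ _ (predC1 (Ordinal hi))) ?e; first by rewrite prednK // (leq_ltn_trans _ hi).
by move=> j; rewrite !inE.
Qed.

Definition nodal (s : seq R) : {poly R} := \prod_(a <- s) ('X - a%:P).

Lemma nodal_neq0 s : nodal s != 0.
Proof. by rewrite -size_poly_eq0 size_prod_XsubC. Qed.

Lemma horner_nodal_mem s a : a \in s -> (nodal s).[a] = 0.
Proof. by move=> ha; apply/rootP; rewrite root_prod_XsubC. Qed.

Lemma size_nodal2 s : size (nodal s ^+ 2) = (size s).*2.+1.
Proof.
rewrite expr2 size_mul ?nodal_neq0 // !size_prod_XsubC; lia.
Qed.

Lemma size_XsubC_nodal2 a s : size (('X - a%:P) * nodal s ^+ 2) = (size s).*2.+2.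
Proof. by rewrite size_mul ?expf_neq0 ?nodal_neq0 ?polyXsubC_eq0 // size_nodal2 size_XsubC. Qed.

Lemma size_XsubC2_nodal2 a b s : size (('X - a%:P) * (('X - b%:P) * nodal s ^+ 2)) = (size s).*2.+3.
Proof.
by rewrite size_mul ?mulf_neq0 ?expf_neq0 ?nodal_neq0 ?polyXsubC_eq0 // size_XsubC_nodal2 size_XsubC.
Qed.

Lemma horner_nodal2_ge0 s t : 0 <= (nodal s ^+ 2).[t].
Proof. by rewrite horner_exp sqr_ge0. Qed.

Section Design.
Variables (n tau : nat) (C : seq 'rV[R]_n).
Hypotheses (n2 : (2 <= n)%N) (C0 : (0 < size C)%N) (hC : spherical_design tau C).
Variables (P : {poly R}).
Let k := (tau.+1)./2.
Let eps : nat := ~~ odd tau.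
Hypothesis sP : size P = k.+1.
Let F := ('X + 1) ^+ eps * P.
Variables (x : 'rV[R]_n) (alpha : seq R).
Hypotheses (x1 : dotp x x = 1) (hx : forall y, y \in C -> F.[dotp x y] = 0).
Hypotheses (sa : sorted <%R alpha) (ra : forall t, root F t = (t \in alpha)).

Let tauE : (tau.+1 = k.*2 + eps)%N.
Proof. by rewrite /k /eps -[LHS]odd_double_half addnC. Qed.

Lemma nodes_uniq : uniq alpha.
Proof. exact: lt_sorted_uniq sa. Qed.

Lemma node_mem y : y \in C -> dotp x y \in alpha.
Proof. by move=> yC; rewrite -ra; apply/rootP/hx. Qed.

(** Otherwise the squared nodal polynomial of [s] would have degree at most [tau] and vanish on all
    products with [x]. *)
Lemma no_small_nodes s : (forall y, y \in C -> dotp x y \in s) -> (tau < (size s).*2)%N.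
Proof.
move=> hs; rewrite ltnNge; apply/negP => ss.
have := nonneg_vanish n2 C0 hC (f := nodal s ^+ 2) x1.
rewrite size_nodal2 ltnS => /(_ ss (fun t _ => horner_nodal2_ge0 s t)) h.
suff : nodal s ^+ 2 = 0 by apply/eqP; rewrite expf_eq0 /= nodal_neq0.
by apply: h => y yC; rewrite horner_exp horner_nodal_mem ?hs // expr0n.
Qed.

Let XD1 : ('X + 1 : {poly R}) = 'X - (-1)%:P.
Proof. by rewrite polyCN opprK. Qed.

Let F0 : F != 0.
Proof.
rewrite mulf_neq0 ?expf_neq0 // -size_poly_eq0 ?sP //.
by rewrite XD1 size_XsubC.
Qed.

(** The degree bounds the number of roots from above, [no_small_nodes] from below; so all zeros are
    real and simple. *)
Lemma size_nodes : size alpha = (k + eps)%N.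
Proof.
apply/eqP; rewrite eqn_leq; apply/andP; split.
  have := max_poly_roots F0 (_ : all (root F) alpha) nodes_uniq => h.
  have : (size alpha < size F)%N by apply: h; apply/allP => a; rewrite ra.
  rewrite /F size_mul ?expf_neq0 -?size_poly_eq0 ?sP ?XD1 ?size_XsubC // size_exp_XsubC; lia.
have := no_small_nodes node_mem.
have : (eps <= 1)%N by rewrite /eps; case: (odd tau).
move: tauE; move: (size alpha) k eps => a' k' e'; lia.
Qed.

Lemma node_attained a : a \in alpha -> exists2 y, y \in C & dotp x y = a.
Proof.
move=> aa; apply: contrapT => h.
have := @no_small_nodes (rem a alpha); rewrite size_rem // size_nodes.
have hm y : y \in C -> dotp x y \in rem a alpha.
  move=> yC; rewrite mem_rem_uniq ?nodes_uniq // inE node_mem // andbT.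
  by apply/eqP => e; apply: h; exists y.
move=> /(_ hm).
have : (eps <= 1)%N by rewrite /eps; case: (odd tau).
move: tauE; move: k eps => k' e'; lia.
Qed.

Lemma node_itv a : a \in alpha -> -1 <= a <= 1.
Proof. by move=> /node_attained [y yC <-]; rewrite dotp_unit_itv // (design_unit hC). Qed.

Lemma node_count i : (i < size alpha)%N ->
  (count (fun y => dotp x y == alpha`_i) C)%:R = (size C)%:R * mu_integral n (lagrange_basis alpha i).
Proof.
move=> hi; rewrite -(sum_lagrange_basis nodes_uniq hi node_mem).
have -> : lagrange_basis alpha i = fun t => (lagrange_poly alpha i).[t].
  by apply/funext => t; rewrite horner_lagrange_poly.
rewrite mu_integral_poly // -(sum_poly n2 C0 hC x1) //.
rewrite (leq_trans (size_lagrange_poly hi)) // size_nodes.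
by move: tauE; move: k eps => k' e' ->; rewrite -addnn -addnA leq_addl.
Qed.

(** The test polynomial is 1 - t, times 1 + t for even [tau], times the square of the nodal
    polynomial of the remaining nodes; its degree is exactly [tau]. At 1 the potential may be
    infinite and has no derivative to interpolate. *)
Lemma node_neq1 : 1 \notin alpha.
Proof.
apply/negP => a1.
have [e0|e1] := boolP (odd tau).
  pose f := - (('X - 1%:P) * nodal (rem 1 alpha) ^+ 2).
  have f0 : f != 0 by rewrite oppr_eq0 mulf_neq0 ?expf_neq0 ?nodal_neq0 ?polyXsubC_eq0.
  suff : f = 0 by apply/eqP.
  apply: (nonneg_vanish n2 C0 hC x1).
  - rewrite size_polyN size_XsubC_nodal2 size_rem // size_nodes.
    have : (0 < k + eps)%N by rewrite -size_nodes; case: (alpha) a1.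
    by move: tauE; rewrite /eps e0; move: k => k'; lia.
  - move=> t /andP[_ t1]; rewrite hornerN hornerM hornerXsubC -mulNr.
    by rewrite mulr_ge0 ?horner_nodal2_ge0 // opprB subr_ge0.
  - move=> y yC; apply/eqP; rewrite hornerN oppr_eq0 hornerM hornerXsubC; apply/eqP; have [->|ne] := eqVneq (dotp x y) 1.
      by rewrite subrr mul0r.
    rewrite horner_exp horner_nodal_mem ?expr0n ?mulr0 //.
    by rewrite mem_rem_uniq ?nodes_uniq // inE ne node_mem.
have aN1 : -1 \in alpha.
  by rewrite -ra /F /eps e1 expr1 rootM XD1 root_XsubC eqxx.
pose s := rem (-1) (rem 1 alpha).
pose f := - (('X - 1%:P) * (('X - (-1)%:P) * nodal s ^+ 2)).
have f0 : f != 0 by rewrite oppr_eq0 !mulf_neq0 ?expf_neq0 ?nodal_neq0 ?polyXsubC_eq0.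
suff : f = 0 by apply/eqP.
have aN1' : -1 \in rem 1 alpha.
  by rewrite mem_rem_uniq ?nodes_uniq // inE aN1 andbT; apply/eqP; lra.
apply: (nonneg_vanish n2 C0 hC x1).
- rewrite size_polyN size_XsubC2_nodal2 !size_rem // size_nodes.
  have : (1 < k + eps)%N.
    by rewrite -size_nodes -(ltn_predK (_ : (0 < size alpha)%N)) -?(size_rem a1);
      [case: (rem 1 alpha) aN1'|case: (alpha) a1].
  by move: tauE; rewrite /eps e1; move: k => k'; lia.
- move=> t /andP[t1 t2]; rewrite hornerN hornerM hornerXsubC -mulNr hornerM hornerXsubC.
  by rewrite mulr_ge0 ?mulr_ge0 ?horner_nodal2_ge0 //; lra.
- move=> y yC; apply/eqP; rewrite hornerN oppr_eq0 !hornerM !hornerXsubC; apply/eqP.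
  have [->|ne] := eqVneq (dotp x y) 1; first by rewrite subrr mul0r.
  have [->|ne'] := eqVneq (dotp x y) (-1); first by rewrite subrr mul0r mulr0.
  rewrite (@horner_nodal_mem s) ?mulr0 //.
  rewrite mem_rem_uniq ?rem_uniq ?nodes_uniq // inE ne' /=.
  by rewrite mem_rem_uniq ?nodes_uniq // inE ne node_mem.
Qed.

Lemma node_neqN1 : odd tau -> -1 \notin alpha.
Proof.
move=> e0; apply/negP => a1.
pose f := ('X - (-1)%:P) * nodal (rem (-1) alpha) ^+ 2.
have f0 : f != 0 by rewrite mulf_neq0 ?expf_neq0 ?nodal_neq0 ?polyXsubC_eq0.
suff : f = 0 by apply/eqP.
apply: (nonneg_vanish n2 C0 hC x1).
- rewrite size_XsubC_nodal2 size_rem // size_nodes.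
  have : (0 < k + eps)%N by rewrite -size_nodes; case: (alpha) a1.
  by move: tauE; rewrite /eps e0; move: k => k'; lia.
- move=> t /andP[t1 _]; rewrite hornerM hornerXsubC mulr_ge0 ?horner_nodal2_ge0 //; lra.
- move=> y yC; rewrite hornerM hornerXsubC.
  have [->|ne] := eqVneq (dotp x y) (-1); first by rewrite subrr mul0r.
  rewrite horner_exp horner_nodal_mem ?expr0n ?mulr0 //.
  by rewrite mem_rem_uniq ?nodes_uniq // inE ne node_mem.
Qed.

End Design.
End Nodes.

(** * Hermite interpolation and the universal minorant *)

Section Rolle.
Context {R : realType}.
Implicit Types (f g : R -> R) (p H : {poly R}).

(** The derivatives of g - p are known only inside ]-1,1[, so each differentiation goes through
    equality near the point. *)
Lemma derive1n_subpoly g p N :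
  (forall j (t : R), (j <= N)%N -> -1 < t < 1 -> derivable (derive1n j g) t 1) ->
  forall j, (j <= N.+1)%N -> forall t : R, -1 < t < 1 ->
    derive1n j (fun t => g t - p.[t]) t = derive1n j g t - p^`(j).[t] /\
    ((j <= N)%N -> derivable (derive1n j (fun t => g t - p.[t])) t 1).
Proof.
move=> hg; elim=> [|j IH] hj t t1.
  split=> // _; apply: derivableB; last exact: derivable_horner.
  exact: (hg 0%N).
have near_eq i (s : R) : (i <= N.+1)%N -> -1 < s < 1 ->
    (forall s : R, -1 < s < 1 -> derive1n i (fun t => g t - p.[t]) s = derive1n i g s - p^`(i).[s]) ->
    (\forall u \near s, derive1n i (fun t => g t - p.[t]) u = (derive1n i g \- horner p^`(i)) u).
  move=> hi s1 heq; near=> u; rewrite heq //.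
  rewrite -[_ && _]/(u \in `](-1)%R, 1%R[); near: u.
  by apply: near_in_itvoo; rewrite in_itv.
have IH1 (s : R) (s1 : -1 < s < 1) := (IH (ltnW hj) s s1).1.
have E (s : R) : -1 < s < 1 -> derive1n j.+1 (fun t => g t - p.[t]) s = derive1n j.+1 g s - p^`(j.+1).[s].
  move=> s1; rewrite derive1nS derive1E (near_eq_derive _ (near_eq j s (ltnW hj) s1 IH1)).
  rewrite deriveB; [|exact: hg|exact: derivable_horner].
  by rewrite -!derive1E -derivE -derivnS.
split; first exact: E.
move=> hj'; apply: (near_eq_derivable (f := derive1n j.+1 g \- horner p^`(j.+1))).
  have := near_eq j.+1 t hj t1 E.
  by apply: filterS => u.
by apply: derivableB; [exact: hg|exact: derivable_horner].
Unshelve. all: by end_near. Qed.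

(** The first zero may be -1, where [f] is merely continuous; hence continuity on closed intervals
    is a separate hypothesis. That the new points avoid the old zeros allows the double nodes to be
    counted in addition. *)
Lemma rolle_path f z0 (z : seq R) : path <%R z0 z ->
  (forall t, t \in z0 :: z -> -1 <= t < 1 /\ f t = 0) ->
  (forall t : R, -1 < t < 1 -> derivable f t 1) ->
  (forall a b : R, a \in z0 :: z -> a < b -> b < 1 -> {within `[a, b], continuous f}) ->
  exists w : seq R, [/\ size w = size z, uniq w &
    forall t, t \in w -> [/\ z0 < t < 1, derive1 f t = 0 & t \notin z0 :: z]].
Proof.
elim: z z0 => [|z1 z IH] z0; first by exists [::].
rewrite [path _ _ _]/= => /andP[z01 hz] h0 hd hc.
have [w [sw uw hw]] : exists w : seq R, [/\ size w = size z, uniq w &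
    forall t, t \in w -> [/\ z1 < t < 1, derive1 f t = 0 & t \notin z1 :: z]].
  apply: IH => // [t tz|a b az]; first by apply: h0; rewrite inE tz orbT.
  by apply: hc; rewrite inE az orbT.
have [[z0l z0r] f0] : (-1 <= z0 /\ z0 < 1) /\ f z0 = 0.
  by have [/andP[]] := h0 z0 (mem_head _ _).
have [[z1l z1r] f1] : (-1 <= z1 /\ z1 < 1) /\ f z1 = 0.
  by have [|/andP[]] := h0 z1; rewrite ?inE ?eqxx ?orbT.
have [||c c01 hfc] := Rolle z01 _ (hc _ _ (mem_head _ _) z01 z1r).
- by move=> t; rewrite in_itv /= => /andP[t0 t1]; apply: hd; lra.
- by rewrite f0 f1.
move: c01; rewrite in_itv /= => /andP[c0 c1].
exists (c :: w); split; first by rewrite /= sw.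
  rewrite /= uw andbT; apply/negP => /hw [/andP[]]; lra.
move=> t; rewrite inE => /predU1P[->|/hw [/andP[t1 t2] ft tz]].
  split; first by lra.
    by rewrite derive1E; apply: derive_val.
  apply/negP; rewrite !inE => /or3P[/eqP|/eqP|]; try lra.
  move: hz; rewrite (path_sortedE (@lt_trans _ _)) => /andP[/allP h _] /h; lra.
split=> //; first by lra.
by rewrite inE negb_or tz andbT; apply/eqP; lra.
Qed.

Lemma rolle_iter N f (s : seq R) : uniq s -> (N < size s)%N ->
  (forall t, t \in s -> -1 < t < 1 /\ f t = 0) ->
  (forall j (t : R), (j < N)%N -> -1 < t < 1 -> derivable (derive1n j f) t 1) ->
  exists2 t, -1 < t < 1 & derive1n N f t = 0.
Proof.
elim: N f s => [|N IH] f s us ss h0 hd.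
  by case: s ss h0 {us} => [//|t s] _ h0; have [] := h0 t (mem_head _ _); exists t.
have srt := sort_lt_sorted s; rewrite us in srt.
have: exists2 z, perm_eq z s & sorted <%R z.
  by exists (sort <=%R s); [rewrite perm_sort|].
case=> -[|z0 z] pz sz; first by rewrite -(perm_size pz) in ss.
have cf t : -1 < t < 1 -> {for t, continuous f}.
  by move=> t1; apply/differentiable_continuous/derivable1_diffP; apply: (hd 0%N).
have [||//|w [sw uw hw]] := @rolle_path f z0 z sz.
- move=> t; rewrite (perm_mem pz) => /h0 [/andP[t1 t2] ->]; split=> //; lra.
- by move=> t; apply: (hd 0%N).
- move=> a b; rewrite (perm_mem pz) => /h0 [/andP[a1 a2] _] ab b1.
  apply: continuous_in_subspaceT => u; rewrite inE /= in_itv /= => /andP[u1 u2].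
  by apply: cf; lra.
have z0s : z0 \in s by rewrite -(perm_mem pz) mem_head.
have [|||t t1 ht] := IH (derive1 f) w uw.
- by rewrite sw; move: ss; rewrite -(perm_size pz).
- move=> t /hw [/andP[t1 t2] ft _]; split=> //; have [/andP[]] := h0 _ z0s; lra.
- by move=> j t jN t1; rewrite -derive1Sn; apply: hd.
- by exists t => //; rewrite derive1Sn.
Qed.

Lemma derivn_monic N p : p \is monic -> size p = N.+1 -> p^`(N) = (N`!)%:R%:P.
Proof.
move=> mp sp; apply/polyP => i; rewrite coef_derivn coefC.
case: i => [|i]; last by rewrite nth_default ?mul0rn // sp; lia.
rewrite addn0 eqxx ffactnn.
by move/monicP: mp; rewrite lead_coefE sp /= => ->.
Qed.

(** The classical argument with double nodes [d] and simple nodes [s]. With [c] making phi = g - H -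
    c om vanish also at [t0], phi has |d| + |s| + 1 zeros; phi' vanishes at the |d| + |s| Rolle
    points and at the |d| double nodes, N + 1 places in all. So g^(N+1) - c (N+1)! vanishes
    somewhere, and [c] is nonnegative. *)
Lemma interpolation_error g N (d s : seq R) H t0 :
  (forall j (t : R), (j <= N)%N -> -1 < t < 1 -> derivable (derive1n j g) t 1) ->
  (forall t : R, -1 < t < 1 -> 0 <= derive1n N.+1 g t) ->
  (forall a b : R, a \in d ++ s -> a < b -> b < 1 -> {within `[a, b], continuous g}) ->
  uniq (d ++ s) -> ((size d).*2 + size s = N.+1)%N -> (size H <= N.+1)%N ->
  (forall t, t \in d -> -1 < t < 1) -> (forall t, t \in s -> -1 <= t < 1) ->
  (forall t, t \in d ++ s -> H.[t] = g t) -> (forall t, t \in d -> H^`().[t] = derive1 g t) ->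
  -1 < t0 < 1 -> t0 \notin d ++ s ->
  0 <= (g t0 - H.[t0]) * (nodal d ^+ 2 * nodal s).[t0].
Proof.
move=> hd hpos hc ud sN sH d1 s1 Hg Hg' t01 t0N.
set om := nodal d ^+ 2 * nodal s.
have nz (z : seq R) : t0 \notin z -> (nodal z).[t0] != 0.
  by rewrite -(root_prod_XsubC z t0) rootE.
have om0 : om.[t0] != 0.
  move: t0N; rewrite mem_cat negb_or => /andP[td ts].
  by rewrite /om hornerM horner_exp mulf_neq0 ?expf_neq0 ?nz.
pose c := (g t0 - H.[t0]) / om.[t0].
suff c0 : 0 <= c.
  have -> : (g t0 - H.[t0]) * om.[t0] = c * om.[t0] ^+ 2 by rewrite /c expr2 mulrA divfK.
  by rewrite mulr_ge0 ?sqr_ge0.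
pose p := H + c *: om.
pose phi t := g t - p.[t].
have hphi := derive1n_subpoly p hd.
have omd t : t \in d ++ s -> om.[t] = 0.
  rewrite mem_cat /om hornerM => /orP[td|ts]; last by rewrite (horner_nodal_mem ts) mulr0.
  by rewrite horner_exp (horner_nodal_mem td) expr0n mul0r.
have omd' t : t \in d -> om^`().[t] = 0.
  move=> td; rewrite /om derivM hornerD !hornerM deriv_exp /= hornerMn hornerM.
  by rewrite horner_exp (horner_nodal_mem td) !(expr0n, mul0r, mulr0, mul0rn, addr0, expr1).
have phi0 t : t \in t0 :: d ++ s -> phi t = 0.
  rewrite inE /phi /p hornerD hornerZ => /predU1P[->|tz].
    by rewrite /c divfK //; ring.
  by rewrite omd // Hg //; ring.
have z1 t : t \in t0 :: d ++ s -> -1 <= t < 1.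
  rewrite inE mem_cat => /or3P[/eqP->|/d1|/s1 //]; lra.
have: exists2 z, perm_eq z (t0 :: d ++ s) & sorted <%R z.
  exists (sort <=%R (t0 :: d ++ s)); first by rewrite perm_sort.
  by rewrite sort_lt_sorted /= t0N ud.
case=> -[|z0 z] pz sz; first by have := perm_size pz.
have cphi t : -1 < t < 1 -> {for t, continuous phi}.
  by move=> t1; apply/differentiable_continuous/derivable1_diffP; apply: (hphi 0%N _ t t1).2.
have [|||w [sw uw hw]] := @rolle_path phi z0 z sz.
- by move=> t; rewrite (perm_mem pz) => tz; rewrite phi0 // z1.
- by move=> t t1; apply: (hphi 0%N _ t t1).2.
- move=> a b; rewrite (perm_mem pz) => az ab b1.
  have gc : {within `[a, b], continuous g}.
    move: az; rewrite inE => /predU1P[->|az]; last exact: hc.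
    apply: continuous_in_subspaceT => u; rewrite inE /= in_itv /= => /andP[u1 u2].
    apply/differentiable_continuous/derivable1_diffP; apply: (hd 0%N) => //; lra.
  move=> u; apply: cvgB; first exact: gc.
  apply: continuous_subspaceT; apply: continuous_horner.
have dphi t : t \in d -> derive1 phi t = 0.
  move=> td; have := (hphi 1%N isT t (d1 t td)).1; rewrite derive1n1 => ->.
  by rewrite derivn1 derivD derivZ hornerD hornerZ omd' // Hg' // mulr0 addr0 subrr.
have [||||xi xi1] := @rolle_iter N (derive1 phi) (w ++ d).
- rewrite cat_uniq uw (subseq_uniq _ ud) ?prefix_subseq // andbT.
  apply/hasPn => t td; apply/negP => /hw [_ _]; rewrite (perm_mem pz).
  by rewrite inE mem_cat td orbT.
- rewrite size_cat sw.
  have := perm_size pz; rewrite /= size_cat => -[->].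
  by rewrite -sN -addnn; lia.
- move=> t; rewrite mem_cat => /orP[/hw [/andP[ta tb] ft _]|td].
    split=> //; have := z1 z0; rewrite -(perm_mem pz) mem_head => /(_ isT); lra.
  by rewrite dphi // d1.
- move=> j t jN t1; rewrite -derive1Sn; exact: (hphi j.+1 (leqW jN) t t1).2 jN.
rewrite -derive1Sn (hphi N.+1 (leqnn _) xi xi1).1 => /eqP.
rewrite subr_eq0 => /eqP E; have := hpos xi xi1; rewrite E.
have mom : om \is monic by rewrite monicMl ?monic_exp ?monic_prod_XsubC.
have som : size om = N.+2.
  rewrite /om size_mul ?expf_neq0 ?nodal_neq0 // size_nodal2 size_prod_XsubC -sN; clear; lia.
rewrite /p derivnD derivnZ (derivn_monic mom som) hornerD hornerZ hornerC.
have -> : H^`(N.+1) = 0.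
  exact: derivn_poly0.
rewrite horner0 add0r pmulr_lge0 // ltr0n fact_gt0 //.
Qed.

End Rolle.

(** * Hermite interpolants and their comparison with the potential *)

Section Hermite.
Context {R : realType}.

(** Newton's scheme: each new node adds a multiple of the polynomial vanishing on the earlier ones;
    at a double node the two coefficients [c] and [e] fit the value and the slope. *)
Lemma hermite_exists (u u' : R -> R) (d s : seq R) : uniq (d ++ s) ->
  exists H : {poly R}, [/\ (size H <= (size d).*2 + size s)%N,
    forall t, t \in d ++ s -> H.[t] = u t & forall t, t \in d -> H^`().[t] = u' t].
Proof.
have nz (z : seq R) t : t \notin z -> (nodal z).[t] != 0.
  by rewrite -(root_prod_XsubC z t) rootE.
elim: d => [|a d IH].
  elim: s => [|a s IH]; first by exists 0; rewrite size_poly0.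
  rewrite cons_uniq => /andP[as_ us]; have [H [sH Hu _]] := IH us.
  exists (H + ((u a - H.[a]) / (nodal s).[a]) *: nodal s); split=> //.
    rewrite (leq_trans (size_polyD _ _)) // geq_max (leq_trans sH) //=.
    by rewrite (leq_trans (size_scale_leq _ _)) // size_prod_XsubC.
  move=> t; rewrite inE hornerD hornerZ => /predU1P[->|ts].
    by rewrite divfK ?nz // addrC subrK.
  by rewrite (horner_nodal_mem ts) mulr0 addr0 Hu.
rewrite [uniq _]/= mem_cat negb_or => /andP[/andP[ad as_] us].
have [H [sH Hu Hu']] := IH us.
pose om := nodal d ^+ 2 * nodal s.
have oma : om.[a] != 0 by rewrite /om hornerM horner_exp mulf_neq0 ?expf_neq0 ?nz.
have om0 t : t \in d ++ s -> om.[t] = 0.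
  rewrite mem_cat /om hornerM => /orP[td|ts]; last by rewrite (horner_nodal_mem ts) mulr0.
  by rewrite horner_exp (horner_nodal_mem td) expr0n mul0r.
have om0' t : t \in d -> om^`().[t] = 0.
  move=> td; rewrite /om derivM hornerD !hornerM deriv_exp /= hornerMn hornerM.
  by rewrite horner_exp (horner_nodal_mem td) !(expr0n, mul0r, mulr0, mul0rn, addr0, expr1).
have som : size om = ((size d).*2 + size s).+1.
  rewrite /om size_mul ?expf_neq0 ?nodal_neq0 // size_nodal2 size_prod_XsubC; clear; lia.
move: om oma om0 om0' som => om oma om0 om0' som.
pose c := (u a - H.[a]) / om.[a].
pose e := (u' a - H^`().[a] - c * om^`().[a]) / om.[a].
exists (H + (c%:P + e *: ('X - a%:P)) * om); split.
- rewrite (leq_trans (size_polyD _ _)) // geq_max (leq_trans sH) //=; last by rewrite doubleS; clear; lia.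
  rewrite (leq_trans (size_polyMleq _ _)) // som.
  have : (size (c%:P + e *: ('X - a%:P))%R <= 2)%N.
    rewrite (leq_trans (size_polyD _ _)) // geq_max (leq_trans (size_polyC_leq1 _)) //=.
    by rewrite (leq_trans (size_scale_leq _ _)) // size_XsubC.
  rewrite doubleS; move: (size _) => z; clear; lia.
- move=> t; rewrite [(a :: d) ++ s]/= inE hornerD hornerM => /predU1P[->|tz]; last first.
    by rewrite om0 // mulr0 addr0 Hu.
  by rewrite hornerD hornerC hornerZ hornerXsubC subrr mulr0 addr0 /c divfK // addrC subrK.
- move=> t; rewrite inE derivD derivM derivD derivC derivZ derivXsubC add0r.
  rewrite hornerD [in X in _ + X]hornerD !hornerM hornerZ hornerC mulr1 hornerD hornerC hornerZ hornerXsubC.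
  move=> /predU1P[->|td].
    by rewrite subrr mulr0 addr0 /e divfK // subrK addrC subrK.
  by rewrite om0 ?mem_cat ?td // om0' // !mulr0 !addr0 Hu'.
Qed.

Lemma within_cvg_right (T : topologicalType) (h : R -> T) (a b : R) : a < b ->
  {within `[a, b], continuous h} -> h @ a^'+ --> h a.
Proof.
move=> ab /subspace_continuousP hc A /(hc a) hA.
have aab : `[a, b]%classic a by rewrite /= in_itv /= lexx ltW.
have := hA aab; rewrite /= !near_simpl /= !near_withinE => hB.
near=> t => at_; apply: (near hB t) => //=.
by rewrite in_itv /= (ltW at_) ltW //; near: t; apply: lt_nbhsl.
Unshelve. all: by end_near. Qed.

Lemma within_cvg_left (T : topologicalType) (h : R -> T) (a b : R) : a < b ->
  {within `[a, b], continuous h} -> h @ b^'- --> h b.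
Proof.
move=> ab /subspace_continuousP hc A /(hc b) hA.
have bab : `[a, b]%classic b by rewrite /= in_itv /= lexx ltW.
have := hA bab; rewrite /= !near_simpl /= !near_withinE => hB.
near=> t => tb; apply: (near hB t) => //=.
by rewrite in_itv /= (ltW tb) andbT ltW //; near: t; apply: lt_nbhsr.
Unshelve. all: by end_near. Qed.

Lemma sign_nodal (s : seq R) (t : R) : (forall a, a \in s -> t < a) ->
  0 < (-1) ^+ size s * (nodal s).[t].
Proof.
elim: s => [|a s IH] hs; first by rewrite /nodal big_nil hornerC mulr1.
rewrite /nodal big_cons -/(nodal s) /= exprS hornerM hornerXsubC.
rewrite mulrACA mulN1r opprB mulr_gt0 // ?subr_gt0 ?hs ?mem_head //.
by apply: IH => b bs; apply: hs; rewrite inE bs orbT.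
Qed.

Section Below.
Variables (h : R -> \bar R) (N : nat).
Let g := fun t => fine (h t).
Hypotheses (h0 : forall t : R, -1 <= t <= 1 -> (0 <= h t)%E)
  (hc : {within `[-1, 1], continuous h})
  (hf : forall t : R, -1 < t < 1 -> h t \is a fin_num)
  (hd : forall (j : nat) (t : R), (j <= N)%N -> -1 < t < 1 -> derivable (derive1n j g) t 1)
  (hN : forall t : R, -1 < t < 1 -> 0 <= derive1n N.+1 g t).

Let hR : h @ (-1)^'+ --> h (-1).
Proof. by apply: (within_cvg_right _ hc); lra. Qed.

Let hL : h @ 1^'- --> h 1.
Proof. by apply: (within_cvg_left _ hc); lra. Qed.

Let gc t : -1 < t < 1 -> {for t, continuous g}.
Proof. by move=> t1; apply/differentiable_continuous/derivable1_diffP; apply: (hd (j := 0%N)). Qed.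

Lemma within_fine (a b : R) : -1 <= a -> (a = -1 -> h (-1) \is a fin_num) -> a < b -> b < 1 ->
  {within `[a, b], continuous g}.
Proof.
move=> a1 ha ab b1; apply/(continuous_within_itvP _ ab); split.
- by move=> t; rewrite in_itv /= => /andP[t1 t2]; apply: gc; lra.
- move: a1; rewrite le_eqVlt => /predU1P[aE|a1].
    rewrite -aE; apply: fine_cvg; rewrite fineK; last by rewrite ha.
    exact: hR.
  by apply: cvg_at_right_filter; apply: gc; lra.
- by apply: cvg_at_left_filter; apply: gc; lra.
Qed.

Lemma endpointR_le (H : {poly R}) : (forall t : R, -1 < t < 1 -> H.[t] <= g t) -> (H.[1]%:E <= h 1)%E.
Proof.
move=> hH; apply: (lee_cvg_to (f := fun t => H.[t]%:E) _ hL).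
  apply: cvg_EFin; first by apply: nearW.
  by apply: cvg_at_left_filter; apply: continuous_horner.
near=> t; have t1 : -1 < t < 1.
  by apply/andP; split; near: t; [apply: nbhs_left_gt; lra|apply: nbhs_left_lt].
by rewrite -(fineK (hf t1)) lee_fin hH.
Unshelve. all: by end_near. Qed.

Lemma endpointL_le (H : {poly R}) : (forall t : R, -1 < t < 1 -> H.[t] <= g t) -> (H.[-1]%:E <= h (-1))%E.
Proof.
move=> hH; apply: (lee_cvg_to (f := fun t => H.[t]%:E) _ hR).
  apply: cvg_EFin; first by apply: nearW.
  by apply: cvg_at_right_filter; apply: continuous_horner.
near=> t; have t1 : -1 < t < 1.
  by apply/andP; split; near: t; [apply: nbhs_right_gt|apply: nbhs_right_lt; lra].
by rewrite -(fineK (hf t1)) lee_fin hH.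
Unshelve. all: by end_near. Qed.

(* Interpolating at an odd number of interior points bounds [h] from above to
   the left of all of them. *)
Lemma endpointL_fin : ~~ odd N -> h (-1) \is a fin_num.
Proof.
move=> oN.
pose s : seq R := [seq - (i.+2)%:R^-1 | i <- iota 0 N.+1].
have us : uniq s.
  rewrite map_inj_uniq ?iota_uniq // => i j /oppr_inj /invr_inj /eqP.
  by rewrite eqr_nat => /eqP [].
have s1 t : t \in s -> - 2^-1 <= t < 0.
  move=> /mapP[i _ ->]; rewrite oppr_lt0 invr_gt0 ltr0n /= andbT.
  by rewrite lerN2 lef_pV2 ?posrE ?ltr0n // ler_nat.
have [H [sH Hg _]] := @hermite_exists g g [::] s us.
rewrite ge0_fin_numE; last by apply: h0; lra.
apply: (@le_lt_trans _ _ (H.[-1]%:E)); last by rewrite ltry.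
apply: (lee_cvg_to (g := fun t => H.[t]%:E) hR).
  apply: cvg_EFin; first by apply: nearW.
  by apply: cvg_at_right_filter; apply: continuous_horner.
near=> t; have t1 : -1 < t < - 2^-1.
  by apply/andP; split; near: t; [apply: nbhs_right_gt|apply: nbhs_right_lt; lra].
have t1' : -1 < t < 1 by lra.
rewrite -(fineK (hf t1')) lee_fin.
have sz : size s = N.+1 by rewrite size_map size_iota.
have ts a : a \in s -> t < a by move=> /s1; lra.
have := sign_nodal ts; rewrite sz -signr_odd /= oN expr1 mulN1r oppr_gt0 => neg.
have := @interpolation_error _ g N [::] s H t hd hN.
rewrite /nodal big_nil expr1n mul1r nmulr_lge0 // subr_le0; apply=> //.
- by move=> a b /s1 a1 ab b1; apply: within_fine => //; lra.
- by rewrite (leq_trans sH) // sz.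
- by move=> a /s1; lra.
- by apply/negP => /ts; rewrite ltxx.
Unshelve. all: by end_near. Qed.

(** The error has the sign of nodal(d)^2 nodal(s), positive off the nodes inside ]-1,1[ because [s]
    contains at most -1. The endpoints follow by passing to the limit, which also covers an infinite
    value of [h]. *)
Lemma hermite_below (d s : seq R) (H : {poly R}) :
  uniq (d ++ s) -> ((size d).*2 + size s = N.+1)%N -> (size H <= N.+1)%N ->
  (forall t, t \in d -> -1 < t < 1) -> (forall t, t \in s -> t = -1) ->
  (s != [::] -> h (-1) \is a fin_num) ->
  (forall t, t \in d ++ s -> H.[t] = g t) -> (forall t, t \in d -> H^`().[t] = derive1 g t) ->
  forall t : R, -1 <= t <= 1 -> (H.[t]%:E <= h t)%E.
Proof.
move=> ud sN sH d1 s1 hs Hg Hg'.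
have hI t : -1 < t < 1 -> H.[t] <= g t.
  move=> t1; have [tds|tds] := boolP (t \in d ++ s); first by rewrite Hg.
  have := @interpolation_error _ g N d s H t hd hN.
  rewrite hornerM pmulr_lge0 ?subr_ge0.
    apply=> //.
    - move=> a b abs ab b1; apply: within_fine => //.
        by move: abs; rewrite mem_cat => /orP[/d1|/s1]; lra.
      move=> aE; apply: hs; apply/eqP => s0; move: abs; rewrite s0 cats0 => /d1; lra.
    - by move=> a /s1; lra.
  rewrite mulr_gt0 // lt0r.
    rewrite horner_nodal2_ge0 andbT horner_exp expf_neq0 // -[_ == _]/(root _ _) root_prod_XsubC.
    by apply: contraNN tds; rewrite mem_cat => ->.
  rewrite -[_ == _]/(root _ _) root_prod_XsubC /nodal horner_prod.
  apply/andP; split; first by apply: contraNN tds; rewrite mem_cat => ->; rewrite orbT.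
  elim: s s1 {sN ud hs Hg tds} => [|a s IH] s1; first by rewrite big_nil.
  rewrite big_cons hornerXsubC mulr_ge0 ?IH //.
    by rewrite (s1 a (mem_head _ _)); lra.
  by move=> b bs; apply: s1; rewrite inE bs orbT.
move=> t /andP[]; rewrite le_eqVlt => /predU1P[<- _|t1]; first exact: endpointL_le.
rewrite le_eqVlt => /predU1P[->|t2]; first exact: endpointR_le.
by have t12 : -1 < t < 1 by [lra|apply/andP]; rewrite -(fineK (hf t12)) lee_fin hI.
Qed.

End Below.
End Hermite.

(** * Optimality of a point whose products are the nodes *)

Section Conclusion.
Context {R : realType}.
Variables (n tau : nat) (C : seq 'rV[R]_n).
Hypotheses (n2 : (2 <= n)%N) (C0 : (0 < size C)%N) (hC : spherical_design tau C).
Variables (P : {poly R}).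
Let k := (tau.+1)./2.
Let eps : nat := ~~ odd tau.
Hypothesis sP : size P = k.+1.
Let F := ('X + 1) ^+ eps * P.
Variables (x : 'rV[R]_n) (alpha : seq R).
Hypotheses (x1 : dotp x x = 1) (hx : forall y, y \in C -> F.[dotp x y] = 0).
Hypotheses (sa : sorted <%R alpha) (ra : forall t, root F t = (t \in alpha)).

Let tauE : (tau.+1 = k.*2 + eps)%N.
Proof. by rewrite /k /eps -[LHS]odd_double_half addnC. Qed.

Let ua : uniq alpha := nodes_uniq sa.
Let szA : size alpha = (k + eps)%N := size_nodes n2 C0 hC sP x1 hx sa ra.

Section Potential.
Variable h : R -> \bar R.
Let g := fun t => fine (h t).
Hypotheses (h0 : forall t : R, -1 <= t <= 1 -> (0 <= h t)%E)
  (hc : {within `[-1, 1], continuous h})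
  (hf : forall t : R, -1 < t < 1 -> h t \is a fin_num)
  (hd : forall (j : nat) (t : R), (j <= tau)%N -> -1 < t < 1 -> derivable (derive1n j g) t 1)
  (hN : forall t : R, -1 < t < 1 -> 0 <= derive1n tau.+1 g t).

Let nodeI a : a \in alpha -> -1 <= a < 1.
Proof.
move=> aa; have := node_itv n2 C0 hC sP x1 hx sa ra aa => /andP[-> a1] /=.
rewrite lt_neqAle a1 andbT; apply: contraTneq aa => ->.
exact: (node_neq1 n2 C0 hC sP x1 hx sa ra).
Qed.

(** For odd [tau] every node is double; for even [tau] the node -1 is simple and the others are
    double. Both times there are [tau.+1] interpolation conditions. *)
Lemma minorant : exists H : {poly R}, [/\ (size H <= tau.+1)%N,
  forall t : R, -1 <= t <= 1 -> (H.[t]%:E <= h t)%E & forall a, a \in alpha -> h a = H.[a]%:E].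
Proof.
have [e0|e1] := boolP (odd tau).
  have aI a : a \in alpha -> -1 < a < 1.
    move=> aa; have /andP[a1 ->] := nodeI aa; rewrite andbT lt_neqAle a1 andbT.
    apply: contraTneq aa => <-; exact: (node_neqN1 n2 C0 hC sP x1 hx sa ra).
  have ua' : uniq (alpha ++ [::]) by rewrite cats0.
  have [H [sH Hg Hg']] := hermite_exists g (derive1 g) ua'.
  have sN : ((size alpha).*2 + size ([::] : seq R) = tau.+1)%N.
    by rewrite szA tauE /eps e0 !addn0.
  rewrite sN in sH; exists H; split=> //.
    by apply: (hermite_below (s := [::]) hc hf hd hN ua' sN sH aI).
  by move=> a aa; rewrite Hg ?cats0 // /g fineK ?hf ?aI.
have hN1 : h (-1) \is a fin_num by apply: (endpointL_fin h0 hc hf hd hN).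
have aN1 : -1 \in alpha.
  by rewrite -ra /F /eps e1 expr1 rootM rootE !hornerE addNr eqxx.
pose d := rem (-1) alpha.
have da a : (a \in d) = (a != -1) && (a \in alpha) by rewrite mem_rem_uniq // inE.
have pd : perm_eq (d ++ [:: -1]) alpha by rewrite perm_catC perm_sym perm_to_rem.
have ud : uniq (d ++ [:: -1]) by rewrite (perm_uniq pd).
have [H [sH Hg Hg']] := hermite_exists g (derive1 g) ud.
have sN : ((size d).*2 + size [:: (-1)%R : R] = tau.+1)%N.
  have := perm_size pd; rewrite size_cat szA addn1 /= tauE /eps e1 /=.
  by move: (size d) k => d' k'; clear; lia.
rewrite sN in sH; exists H; split=> //.
  apply: (hermite_below hc hf hd hN ud sN sH) => // t.
    by rewrite da => /andP[t1 /nodeI /andP[t2 ->]]; rewrite andbT lt_neqAle eq_sym t1.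
  by rewrite inE => /eqP.
move=> a aa; rewrite Hg ?(perm_mem pd) // /g fineK //.
have /andP[] := nodeI aa; rewrite le_eqVlt => /predU1P[<- //|a1 a2].
by apply: hf; rewrite a1.
Qed.

Lemma potential_ge z : dotp z z = 1 ->
  (\sum_(y <- C) h (dotp x y) <= \sum_(y <- C) h (dotp z y))%E.
Proof.
move=> z1; have [H [sH Hh Ha]] := minorant.
have -> : (\sum_(y <- C) h (dotp x y) = \sum_(y <- C) H.[dotp z y]%:E)%E.
  rewrite (eq_big_seq (fun y => H.[dotp x y]%:E)); last first.
    by move=> y yC; rewrite Ha // (node_mem hx ra).
  by rewrite !sumEFin !(sum_poly n2 C0 hC).
rewrite big_seq [leRHS]big_seq; apply: lee_sum => y yC; apply: Hh; exact: dotp_unit_itv z1 (design_unit hC yC).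
Qed.

Lemma potential_nodes :
  (\sum_(y <- C) h (dotp x y) =
   (size C)%:R%:E * \sum_(i < size alpha) (mu_integral n (lagrange_basis alpha i))%:E * h alpha`_i)%E.
Proof.
have [H [sH Hh Ha]] := minorant.
under [in RHS]eq_bigr => i _ do rewrite Ha ?mem_nth // -EFinM.
rewrite sumEFin -EFinM mulr_sumr.
under [in RHS]eq_bigr => i _ do
  rewrite mulrA -(node_count n2 C0 hC sP x1 hx sa ra) // -sum1_count natr_sum mulr_suml big_mkcond.
rewrite exchange_big /= -sumEFin.
apply: eq_big_seq => y yC; have ya := node_mem hx ra yC.
have jl : (index (dotp x y) alpha < size alpha)%N by rewrite index_mem.
rewrite Ha // (bigD1 (Ordinal jl)) //= nth_index // eqxx mul1r big1 ?addr0 // => j jj.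
case: eqP => // e; case/negP: jj; apply/eqP/val_inj => /=.
by rewrite e index_uniq.
Qed.

End Potential.

Lemma conclusion :
  (forall t : R, (t \in [seq dotp x y | y <- C]) = (t \in alpha)) /\
    (forall i : nat, (i < size alpha)%N ->
       (count (fun y => dotp x y == alpha`_i) C)%:R = (size C)%:R * mu_integral n (lagrange_basis alpha i)) /\
    (forall h : R -> \bar R,
       (forall t : R, -1 <= t <= 1 -> (0 <= h t)%E) ->
       {within `[-1, 1], continuous h} ->
       (forall t : R, -1 < t < 1 -> h t \is a fin_num) ->
       let g := fun t : R => fine (h t) in
       (forall (j : nat) (t : R), (j <= tau)%N -> -1 < t < 1 ->
          derivable (derive1n j g) t 1) ->
       (forall t : R, -1 < t < 1 -> 0 <= derive1n tau.+1 g t) ->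
       ereal_inf [set (\sum_(y <- C) h (dotp x y))%E | x in @sphere R n]
         = ((size C)%:R%:E * \sum_(i < size alpha) (mu_integral n (lagrange_basis alpha i))%:E * h alpha`_i)%E /\
       (\sum_(y <- C) h (dotp x y))%E
         = ereal_inf [set (\sum_(y <- C) h (dotp x y))%E | x in @sphere R n]).
Proof.
split; [|split].
- move=> t; apply/mapP/idP => [[y yC ->]|ta]; first exact: (node_mem hx ra).
  have [y yC <-] := node_attained n2 C0 hC sP x1 hx sa ra ta; by exists y.
- exact: (node_count n2 C0 hC sP x1 hx sa ra).
move=> h h0 hc hf g hd hN.
suff E : (\sum_(y <- C) h (dotp x y))%E = ereal_inf [set (\sum_(y <- C) h (dotp x y))%E | x in @sphere R n].
  by split=> //; rewrite -E (potential_nodes h0 hc hf hd hN).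
apply/eqP; rewrite eq_le; apply/andP; split; last by apply: ereal_inf_lbound; exists x.
by apply: le_ereal_inf_tmp => _ [z z1 <-]; apply: (potential_ge h0 hc hf hd hN).
Qed.

End Conclusion.

(** * Few inner products suffice *)

Section Existence.
Context {R : realType}.

(** The list may contain values that are not attained: its length is fixed because its nodal
    polynomial must have degree exactly [k]. *)
Definition few_values n (k : nat) (C : seq 'rV[R]_n) : Prop :=
  exists2 v : 'rV[R]_n, v != 0 & exists2 s : seq R, size s = k & forall y, y \in C -> dotp v y \in s.

Section Zero.
Variables (n tau : nat) (C : seq 'rV[R]_n).
Hypotheses (n2 : (2 <= n)%N) (C0 : (0 < size C)%N) (hC : spherical_design tau C).
Variables (P : {poly R}).
Let k := (tau.+1)./2.
Let eps : nat := ~~ odd tau.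
Hypothesis hP : is_jacobi n 0 eps k P.
Let F := ('X + 1) ^+ eps * P.

Lemma zero_few_values : odd tau -> few_values k C ->
  exists2 x, dotp x x = 1 & forall y, y \in C -> F.[dotp x y] = 0.
Proof.
move=> e0 [v v0 [s sk hs]].
exists ((Num.sqrt (dotp v v))^-1 *: v); first exact: normalize.
apply: (jacobi_vanish n2 C0 hC hP (Q := nodal [seq (Num.sqrt (dotp v v))^-1 * a | a <- s])).
- exact: normalize.
- by rewrite size_prod_XsubC size_map sk.
- move=> y yC; rewrite /eps e0 expr0 mul1r dotpZl horner_nodal_mem //.
  by apply: map_f; apply: hs.
Qed.

(** The product of [- y0] with [y0] is the zero of X + 1, and the negatives of the [k] inner
    products are the zeros of [Q]. *)
Lemma zero_antipode : ~~ odd tau -> size (inner_products C) = k ->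
  exists2 x, dotp x x = 1 & forall y, y \in C -> F.[dotp x y] = 0.
Proof.
move=> e1 sk; case: C C0 hC sk => [//|y0 C'] C0' hC' sk.
have y1 : dotp (- y0) (- y0) = 1.
  by rewrite dotpNl dotpNr opprK (design_unit hC') ?mem_head.
exists (- y0) => //.
apply: (jacobi_vanish n2 C0' hC' hP (Q := nodal [seq - a | a <- inner_products (y0 :: C')])) => //.
  by rewrite size_prod_XsubC size_map sk.
move=> y yC; rewrite /eps e1 expr1 dotpNl hornerM.
have [->|yy0] := eqVneq y y0.
  by rewrite (design_unit hC') ?mem_head // hornerD hornerX hornerC addNr mul0r.
rewrite horner_nodal_mem ?mulr0 //; apply: map_f.
rewrite mem_undup; apply/allpairsPdep; exists y0, y; split; rewrite ?mem_head //.
by rewrite mem_filter yy0.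
Qed.

End Zero.

Section Simplex.
Variables (n tau : nat) (C : seq 'rV[R]_n).
Hypotheses (n2 : (2 <= n)%N) (C0 : (0 < size C)%N) (hC : spherical_design tau C).

(** A vector orthogonal to all points but one is orthogonal to the last one too, since the first
    moment vanishes; the single value is 0. *)
Lemma few_values_simplex : (0 < tau)%N -> (size C <= n)%N -> few_values 1 C.
Proof.
move=> tau0 Cn; case: C C0 Cn hC => [//|y0 C'] _ Cn hC'.
pose A := \matrix_(i < size C') C'`_i.
have [v v0 hv] := exists_orthogonal A Cn.
have hv' y : y \in C' -> dotp v y = 0.
  move=> yC; have iC : (index y C' < size C')%N by rewrite index_mem.
  have := hv (Ordinal iC); rewrite rowK /= nth_index //.
exists v => //; exists [:: 0] => // y; rewrite !inE => /predU1P[->|/hv' -> //].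
have := dot_moment (ltnW n2) (isT : (0 < size (y0 :: C'))%N) hC' v n2 tau0.
rewrite big_cons [mom n 1]/= mulr0 mul0r expr1 big_seq big1 ?addr0 => [->//|y' yC].
by rewrite hv'.
Qed.

End Simplex.

(* A code rescaled to norm [s], with the design property reduced to the moments of inner products. *)
Definition tight_code n tau (s : R) (D : seq 'rV[R]_n) : Prop :=
  [/\ uniq D, forall y, y \in D -> dotp y y = s,
   forall u m, (m <= tau)%N ->
     \sum_(y <- D) dotp u y ^+ m = (size D)%:R * mom n m * (s * dotp u u) ^+ m./2 &
   exists2 p : seq R, size p = (tau.+1)./2 &
     forall y z, y \in D -> z \in D -> y != z -> dotp y z \in p].

Lemma tight_code_scale n tau (s : R) (C : seq 'rV[R]_n) : (2 <= n)%N -> (0 < size C)%N -> 0 < s ->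
  sharp_code (size C) tau C -> 
  tight_code tau s [seq Num.sqrt s *: y | y <- C].
Proof.
move=> n2 C0 s0 [uC [_ [hC sip]]].
have ss : Num.sqrt s * Num.sqrt s = s by rewrite -expr2 sqr_sqrtr ?ltW.
have inj : injective (fun y : 'rV[R]_n => Num.sqrt s *: y).
  by apply: scalerI; rewrite gt_eqF // sqrtr_gt0.
split.
- by rewrite map_inj_uniq.
- move=> _ /mapP[y yC ->]; rewrite dotpZl dotpZr mulrA ss (design_unit hC yC) mulr1 //.
- move=> u m mt; rewrite big_map size_map.
  under eq_bigr do rewrite dotpZr exprMn.
  rewrite -mulr_sumr (dot_moment (ltnW n2) C0 hC) //.
  have [om|em] := boolP (odd m).
    by rewrite mom_odd // !(mulr0, mul0r).
  have -> : Num.sqrt s ^+ m = s ^+ m./2.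
    by rewrite -[in LHS](even_halfK em) -mul2n exprM sqr_sqrtr // ltW.
  by rewrite exprMn; ring.
exists [seq s * a | a <- inner_products C]; first by rewrite size_map.
move=> _ _ /mapP[y yC ->] /mapP[z zC ->]; rewrite (inj_eq inj) => yz.
rewrite dotpZl dotpZr mulrA ss; apply: map_f.
rewrite mem_undup; apply/allpairsPdep; exists y, z; split=> //.
by rewrite mem_filter eq_sym yz.
Qed.

Lemma few_values_scale n k (s : R) (C : seq 'rV[R]_n) : 0 < s ->
  few_values k [seq Num.sqrt s *: y | y <- C] -> few_values k C.
Proof.
move=> s0 [v v0 [l lk hl]]; exists (Num.sqrt s *: v).
  by rewrite scaler_eq0 negb_or v0 andbT gt_eqF // sqrtr_gt0.
exists l => // y yC; rewrite dotpZl -dotpZr; apply: hl; exact: map_f.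
Qed.

Lemma psumr_seq_eq0 (T : eqType) (D : seq T) (f : T -> R) :
  (forall y, y \in D -> 0 <= f y) -> \sum_(y <- D) f y = 0 -> forall y, y \in D -> f y = 0.
Proof.
move=> f0; elim: D f0 => [//|a D IH] f0; rewrite big_cons => /eqP.
have D0 : 0 <= \sum_(y <- D) f y.
  by rewrite big_seq; apply: sumr_ge0 => y yD; apply: f0; rewrite inE yD orbT.
rewrite paddr_eq0 ?f0 ?mem_head // => /andP[/eqP a0 /eqP s0] y.
rewrite inE => /predU1P[->//|]; apply: IH => // z zD; apply: f0; by rewrite inE zD orbT.
Qed.

Section Tight.
Variables (n tau : nat) (s : R) (D : seq 'rV[R]_n).
Hypothesis hD : tight_code tau s D.
Local Notation N := ((size D)%:R : R).

Lemma tight_uniq : uniq D. Proof. by case: hD. Qed.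

Lemma tight_norm y : y \in D -> dotp y y = s. Proof. by case: hD => _ + _ _; apply. Qed.

Lemma tight_moment u m : (m <= tau)%N ->
  \sum_(y <- D) dotp u y ^+ m = N * mom n m * (s * dotp u u) ^+ m./2.
Proof. by case: hD => _ _ + _; apply. Qed.

Lemma moment1 u : (1 <= tau)%N -> \sum_(y <- D) dotp u y = 0.
Proof. by move/(tight_moment u); rewrite mulr0 mul0r. Qed.

Lemma moment3 u : (3 <= tau)%N -> \sum_(y <- D) dotp u y ^+ 3 = 0.
Proof. by move/(tight_moment u); rewrite mom_odd // mulr0 mul0r. Qed.

Lemma moment5 u : (5 <= tau)%N -> \sum_(y <- D) dotp u y ^+ 5 = 0.
Proof. by move/(tight_moment u); rewrite mom_odd // mulr0 mul0r. Qed.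

Lemma moment2 u : (2 <= tau)%N -> \sum_(y <- D) dotp u y ^+ 2 = N / n%:R * s * dotp u u.
Proof. by move/(tight_moment u) ->; rewrite /= addn0 div1r mulr1 expr1 !mulrA. Qed.

Lemma moment4 u : (4 <= tau)%N ->
  \sum_(y <- D) dotp u y ^+ 4 = N * 3 / (n%:R * (n%:R + 2)) * s ^+ 2 * dotp u u ^+ 2.
Proof.
move/(tight_moment u) ->; rewrite /= addn0 natrD invfM exprMn; ring.
Qed.

Lemma moment6 u : (6 <= tau)%N ->
  \sum_(y <- D) dotp u y ^+ 6 = N * 15 / (n%:R * (n%:R + 2) * (n%:R + 4)) * s ^+ 3 * dotp u u ^+ 3.
Proof.
move/(tight_moment u) ->; rewrite /= addn0 !natrD !invfM exprMn; ring.
Qed.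

Lemma moment0 : \sum_(y <- D) (1 : R) = N.
Proof. by rewrite -sum1_size natr_sum. Qed.

Lemma sum_code y (f : R -> R) : y \in D -> (forall z, z \in D -> z != y -> f (dotp y z) = 0) ->
  \sum_(z <- D) f (dotp y z) = f s.
Proof.
move=> yD hf; rewrite (bigD1_seq y) ?tight_uniq //= tight_norm //.
by rewrite big_seq_cond big1 ?addr0 // => z /andP[/hf].
Qed.

Lemma code_neq_le y z : y \in D -> z \in D -> - s <= dotp y z <= s.
Proof.
move=> yD zD; have := dotp_ge0 (y + z); have := dotp_ge0 (y - z).
rewrite !(dotpDl, dotpDr, dotpNl, dotpNr) !tight_norm // (dotpC z y); lra.
Qed.

(** Tightness in the linear programming bound: the term z = y already exhausts the sum. With [f]
    vanishing at the expected products, this determines the inner products from the parameters. *)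
Lemma code_values y (f : R -> R) : (forall t, - s <= t <= s -> 0 <= f t) -> y \in D ->
  \sum_(z <- D) f (dotp y z) = f s -> forall z, z \in D -> z != y -> f (dotp y z) = 0.
Proof.
move=> f0 yD; rewrite (bigD1_seq y) ?tight_uniq //= tight_norm // => /eqP.
rewrite -subr_eq0 addrAC subrr add0r => /eqP; rewrite -big_filter => h z zD zy.
apply: (@psumr_seq_eq0 _ [seq z <- D | z != y] (fun z => f (dotp y z)) _ h).
  by move=> w; rewrite mem_filter => /andP[_ wD]; apply/f0/code_neq_le.
by rewrite mem_filter zy.
Qed.

(** For a polynomial [f] as in [code_values], a zero inside ]-s,s[ is at least double, and two such
    zeros are too many for degree 3. Then sharpness supplies a polynomial vanishing on the products,
    and moments supply linear equations for its coefficients. *)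
Lemma code_quadratic : (tau.+1)./2 = 2 -> exists a b : R,
  forall y z, y \in D -> z \in D -> y != z -> dotp y z ^+ 2 - a * dotp y z + b = 0.
Proof.
move=> k2; case: hD => _ _ _ [p]; rewrite k2.
case: p => [|p1 [|p2 [|]]] // _ hp.
exists (p1 + p2), (p1 * p2) => y z yD zD /(hp _ _ yD zD).
by rewrite !inE => /orP[] /eqP ->; ring.
Qed.

Lemma code_cubic : (tau.+1)./2 = 3 -> exists a b c : R,
  forall y z, y \in D -> z \in D -> y != z -> dotp y z ^+ 3 - a * dotp y z ^+ 2 + b * dotp y z - c = 0.
Proof.
move=> k2; case: hD => _ _ _ [p]; rewrite k2.
case: p => [|p1 [|p2 [|p3 [|]]]] // _ hp.
exists (p1 + p2 + p3), (p1 * p2 + p1 * p3 + p2 * p3), (p1 * p2 * p3) => y z yD zD /(hp _ _ yD zD).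
by rewrite !inE => /or3P[] /eqP ->; ring.
Qed.

End Tight.
End Existence.

(** * Moment sums up to degree seven; the codes of 16 and 56 points *)

Section Small.
Context {R : realType}.
Variables (n tau : nat) (s : R) (D : seq 'rV[R]_n).
Hypothesis hD : tight_code tau s D.
Local Notation N := ((size D)%:R : R).

Lemma sum_deg3 u (c0 c1 c2 c3 : R) : (3 <= tau)%N ->
  \sum_(y <- D) (c0 + c1 * dotp u y + c2 * dotp u y ^+ 2 + c3 * dotp u y ^+ 3) =
  c0 * N + c2 * (N / n%:R * s * dotp u u).
Proof.
move=> t3; rewrite !big_split /= -!mulr_sumr (moment1 hD) ?(moment2 hD) ?(moment3 hD) //; try lia.
by rewrite -[c0]mulr1 -mulr_sumr moment0; ring.
Qed.

Lemma sum_deg5 u (c0 c1 c2 c3 c4 c5 : R) : (5 <= tau)%N ->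
  \sum_(y <- D) (c0 + c1 * dotp u y + c2 * dotp u y ^+ 2 + c3 * dotp u y ^+ 3 +
     c4 * dotp u y ^+ 4 + c5 * dotp u y ^+ 5) =
  c0 * N + c2 * (N / n%:R * s * dotp u u)
    + c4 * (N * 3 / (n%:R * (n%:R + 2)) * s ^+ 2 * dotp u u ^+ 2).
Proof.
move=> t5; do 2 rewrite big_split /= ; rewrite -!mulr_sumr.
rewrite sum_deg3 ?(moment4 hD) ?(moment5 hD) //; try lia.
by ring.
Qed.

Lemma sum_deg7 u (c0 c1 c2 c3 c4 c5 c6 c7 : R) : (7 <= tau)%N ->
  \sum_(y <- D) (c0 + c1 * dotp u y + c2 * dotp u y ^+ 2 + c3 * dotp u y ^+ 3 +
     c4 * dotp u y ^+ 4 + c5 * dotp u y ^+ 5 + c6 * dotp u y ^+ 6 + c7 * dotp u y ^+ 7) =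
  c0 * N + c2 * (N / n%:R * s * dotp u u)
    + c4 * (N * 3 / (n%:R * (n%:R + 2)) * s ^+ 2 * dotp u u ^+ 2)
    + c6 * (N * 15 / (n%:R * (n%:R + 2) * (n%:R + 4)) * s ^+ 3 * dotp u u ^+ 3).
Proof.
move=> t7; do 2 rewrite big_split /= ; rewrite -!mulr_sumr.
rewrite sum_deg5 ?(moment6 hD) //; try lia.
by rewrite (tight_moment hD) // mom_odd //; ring.
Qed.

Lemma code_quadratic_eqs : tau = 3%N -> (0 < size D)%N -> exists a b : R,
  [/\ forall y z, y \in D -> z \in D -> y != z -> dotp y z ^+ 2 - a * dotp y z + b = 0,
   N / n%:R * s ^+ 2 + b * N = s ^+ 2 - a * s + b &
   - a * (N / n%:R * s ^+ 2) = s ^+ 3 - a * s ^+ 2 + b * s].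
Proof.
move=> t3 D0; have [|a [b hab]] := code_quadratic hD; first by rewrite t3.
exists a, b; split=> //.
  have [y yD] : exists y, y \in D by case: (D) D0 => [//|y D'] _; exists y; rewrite mem_head.
  have <- : \sum_(z <- D) (b + (- a) * dotp y z + 1 * dotp y z ^+ 2 + 0 * dotp y z ^+ 3) = s ^+ 2 - a * s + b.
    rewrite (sum_code hD (f := fun t => b + (- a) * t + 1 * t ^+ 2 + 0 * t ^+ 3) yD); first by ring.
    by move=> z zD; rewrite eq_sym => zy; rewrite -[RHS](hab y z yD zD zy); ring.
  by rewrite sum_deg3 ?t3 // (tight_norm hD yD); ring.
have [y yD] : exists y, y \in D by case: (D) D0 => [//|y D'] _; exists y; rewrite mem_head.
have <- : \sum_(z <- D) (0 + b * dotp y z + (- a) * dotp y z ^+ 2 + 1 * dotp y z ^+ 3) = s ^+ 3 - a * s ^+ 2 + b * s.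
  rewrite (sum_code hD (f := fun t => 0 + b * t + (- a) * t ^+ 2 + 1 * t ^+ 3) yD); first by ring.
  by move=> z zD; rewrite eq_sym => zy; transitivity (dotp y z * (dotp y z ^+ 2 - a * dotp y z + b)); [ring|by rewrite hab ?mulr0].
by rewrite sum_deg3 ?t3 // (tight_norm hD yD); ring.
Qed.

End Small.

(** Take y + z with y.z = -3. Its products are all 2 modulo 4, so their squares are at least 4;
    since its norm is 4 the second moment is 4 * 16, which forces equality. *)
Lemma few_values16 (R : realType) (D : seq 'rV[R]_5) : tight_code 3 5 D -> size D = 16%N -> few_values 2 D.
Proof.
move=> hD sD; have [//||a [b [hab]]] := code_quadratic_eqs hD; rewrite ?sD // => e1 e2.
have [y yD] : exists y, y \in D by case: (D) sD => [//|y D'] _; exists y; rewrite mem_head.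
have ips z w : z \in D -> w \in D -> z != w -> dotp z w = 1 \/ dotp z w = - 3.
  move=> zD wD zw; have := hab z w zD wD zw.
  have -> : a = - 2 by lra.
  have -> : b = - 3 by lra.
  move=> e; have /eqP : (dotp z w - 1) * (dotp z w + 3) = 0 by rewrite -[RHS]e; ring.
  by rewrite mulf_eq0 => /orP[] /eqP; [left|right]; lra.
have [z zD [zy yz]] : exists2 z, z \in D & z != y /\ dotp y z = - 3.
  apply: contrapT => h.
  have := sum_deg3 hD y (- 1) 1 0 0 isT; rewrite sD.
  rewrite (eq_bigr (fun z => dotp y z - 1)); last by move=> *; ring.
  rewrite (sum_code hD (f := fun t => t - 1)) //; first by lra.
  move=> z zD zy; have [|->|e] := ips y z yD zD; rewrite 1?eq_sym ?subrr //.
  by case: h; exists z.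
have vv : dotp (y + z) (y + z) = 4.
  rewrite !(dotpDl, dotpDr) !(tight_norm hD) // (dotpC z y) yz; lra.
exists (y + z); first by rewrite -dotp_eq0 vv; apply/eqP; lra.
exists [:: 2; - 2] => // w wD.
have := @psumr_seq_eq0 _ _ D (fun w => dotp (y + z) w ^+ 2 - 4) _ _ w wD.
have -> : (dotp (y + z) w \in [:: 2; - 2]) = (dotp (y + z) w ^+ 2 - 4 == 0).
  have -> : dotp (y + z) w ^+ 2 - 4 = (dotp (y + z) w - 2) * (dotp (y + z) w + 2) by ring.
  by rewrite !inE mulf_eq0 subr_eq0 addr_eq0.
move=> h; apply/eqP; apply: h.
  move=> x xD; rewrite dotpDl.
  have iv u : u \in D -> [\/ dotp u x = 5, dotp u x = 1 | dotp u x = - 3].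
    move=> uD; have [->|ux] := eqVneq u x; first by constructor 1; exact: (tight_norm hD).
    by have [] := ips u x uD xD ux; [constructor 2|constructor 3].
  by have [->|->|->] := iv y yD; have [->|->|->] := iv z zD; lra.
have := sum_deg3 hD (y + z) (- 4) 0 1 0 isT; rewrite sD vv.
rewrite (eq_bigr (fun w => dotp (y + z) w ^+ 2 - 4)) => [->|*]; [by field|by ring].
Qed.

(** At norm 3 all products are odd integers, so y - z has even products, on which t^2 (t^2 - 4) is
    nonnegative. With y.z = 1 the norm of y - z is 4, and the second and fourth moments make the sum
    0. *)
Lemma few_values56 (R : realType) (D : seq 'rV[R]_7) : tight_code 5 3 D -> size D = 56%N -> few_values 3 D.
Proof.
move=> hD sD.
have [y yD] : exists y, y \in D by case: (D) sD => [//|y D'] _; exists y; rewrite mem_head.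
have ips z w : z \in D -> w \in D -> z != w -> [\/ dotp z w = 1, dotp z w = - 1 | dotp z w = - 3].
  move=> zD wD zw; have wz : w != z by rewrite eq_sym.
  have e : (3 + dotp z w) * (dotp z w ^+ 2 - 1) ^+ 2 = 0.
    apply: (code_values hD (f := fun t => (3 + t) * (t ^+ 2 - 1) ^+ 2) _ zD _ wD wz) => [t /andP[t1 _]|].
      by rewrite mulr_ge0 ?sqr_ge0 //; lra.
    rewrite (eq_bigr (fun w => 3 + 1 * dotp z w + (- 6) * dotp z w ^+ 2 + (- 2) * dotp z w ^+ 3
      + 3 * dotp z w ^+ 4 + 1 * dotp z w ^+ 5)); last by move=> *; ring.
    by rewrite (sum_deg5 hD) // sD (tight_norm hD zD); field.
  have /eqP : (3 + dotp z w) * ((dotp z w - 1) ^+ 2 * (dotp z w + 1) ^+ 2) = 0 by rewrite -[RHS]e; ring.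
  rewrite !mulf_eq0 !orbb => /or3P[] /eqP e'; [constructor 3|constructor 1|constructor 2]; lra.
have [z zD [zy yz]] : exists2 z, z \in D & z != y /\ dotp y z = 1.
  apply: contrapT => h.
  have := sum_deg5 hD y 3 4 1 0 0 0 isT; rewrite sD (tight_norm hD yD).
  rewrite (eq_bigr (fun z => (dotp y z + 1) * (dotp y z + 3))); last by move=> *; ring.
  rewrite (sum_code hD (f := fun t => (t + 1) * (t + 3))) //; first by lra.
  move=> z zD zy; have [|e|->|->] := ips y z yD zD; rewrite 1?eq_sym ?addNr ?mul0r ?mulr0 //.
  by case: h; exists z.
have vv : dotp (y - z) (y - z) = 4.
  rewrite !(dotpDl, dotpDr, dotpNl, dotpNr) !(tight_norm hD) // (dotpC z y) yz; lra.
exists (y - z); first by rewrite -dotp_eq0 vv; apply/eqP; lra.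
exists [:: 0; 2; - 2] => // w wD.
have := @psumr_seq_eq0 _ _ D (fun w => dotp (y - z) w ^+ 2 * (dotp (y - z) w ^+ 2 - 4)) _ _ w wD.
have -> : (dotp (y - z) w \in [:: 0; 2; - 2]) = (dotp (y - z) w ^+ 2 * (dotp (y - z) w ^+ 2 - 4) == 0).
  have -> : dotp (y - z) w ^+ 2 - 4 = (dotp (y - z) w - 2) * (dotp (y - z) w + 2) by ring.
  by rewrite !inE !mulf_eq0 orbb subr_eq0 addr_eq0.
move=> h; apply/eqP; apply: h.
  move=> x xD; rewrite dotpBl.
  have iv u : u \in D -> [\/ dotp u x = 3, dotp u x = 1, dotp u x = - 1 | dotp u x = - 3].
    move=> uD; have [->|ux] := eqVneq u x; first by constructor 1; exact: (tight_norm hD).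
    by have [] := ips u x uD xD ux; [constructor 2|constructor 3|constructor 4].
  by have [->|->|->|->] := iv y yD; have [->|->|->|->] := iv z zD; lra.
have := sum_deg5 hD (y - z) 0 0 (- 4) 0 1 0 isT; rewrite sD vv.
rewrite (eq_bigr (fun w => dotp (y - z) w ^+ 2 * (dotp (y - z) w ^+ 2 - 4))) => [->|*]; [by field|by ring].
Qed.

(** * Odd vectors in integral codes *)

(** Over F_2 the cross terms of a symmetric form occur twice and cancel, and x^2 = x, so the
    quadratic form is linear. *)
Lemma sym_F2_quadratic N (M : 'M['F_2]_N) (k : 'cV_N) : M^T = M ->
  (k^T *m M *m k) 0 0 = \sum_i M i i * k i 0.
Proof.
move=> sM.
have two (x : 'F_2) : x + x = 0 by case: x => [[|[|//]] ?]; apply/val_inj.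
have sq (x : 'F_2) : x * x = x by case: x => [[|[|//]] ?]; apply/val_inj.
pose Q (k : 'cV['F_2]_N) : 'F_2 := (k^T *m M *m k) 0 0.
have QD : {morph Q : k1 k2 / k1 + k2}.
  move=> k1 k2; have e : k1^T *m M *m k2 = (k2^T *m M *m k1)^T.
    by rewrite !trmx_mul trmxK sM mulmxA.
  have add (A B : 'M['F_2]_1) : (A + B) 0 0 = A 0 0 + B 0 0 by rewrite mxE.
  have tr (A : 'M['F_2]_1) : A^T 0 0 = A 0 0 by rewrite mxE.
  have -> : Q (k1 + k2) = ((k1^T + k2^T) *m M *m (k1 + k2)) 0 0 by rewrite /Q [(k1 + k2)^T]linearD.
  rewrite mulmxDl mulmxDr !mulmxDl e !add tr -/(Q k1) -/(Q k2).
  by rewrite -[X in _ = X + _]addr0 -(two ((k2^T *m M *m k1) 0 0)) !addrA.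
have Q0 : Q 0 = 0 by rewrite /Q mulmx0 mxE.
rewrite -[LHS]/(Q k) [k in Q k](matrix_sum_delta k).
under eq_bigr do rewrite big_ord1.
rewrite (big_morph Q QD Q0); apply: eq_bigr => i _.
have tz a (u : 'cV['F_2]_N) : (a *: u)^T = a *: u^T by exact: linearZ.
rewrite /Q tz -!scalemxAl -scalemxAr scalerA sq mxE mulrC; congr (_ * _).
by rewrite trmx_delta -rowE -colE !mxE.
Qed.

(** If M k = 0 then 0 = k^T M k is the sum of the entries of k, by the previous lemma. So the
    all-ones row is orthogonal to the kernel and hence lies in the row space. *)
Lemma F2_diag_range N (M : 'M['F_2]_N) : M^T = M -> (forall i, M i i = 1) ->
  exists c : 'rV_N, c *m M = const_mx 1.
Proof.
move=> sM M1; suff /submxP[c ->] : ((const_mx 1 : 'rV_N) <= M)%MS by exists c.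
rewrite submxE; apply/eqP/rowP => j; rewrite [RHS]mxE.
have := sym_F2_quadratic (col j (cokermx M)) sM.
have -> : (col j (cokermx M))^T *m M *m col j (cokermx M) = 0.
  by rewrite -mulmxA [in X in _ *m X]colE (mulmxA M) mulmx_coker mul0mx mulmx0.
rewrite mxE => ->; rewrite mxE; apply: eq_bigr => i _.
by rewrite M1 !mxE.
Qed.

Section OddVector.
Context {R : realType}.

Definition oddr (x : R) := exists z : int, x = (2 * z + 1)%:~R.

Definition zcomb n (D : seq 'rV[R]_n) (v : 'rV[R]_n) :=
  exists f : 'I_(size D) -> int, v = \sum_i (f i)%:~R *: D`_i.

Lemma zcombB n (D : seq 'rV[R]_n) u v : zcomb D u -> zcomb D v -> zcomb D (u - v).
Proof.
move=> [f ->] [g ->]; exists (fun i => f i - g i).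
by rewrite -sumrB; apply: eq_bigr => i _; rewrite -scalerBl intrB.
Qed.

Lemma zcomb_mem n (D : seq 'rV[R]_n) y : y \in D -> zcomb D y.
Proof.
move=> yD; have iD : (index y D < size D)%N by rewrite index_mem.
exists (fun i => (i == Ordinal iD)%:Z); rewrite (bigD1 (Ordinal iD)) //= eqxx scale1r nth_index //.
by rewrite big1 ?addr0 // => i /negbTE ->; rewrite scale0r.
Qed.

Lemma zcombN n (D : seq 'rV[R]_n) v : zcomb D v -> zcomb D (- v).
Proof.
move=> [f ->]; exists (fun i => - f i).
by rewrite -sumrN; apply: eq_bigr => i _; rewrite -scaleNr intrN.
Qed.

Lemma intr_F2 (z : int) : (z%:~R : 'F_2) = 1 -> exists w : int, z = 2 * w + 1.
Proof.
have [w [->|->]] : exists w, z = 2 * w \/ z = 2 * w + 1 by exists (z %/ 2)%Z; lia.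
  rewrite intrM (_ : (2%:~R : 'F_2) = 0) ?mul0r; last exact/val_inj.
  by move/(congr1 val).
by exists w.
Qed.

(** Apply [F2_diag_range] to the Gram matrix scaled by [q] and reduced modulo 2, and lift the
    coefficients to integers. *)
Lemma odd_vector n (D : seq 'rV[R]_n) (q : nat) :
  (forall y z, y \in D -> z \in D -> q%:R * dotp y z \is a Num.int) ->
  (forall y, y \in D -> oddr (q%:R * dotp y y)) ->
  exists2 v, zcomb D v & forall y, y \in D -> oddr (dotp v y).
Proof.
move=> qI qO.
pose m i j : int := Num.floor (q%:R * dotp D`_i D`_j).
pose M : 'M['F_2]_(size D) := \matrix_(i, j) (m i j)%:~R.
have mE (i j : 'I_(size D)) : q%:R * dotp D`_i D`_j = (m i j)%:~R.
  by rewrite /m floorK // qI ?mem_nth.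
have [|i|c cM] := @F2_diag_range _ M.
- by apply/matrixP => i j; rewrite !mxE /m dotpC.
- rewrite mxE /m; have [z ->] := qO D`_i (mem_nth 0 (ltn_ord i)).
  rewrite intrKfloor intrD intrM (_ : (2%:~R : 'F_2) = 0) ?mul0r ?add0r //; exact/val_inj.
exists (\sum_i ((q * (c 0%R i))%:Z)%:~R *: D`_i); first by exists (fun i => (q * (c 0%R i))%:Z).
move=> y yD.
have jD : (index y D < size D)%N by rewrite index_mem.
have [w hw] : exists w : int, \sum_i (nat_of_ord (c 0 i))%:Z * m i (Ordinal jD) = 2 * w + 1.
  apply: intr_F2; have := congr1 (fun A : 'rV_(size D) => A 0 (Ordinal jD)) cM.
  rewrite !mxE => h; rewrite -[RHS]h (rmorph_sum intr) /=; apply: eq_bigr => i _.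
  by rewrite intrM /= !mxE; congr (_ * _); rewrite -pmulrn natr_Zp.
exists w; rewrite -hw dotp_suml (rmorph_sum intr) /=; apply: eq_bigr => i _.
rewrite -[RHS]/((_ * _)%:~R) intrM -(mE i (Ordinal jD)) dotpZl /= nth_index //.
by rewrite PoszM intrM -!pmulrn mulrCA mulrA.
Qed.

Lemma oddr_int x : oddr x -> x \is a Num.int.
Proof. by move=> [z ->]; apply: intr_int. Qed.

(* Parity is unchanged by even translations, so a solution of least norm is
   reduced modulo twice every integral vector. *)
Lemma min_odd_vector n (D : seq 'rV[R]_n) (q : nat) :
  (forall y z, y \in D -> z \in D -> q%:R * dotp y z \is a Num.int) ->
  (forall y, y \in D -> oddr (q%:R * dotp y y)) ->
  exists v, [/\ forall y, y \in D -> oddr (dotp v y), dotp v v \is a Num.int &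
    forall u, zcomb D u -> (forall y, y \in D -> dotp u y \is a Num.int) -> dotp u v <= dotp u u].
Proof.
move=> qI qO; have [v0 zv0 ov0] := odd_vector qI qO.
pose V v := zcomb D v /\ forall y, y \in D -> oddr (dotp v y).
have Vint v : V v -> exists m : nat, dotp v v = m%:R.
  move=> [[f fE] ov]; apply/natrP; rewrite natrEint dotp_ge0 andbT.
  rewrite {1}fE dotp_suml; apply: rpred_sum => i _.
  by rewrite dotpZl rpredM ?intr_int // dotpC; apply/oddr_int/ov/mem_nth.
have [v [zv ov] vmin] : exists2 v, V v & forall w, V w -> dotp v v <= dotp w w.
  have [m mE] := Vint v0 (conj zv0 ov0).
  elim/ltn_ind: m v0 zv0 ov0 mE => m IH v zv ov mE.
  have [[w [[zw ow] lw]]|h] := pselect (exists w, V w /\ dotp w w < dotp v v).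
    have [l lE] := Vint w (conj zw ow).
    by apply: (IH l _ w zw ow lE); rewrite -(ltr_nat R) -lE -mE.
  exists v => // w Vw; rewrite leNgt; apply/negP => lw; apply: h; by exists w.
exists v; split=> //; first by have [m ->] := Vint v (conj zv ov); apply: natr_int.
move=> u zu uI.
have := vmin (v - (u + u)).
rewrite !(dotpDl, dotpDr, dotpNl, dotpNr) (dotpC v u) => h.
suff /h : V (v - (u + u)) by lra.
split; first by rewrite opprD addrA; do 2 apply: zcombB => //.
move=> y yD; have [z zE] := ov y yD; have /intrP[w wE] := uI y yD.
exists (z - w); rewrite !(dotpDl, dotpNl) zE wE !(intrD, intrM, intrN); ring.
Qed.

Lemma oddr_sqr_ge1 x : oddr x -> 1 <= x ^+ 2.
Proof.
move=> [z ->]; rewrite -(rmorphXn intr) /= -[1]/(1%:~R) ler_int expr2; nia.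
Qed.

Lemma oddr_cases x : oddr x -> x <= 3 -> - 3 <= x -> x \in [:: 1; -1; 3; -3].
Proof.
move=> [z ->]; rewrite -[3]/(3%:~R) -[-3]/((-3)%:~R) !ler_int => h1 h2.
have : z \in [:: 0; -1; 1; -2] by rewrite !inE; lia.
rewrite !inE => /or4P[] /eqP ->; rewrite ?mulr0 ?mulr1 /=; apply/or4P.
- by constructor 1; apply/eqP.
- by constructor 2; apply/eqP; ring.
- by constructor 3; apply/eqP; ring.
- by constructor 4; apply/eqP; ring.
Qed.

(** Minimality against [y] and against [- y], both of norm [s]. *)
Lemma odd_bound n tau (s : R) (D : seq 'rV[R]_n) v : tight_code tau s D ->
  (forall y z, y \in D -> z \in D -> dotp y z \is a Num.int) ->
  (forall u, zcomb D u -> (forall y, y \in D -> dotp u y \is a Num.int) -> dotp u v <= dotp u u) ->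
  forall y, y \in D -> - s <= dotp v y <= s.
Proof.
move=> hD hI vmin y yD.
have := vmin y (zcomb_mem yD) (fun z => hI y z yD).
have := vmin (- y) (zcombN (zcomb_mem yD)).
rewrite !(dotpNl, dotpNr) opprK (tight_norm hD) // (dotpC y) => h1 h2.
have /h1 : forall z, z \in D -> dotp (- y) z \is a Num.int by move=> z zD; rewrite dotpNl rpredN hI.
lra.
Qed.

Lemma few_values_cross n (D : seq 'rV[R]_n) : (0 < n)%N -> tight_code 3 1 D -> size D = n.*2 -> few_values 2 D.
Proof.
move=> n0 hD sD.
have n0R : n%:R != 0 :> R by rewrite pnatr_eq0 -lt0n.
have ips y z : y \in D -> z \in D -> y != z -> dotp y z = 0 \/ dotp y z = - 1.
  move=> yD zD; rewrite eq_sym => zy.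
  have /eqP : dotp y z ^+ 2 * (1 + dotp y z) = 0.
    apply: (code_values hD (f := fun t => t ^+ 2 * (1 + t)) _ yD _ zD zy) => [t /andP[t1 _]|].
      by rewrite mulr_ge0 ?sqr_ge0 //; lra.
    rewrite (eq_bigr (fun w => 0 + 0 * dotp y w + 1 * dotp y w ^+ 2 + 1 * dotp y w ^+ 3));
      last by move=> *; ring.
    by rewrite (sum_deg3 hD) // sD (tight_norm hD yD) -muln2 natrM; field.
  rewrite mulf_eq0 expf_eq0 => /orP[/eqP|/eqP]; [left|right] => //; lra.
have hI y z : y \in D -> z \in D -> dotp y z \is a Num.int.
  move=> yD zD; have [->|yz] := eqVneq y z; first by rewrite (tight_norm hD) ?rpred1.
  by have [->|->] := ips y z yD zD yz; rewrite ?rpredN ?rpred0 ?rpred1.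
have [||v [ov _ vmin]] := @min_odd_vector _ D 1.
- by move=> y z yD zD; rewrite mul1r hI.
- by move=> y yD; exists 0; rewrite mul1r (tight_norm hD).
have vb := odd_bound hD hI vmin.
have [y yD] : exists y, y \in D by case: (D) sD => [|y D']; [case: (n) n0|exists y; rewrite mem_head].
exists v; first by apply/eqP => v0; have := oddr_sqr_ge1 (ov y yD); rewrite v0 dotp0l; lra.
exists [:: 1; -1] => // z zD; have /andP[b1 b2] := vb z zD.
have := oddr_cases (ov z zD); rewrite !inE => /(_ _ _)/or4P[||/eqP->//|/eqP->|/eqP|/eqP]; rewrite ?eqxx ?orbT //; lra.
Qed.

(** At norm 3 the minimal odd vector has odd products between -3 and 3: already only four values. *)
Lemma few_values4600 (D : seq 'rV[R]_23) : tight_code 7 3 D -> size D = 4600%N -> few_values 4 D.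
Proof.
move=> hD sD.
have ips y z : y \in D -> z \in D -> y != z -> [\/ dotp y z = 0, dotp y z = 1, dotp y z = - 1 | dotp y z = - 3].
  move=> yD zD; rewrite eq_sym => zy.
  have e : (3 + dotp y z) * (dotp y z ^+ 2 * (dotp y z ^+ 2 - 1) ^+ 2) = 0.
    apply: (code_values hD (f := fun t => (3 + t) * (t ^+ 2 * (t ^+ 2 - 1) ^+ 2)) _ yD _ zD zy) => [t /andP[t1 _]|].
      have t3 : 0 <= 3 + t by lra.
      by rewrite mulr_ge0 // mulr_ge0 ?sqr_ge0.
    rewrite (eq_bigr (fun w => 0 + 0 * dotp y w + 3 * dotp y w ^+ 2 + 1 * dotp y w ^+ 3
      + (- 6) * dotp y w ^+ 4 + (- 2) * dotp y w ^+ 5 + 3 * dotp y w ^+ 6 + 1 * dotp y w ^+ 7));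
      last by move=> *; ring.
    by rewrite (sum_deg7 hD) // sD (tight_norm hD yD); field.
  have /eqP : (3 + dotp y z) * (dotp y z * dotp y z * ((dotp y z - 1) ^+ 2 * (dotp y z + 1) ^+ 2)) = 0.
    by rewrite -[RHS]e; ring.
  rewrite !mulf_eq0 !orbb => /or4P[] /eqP e'; [constructor 4|constructor 1|constructor 2|constructor 3]; lra.
have hI y z : y \in D -> z \in D -> dotp y z \is a Num.int.
  move=> yD zD; have [->|yz] := eqVneq y z; first by rewrite (tight_norm hD) ?rpred_nat.
  by have [->|->|->|->] := ips y z yD zD yz; rewrite ?rpredN ?rpred0 ?rpred1 ?rpred_nat.
have [||v [ov _ vmin]] := @min_odd_vector _ D 1.
- by move=> y z yD zD; rewrite mul1r hI.
- by move=> y yD; exists 1; rewrite mul1r (tight_norm hD) //; ring.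
have vb := odd_bound hD hI vmin.
have [y yD] : exists y, y \in D by case: (D) sD => [|y D'] // _; exists y; rewrite mem_head.
exists v; first by apply/eqP => v0; have := oddr_sqr_ge1 (ov y yD); rewrite v0 dotp0l; lra.
by exists [:: 1; -1; 3; -3] => // z zD; have /andP[b1 b2] := vb z zD; apply: oddr_cases (ov z zD) _ _.
Qed.

Lemma sumr_const_seq (T : Type) (s : seq T) (c : R) : \sum_(y <- s) c = (size s)%:R * c.
Proof. by rewrite big_const_seq count_predT iter_addr addr0 mulr_natl. Qed.

(** * Two-distance codes: 100 and 162 points *)

Section TwoDistance.
Variables (n : nat) (D : seq 'rV[R]_n) (beta : R) (q : nat).
Hypotheses (hD : tight_code 3 (beta + 2) D) (D0 : (0 < size D)%N) (qb : q%:R * beta = 1).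
Hypothesis ips : forall y z, y \in D -> z \in D -> y != z -> dotp y z = beta \/ dotp y z = beta - 1.

Let norm y : y \in D -> dotp y y = beta + 2 := tight_norm hD (y := y).

Lemma two_distance_int y z : y \in D -> z \in D -> dotp y z - beta \is a Num.int.
Proof.
move=> yD zD; have [->|yz] := eqVneq y z; first by rewrite norm // addrAC subrr add0r rpred_nat.
have [->|->] := ips yD zD yz; first by rewrite subrr rpred0.
by rewrite addrAC subrr add0r rpredN rpred1.
Qed.

(** All products are [beta] modulo 1, so the points are not integral but their differences are. A
    difference has norm 4 or 6, the latter only for the smaller product, and minimality against it
    bounds the spread of [v] on the code. *)
Lemma two_distance_vector : exists2 v, (forall y, y \in D -> oddr (dotp v y)) /\ dotp v v \is a Num.int &
  forall y z, y \in D -> z \in D -> y != z ->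
    dotp v y - dotp v z <= 4 \/ dotp v y - dotp v z <= 6 /\ dotp y z = beta - 1.
Proof.
have [||v [ov vI vmin]] := @min_odd_vector _ D q.
- move=> y z yD zD; rewrite -(subrK beta (dotp y z)) mulrDr qb rpredD ?rpred1 //.
  by rewrite rpredM ?rpred_nat // two_distance_int.
- move=> y yD; exists q; rewrite norm // mulrDr qb intrD intrM -[(Posz q)%:~R]/(q%:R); ring.
exists v => // y z yD zD yz.
have := vmin (y - z) (zcombB (zcomb_mem yD) (zcomb_mem zD)).
rewrite (dotpC _ v) dotpBr !(dotpDl, dotpDr, dotpNl, dotpNr) !norm // (dotpC z y) => h.
have /h {}h : forall x, x \in D -> dotp (y - z) x \is a Num.int.
  move=> x xD; rewrite dotpBl (_ : _ - _ = dotp y x - beta - (dotp z x - beta)); last by ring.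
  by rewrite rpredB ?two_distance_int.
by have [e|e] := ips yD zD yz; [left|right; split=> //]; rewrite e in h; lra.
Qed.

Lemma oddr_cube_le x : oddr x -> -1 <= x -> x != 1 -> x != -1 -> 0 < x ^+ 3 - x.
Proof.
move=> [z ->]; rewrite -[-1]/((-1)%:~R) -[1]/(1%:~R) ler_int !eqr_int => h1 h2 h3.
rewrite subr_gt0 -(rmorphXn intr) ltr_int /= !exprSr expr0; nia.
Qed.

(** The first and third moments vanish, so t^3 - t sums to 0. If all values are at least -1, or all
    at most 1, these terms have one sign and every value is 1 or -1. Otherwise values at most -3 and
    at least 3 both occur, and the spread 6 confines all of them to [-3,3]. *)
Lemma two_distance_range v : (forall y, y \in D -> oddr (dotp v y)) ->
  (forall y z, y \in D -> z \in D -> dotp v y - dotp v z <= 6) ->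
  forall y, y \in D -> dotp v y \in [:: 1; -1; 3; -3].
Proof.
move=> ov h6 y yD.
have S : \sum_(y <- D) (dotp v y ^+ 3 - dotp v y) = 0.
  rewrite (eq_bigr (fun w => 0 + (-1) * dotp v w + 0 * dotp v w ^+ 2 + 1 * dotp v w ^+ 3)); last by move=> *; ring.
  by rewrite (sum_deg3 hD) // !mul0r addr0.
have key (e : R) : (e = 1 \/ e = -1) -> (forall z, z \in D -> -1 <= e * dotp v z) ->
    forall z, z \in D -> dotp v z \in [:: 1; -1; 3; -3].
  move=> e1 he z zD.
  have oe w : w \in D -> oddr (e * dotp v w).
    move=> wD; have [a ->] := ov w wD; case: e1 => ->; first by exists a; rewrite mul1r.
    by exists (- a - 1); rewrite !(intrD, intrM, intrN); ring.
  have S' : \sum_(y <- D) ((e * dotp v y) ^+ 3 - e * dotp v y) = 0.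
    transitivity (e * \sum_(y <- D) (dotp v y ^+ 3 - dotp v y)); last by rewrite S mulr0.
    by rewrite mulr_sumr; apply: eq_bigr => w _; case: e1 => ->; ring.
  have e0 : (e * dotp v z) ^+ 3 - e * dotp v z = 0.
    apply: (psumr_seq_eq0 _ S') zD => w wD; have [->|w1] := eqVneq (e * dotp v w) 1; first by lra.
    by have [->|w2] := eqVneq (e * dotp v w) (-1); [lra|apply/ltW/oddr_cube_le => //; [exact: oe|exact: he]].
  have [w1|w1] := eqVneq (e * dotp v z) 1.
    by case: e1 w1 => -> w1; rewrite !inE; [rewrite (_ : dotp v z = 1)|rewrite (_ : dotp v z = -1)]; rewrite ?eqxx ?orbT //; lra.
  have [w2|w2] := eqVneq (e * dotp v z) (-1).
    by case: e1 w2 => -> w2; rewrite !inE; [rewrite (_ : dotp v z = -1)|rewrite (_ : dotp v z = 1)]; rewrite ?eqxx ?orbT //; lra.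
  by have := oddr_cube_le (oe z zD) (he z zD) w1 w2; rewrite e0 ltxx.
have step x w : oddr x -> oddr w -> w < x -> w + 2 <= x.
  by move=> [a ->] [b ->]; rewrite ltr_int => ?; rewrite -[X in _ + X <= _]/(2%:~R) -intrD ler_int; lia.
have oN1 : oddr (-1) by exists (-1); rewrite !(intrD, intrM, intrN); ring.
have o1 : oddr 1 by exists 0.
have [hlow|hlow] := pselect (forall z, z \in D -> -1 <= dotp v z).
  by apply: (key 1) => //; [left|move=> z zD; rewrite mul1r hlow].
have [hup|hup] := pselect (forall z, z \in D -> dotp v z <= 1).
  by apply: (key (-1)) => //; [right|move=> z zD; have := hup z zD; lra].
have [a aD a1] : exists2 a, a \in D & dotp v a < -1.
  by apply: contrapT => h; apply: hlow => z zD; rewrite leNgt; apply/negP => ?; apply: h; exists z.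
have [b bD b1] : exists2 b, b \in D & 1 < dotp v b.
  by apply: contrapT => h; apply: hup => z zD; rewrite leNgt; apply/negP => ?; apply: h; exists z.
have a3 := step _ _ oN1 (ov a aD) a1.
have b3 := step _ _ (ov b bD) o1 b1.
have := h6 y a yD aD; have := h6 b y bD yD => h1 h2.
by apply: oddr_cases (ov y yD) _ _; lra.
Qed.

(** Expand the squared norm of sum A + sum B: each set contributes at most a (a beta + 2), and the
    cross product is a^2 (beta - 1). *)
Lemma two_distance_bound (a : nat) (A B : seq 'rV[R]_n) : uniq A -> uniq B -> size A = a -> size B = a ->
  {subset A <= D} -> {subset B <= D} -> (forall y z, y \in A -> z \in B -> dotp y z = beta - 1) ->
  (0 < a)%N -> a%:R * (1 - 2 * beta) <= 2.
Proof.
move=> uA uB sA sB AD BD AB a0.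
have own E y : uniq E -> size E = a -> {subset E <= D} -> y \in E ->
    dotp y (\sum_(z <- E) z) <= a%:R * beta + 2.
  move=> uE sE ED yE; rewrite dotp_sumr (bigD1_seq y) //= norm ?ED //.
  have -> : a%:R * beta + 2 = beta + 2 + \sum_(z <- E | z != y) beta.
    rewrite -[a%:R * beta](_ : \sum_(z <- E) beta = _); last by rewrite sumr_const_seq sE.
    by rewrite [in LHS](bigD1_seq y) //=; ring.
  rewrite lerD2l big_seq_cond [leRHS]big_seq_cond; apply: ler_sum => z /andP[zE zy].
  by rewrite eq_sym in zy; have [->|->] := ips (ED _ yE) (ED _ zE) zy; lra.
have cross : dotp (\sum_(y <- A) y) (\sum_(z <- B) z) = a%:R * a%:R * (beta - 1).
  rewrite dotp_suml (eq_big_seq (fun _ => a%:R * (beta - 1))).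
    by rewrite sumr_const_seq sA mulrA.
  move=> y yA; rewrite dotp_sumr (eq_big_seq (fun _ => beta - 1)).
    by rewrite sumr_const_seq sB.
  by move=> z; apply: AB.
have self E : uniq E -> size E = a -> {subset E <= D} ->
    dotp (\sum_(y <- E) y) (\sum_(y <- E) y) <= a%:R * (a%:R * beta + 2).
  move=> uE sE ED; rewrite {1}dotp_suml.
  have -> : a%:R * (a%:R * beta + 2) = \sum_(y <- E) (a%:R * beta + 2).
    by rewrite sumr_const_seq sE.
  by rewrite big_seq [leRHS]big_seq; apply: ler_sum => y yE; apply: own.
have := dotp_ge0 (\sum_(y <- A) y + \sum_(y <- B) y).
rewrite !(dotpDl, dotpDr) (dotpC (\sum_(y <- B) y) (\sum_(y <- A) y)) cross.
have := self A uA sA AD; have := self B uB sB BD => h1 h2 h3.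
have a0' : 0 < a%:R :> R by rewrite ltr0n.
rewrite -(ler_pM2l a0'); lra.
Qed.

(** [A] and [B] collect the values 3 and -3. The odd moments give them the same size a, and the
    second moment gives N + 16 a = c |v|^2; this divisibility makes a too large for
    [two_distance_bound] unless a = 0. *)
Lemma few_values_two_distance (c : nat) : (size D)%:R / n%:R * (beta + 2) = c%:R ->
  (forall a r : nat, (size D + 16 * a = c * r)%N -> (0 < a)%N -> 2 < a%:R * (1 - 2 * beta)) ->
  few_values 2 D.
Proof.
move=> cE ha; have [v [ov vI] h46] := two_distance_vector.
have vR := two_distance_range ov.
have {}vR y : y \in D -> dotp v y \in [:: 1; -1; 3; -3].
  move=> yD; apply: vR => // {yD}y z yD zD; have [->|yz] := eqVneq y z; first by rewrite subrr; lra.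
  by have [|[]] := h46 y z yD zD yz; lra.
pose A := [seq y <- D | dotp v y == 3]; pose B := [seq y <- D | dotp v y == -3].
have ind (e : R) : \sum_(y <- D) (dotp v y == e)%:R = (size [seq y <- D | dotp v y == e])%:R :> R.
  by rewrite size_filter -sum1_count natr_sum [RHS]big_mkcond; apply: eq_bigr => y _; case: eqP.
have vals y : y \in D -> [/\ dotp v y ^+ 3 - dotp v y = 24 * (dotp v y == 3)%:R - 24 * (dotp v y == -3)%:R
    & dotp v y ^+ 2 = 1 + 8 * (dotp v y == 3)%:R + 8 * (dotp v y == -3)%:R].
  move=> /vR; have ne (x y' : R) : x < y' -> (x == y') = false /\ (y' == x) = false.
    by move=> xy; rewrite lt_eqF // gt_eqF.
  have [n1 _] := ne 1 3 ltac:(lra); have [_ n2] := ne (-3) 1 ltac:(lra).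
  have [n3 _] := ne (-1) 3 ltac:(lra); have [_ n4] := ne (-3) (-1) ltac:(lra).
  have [n5 n6] := ne (-3) 3 ltac:(lra).
  by rewrite !inE => /or4P[] /eqP ->; rewrite ?eqxx ?n1 ?n2 ?n3 ?n4 ?n5 ?n6 /=; split; ring.
have sAB : size A = size B.
  have : \sum_(y <- D) (dotp v y ^+ 3 - dotp v y) = 0.
    rewrite (eq_bigr (fun w => 0 + (-1) * dotp v w + 0 * dotp v w ^+ 2 + 1 * dotp v w ^+ 3)); last by move=> *; ring.
    by rewrite (sum_deg3 hD) // !mul0r addr0.
  rewrite (eq_big_seq (fun y => 24 * (dotp v y == 3)%:R - 24 * (dotp v y == -3)%:R)); last by move=> y /vals[].
  rewrite sumrB -!mulr_sumr !ind -/A -/B => h; apply/eqP; rewrite -(eqr_nat R); apply/eqP; lra.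
have [r rE] : exists r : nat, dotp v v = r%:R by apply/natrP; rewrite natrEint vI dotp_ge0.
have sE : (size D + 16 * size A = c * r)%N.
  have := moment2 hD v isT; rewrite cE rE.
  rewrite (eq_big_seq (fun y => 1 + 8 * (dotp v y == 3)%:R + 8 * (dotp v y == -3)%:R)); last by move=> y /vals[].
  rewrite !big_split /= -!mulr_sumr !ind -/A -/B -sAB moment0 => h.
  by apply/eqP; rewrite -(eqr_nat R) natrD !natrM -h; apply/eqP; ring.
have sA0 : size A = 0%N.
  apply/eqP; rewrite -leqn0 leqNgt; apply/negP => A0; have := ha _ _ sE A0.
  apply/negP; rewrite -leNgt; apply: (@two_distance_bound (size A) A B) => //.
  - by rewrite filter_uniq ?(tight_uniq hD).
  - by rewrite filter_uniq ?(tight_uniq hD).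
  - by move=> y; rewrite mem_filter => /andP[].
  - by move=> y; rewrite mem_filter => /andP[].
  move=> y z; rewrite !mem_filter => /andP[/eqP y3 yD] /andP[/eqP z3 zD].
  have yz : y != z by apply/eqP => e; move: y3; rewrite e z3; lra.
  by have [|[]//] := h46 y z yD zD yz; rewrite y3 z3; lra.
have A0 : A = [::] by apply: size0nil.
have B0 : B = [::] by apply: size0nil; rewrite -sAB.
have [y yD] : exists y, y \in D by case: (D) D0 => [|y D'] // _; exists y; rewrite mem_head.
exists v; first by apply/eqP => v0; have := oddr_sqr_ge1 (ov y yD); rewrite v0 dotp0l; lra.
exists [:: 1; -1] => // z zD; have := vR z zD; rewrite !inE => /or4P[->|->|h|h]; rewrite ?orbT //.
  by have : z \in A; [rewrite mem_filter h|rewrite A0].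
by have : z \in B; [rewrite mem_filter h|rewrite B0].
Qed.

End TwoDistance.

Lemma few_values_two_distance_params n (D : seq 'rV[R]_n) (beta : R) (q c : nat) :
  tight_code 3 (beta + 2) D -> (0 < size D)%N -> q%:R * beta = 1 ->
  (forall a b : R, (size D)%:R / n%:R * (beta + 2) ^+ 2 + b * (size D)%:R = (beta + 2) ^+ 2 - a * (beta + 2) + b ->
   - a * ((size D)%:R / n%:R * (beta + 2) ^+ 2) = (beta + 2) ^+ 3 - a * (beta + 2) ^+ 2 + b * (beta + 2) ->
   a = 2 * beta - 1 /\ b = beta * (beta - 1)) ->
  (size D)%:R / n%:R * (beta + 2) = c%:R ->
  (forall a r : nat, (size D + 16 * a = c * r)%N -> (0 < a)%N -> 2 < a%:R * (1 - 2 * beta)) ->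
  few_values 2 D.
Proof.
move=> hD D0 qb hab cE ha.
have [//||a [b [h e1 e2]]] := code_quadratic_eqs hD; first by [].
have [aE bE] := hab a b e1 e2.
apply: (few_values_two_distance hD D0 qb _ cE ha) => y z yD zD yz.
have /eqP : (dotp y z - beta) * (dotp y z - (beta - 1)) = 0.
  by rewrite -[RHS](h y z yD zD yz) aE bE; ring.
by rewrite mulf_eq0 !subr_eq0 => /orP[] /eqP; [left|right].
Qed.

Lemma few_values100 (D : seq 'rV[R]_22) : tight_code 3 (5^-1 + 2) D -> size D = 100%N -> few_values 2 D.
Proof.
move=> hD sD; apply: (few_values_two_distance_params (q := 5%N) (c := 10%N) hD); rewrite ?sD //; [by lra|by move=> a b; lra|by lra|].
(* Since 10 divides 100 + 16 a, 5 divides a; and 5 (1 - 2/5) = 3. *)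
move=> a r e a0; have a5 : (5 <= a)%N by lia.
have : 5 <= a%:R :> R by rewrite (ler_nat R 5).
lra.
Qed.

Lemma few_values162 (D : seq 'rV[R]_21) : tight_code 3 (3^-1 + 2) D -> size D = 162%N -> few_values 2 D.
Proof.
move=> hD sD; apply: (few_values_two_distance_params (q := 3%N) (c := 18%N) hD); rewrite ?sD //; [by lra|by move=> a b; lra|by lra|].
(* Since 18 divides 162 + 16 a, 9 divides a; and 9 (1 - 2/3) = 3. *)
move=> a r e a0; have a9 : (9 <= a)%N by lia.
have : 9 <= a%:R :> R by rewrite (ler_nat R 9).
lra.
Qed.

End OddVector.

(** * Ternary words and the codes of 112 and 552 points *)

Section F3.

Definition word := {ffun 'I_10 -> 'F_3}.
Implicit Types (p q w x : word).
Definition wdot p q : 'F_3 := \sum_i p i * q i.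

Lemma F3_case (a : 'F_3) : [\/ a = 0, a = 1 | a = -1].
Proof. by case: a => [[|[|[|//]]] ?]; [constructor 1|constructor 2|constructor 3]; apply/val_inj. Qed.

Lemma wdotC p q : wdot p q = wdot q p.
Proof. by apply: eq_bigr => i _; rewrite mulrC. Qed.

Lemma wdotDl p q x : wdot (p + q) x = wdot p x + wdot q x.
Proof. by rewrite -big_split; apply: eq_bigr => i _; rewrite ffunE mulrDl. Qed.

Lemma wdotNl p x : wdot (- p) x = - wdot p x.
Proof. by rewrite -sumrN; apply: eq_bigr => i _; rewrite ffunE mulNr. Qed.

Lemma wdotBl p q x : wdot (p - q) x = wdot p x - wdot q x.
Proof. by rewrite wdotDl wdotNl. Qed.

Lemma wdotDr p q x : wdot x (p + q) = wdot x p + wdot x q.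
Proof. by rewrite !(wdotC x) wdotDl. Qed.

Lemma wdotBr p q x : wdot x (p - q) = wdot x p - wdot x q.
Proof. by rewrite !(wdotC x) wdotBl. Qed.

(** Its sum over F_3 is 0 and it is positive only at -1, so a positive total of [g3 (wdot x x)]
    exhibits a word of norm -1. *)
Definition g3 (a : 'F_3) : int := if a == -1 then 2 else -1.

Lemma g3_sum (a c : 'F_3) : c != 0 -> g3 a + g3 (a + c) + g3 (a + c + c) = 0.
Proof. by case: (F3_case a) => ->; case: (F3_case c) => ->. Qed.

(* Translating by the isotropic [w] runs [wdot x x] through all residues unless [x] is orthogonal to [w]. *)
Lemma isotropic_restrict (P : pred word) w : wdot w w = 0 ->
  (forall x, P (x + w) = P x) ->
  \sum_(x | P x && (wdot x w == 0)) g3 (wdot x x) = \sum_(x | P x) g3 (wdot x x).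
Proof.
move=> w0 Pw; rewrite [RHS](bigID (fun x => wdot x w == 0)) /=.
rewrite -[LHS]addr0; congr (_ + _); apply/esym.
set S := \sum_(x | _) _.
have shift (f : word -> int) : \sum_(x | P x && (wdot x w != 0)) f x =
    \sum_(x | P x && (wdot x w != 0)) f (x + w).
  rewrite (reindex_inj (addIr w)) /=; apply: eq_bigl => x.
  by rewrite Pw wdotDl w0 addr0.
pose f x := g3 (wdot x x).
have S1 : S = \sum_(x | P x && (wdot x w != 0)) f (x + w) := shift f.
have S2 : S = \sum_(x | P x && (wdot x w != 0)) f (x + w + w) by rewrite S1 (shift (fun x => f (x + w))).
have : S + S + S = 0.
  rewrite [X in _ + X]S2 [X in _ + X + _]S1 /S -!big_split big1 //= => x /andP[_ xw].
  rewrite /f !(wdotDl, wdotDr) w0 (wdotC w x) !addr0.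
  have c0 : wdot x w + wdot x w != 0 by case: (F3_case (wdot x w)) xw => ->.
  rewrite -[RHS](g3_sum (wdot x x) c0); congr (_ + g3 _ + g3 _); ring.
lia.
Qed.

Lemma isotropic_restrict_all (P : pred word) (ws : seq word) :
  (forall w, w \in ws -> forall x, P (x + w) = P x) ->
  (forall w w', w \in ws -> w' \in ws -> wdot w w' = 0) ->
  \sum_(x | P x && all (fun w => wdot x w == 0) ws) g3 (wdot x x) = \sum_(x | P x) g3 (wdot x x).
Proof.
elim: ws => [|w ws IH] hP hw; first by apply: eq_bigl => x; rewrite andbT.
rewrite -IH; last first.
- by move=> u u' uw uw'; apply: hw; rewrite inE (uw, uw') orbT.
- by move=> u uw; apply: hP; rewrite inE uw orbT.
rewrite -[RHS](@isotropic_restrict _ w).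
- by apply: eq_bigl => x /=; rewrite -andbA; congr (_ && _); rewrite andbC.
- by rewrite hw ?mem_head.
move=> x; rewrite hP ?mem_head //; congr (_ && _); apply: eq_in_all => u uw.
by rewrite wdotDl (hw w u) ?addr0 ?mem_head // inE uw orbT.
Qed.

Lemma isotropic_exists (P : pred word) (ws : seq word) :
  (forall w, w \in ws -> forall x, P (x + w) = P x) ->
  (forall w w', w \in ws -> w' \in ws -> wdot w w' = 0) ->
  0 < \sum_(x | P x) g3 (wdot x x) ->
  exists x, [/\ P x, wdot x x = -1 & forall w, w \in ws -> wdot x w = 0].
Proof.
move=> hP hw; rewrite -(isotropic_restrict_all hP hw) => S0.
apply: contrapT => h; move: S0; apply/negP; rewrite -leNgt; apply: sumr_le0 => x /andP[Px /allP xw].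
rewrite /g3; case: eqP => // e; case: h; exists x; split=> // w /xw /eqP //.
Qed.

Definition gsum (c : 'F_3) : int := \sum_(x : word) g3 (wdot x x + c).

(** The norm on the first [k] letters, still summed over full words, so that [B] can be computed
    letter by letter: a letter contributes the squares 0, 1, 1. *)
Let Q (k : nat) x : 'F_3 := \sum_(i < 10 | (i < k)%N) x i * x i.
Let B k c : int := \sum_(x : word) g3 (Q k x + c).

Let Q_S (k : 'I_10) x : Q k.+1 x = Q k x + x k * x k.
Proof.
rewrite /Q (bigD1 k) //= addrC; congr (_ + _); apply: eq_bigl => i.
by rewrite ltnS ltn_neqAle andbC.
Qed.

Let B_S (k : 'I_10) c : 3 * B k.+1 c = B k c + B k (c + 1) + B k (c + 1).
Proof.
pose e : word := [ffun i => (i == k)%:R].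
have Qe x : Q k (x + e) = Q k x.
  apply: eq_bigr => i ik; rewrite !ffunE; case: eqP => [ike|]; last by rewrite !addr0.
  by rewrite ike ltnn in ik.
have ek x : (x + e) k = x k + 1 by rewrite !ffunE eqxx.
have E1 : B k.+1 c = \sum_(x : word) g3 (Q k.+1 (x + e) + c).
  by rewrite /B (reindex_inj (addIr e)).
have E2 : B k.+1 c = \sum_(x : word) g3 (Q k.+1 (x + e + e) + c).
  by rewrite E1 (reindex_inj (addIr e)).
have -> : 3 * B k.+1 c = B k.+1 c + \sum_(x : word) g3 (Q k.+1 (x + e) + c)
    + \sum_(x : word) g3 (Q k.+1 (x + e + e) + c) by rewrite -E1 -E2; ring.
rewrite /B -!big_split; apply: eq_bigr => x _ /=.
rewrite !Q_S !Qe !ek -!addrA; move: (Q k x) => s.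
by case: (F3_case (x k)) => ->; case: (F3_case c) => ->; case: (F3_case s) => ->.
Qed.

Let B_sum k c : B k c + B k (c + 1) + B k (c + 1 + 1) = 0.
Proof. by rewrite -!big_split big1 // => x _ /=; rewrite !addrA g3_sum. Qed.

(** Two further letters multiply [B] by -1/3, so ten of them by -1/243; the values -1, -1, 2 of [g3]
    at 0, 1, -1 then give the ratios. *)
Lemma gsumE : [/\ 0 < gsum 0, gsum 1 = gsum 0 & gsum (-1) = - 2 * gsum 0].
Proof.
have F3E : (-1 : 'F_3) = 1 + 1 by exact/val_inj.
have F31 : (1 + 1 + 1 : 'F_3) = 0 by exact/val_inj.
have step (k : nat) c : (k < 9)%N -> 3 * B k.+2 c = - B k c.
  move=> k9; have k8 := ltnW k9.
  have := B_S (Ordinal (k9 : (k.+1 < 10)%N)) c; have := B_S (Ordinal (leqW k9)) c.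
  have := B_S (Ordinal (leqW k9)) (c + 1); have := B_sum k c => /=; lia.
have B10 c : gsum c = B 10%N c.
  by apply: eq_bigr => x _; congr (g3 (_ + _)); apply: eq_bigl => i; rewrite ltn_ord.
have B0 c : B 0 c = #|{: word}|%:R * g3 c.
  rewrite /B (eq_bigr (fun _ => g3 c)) ?sumr_const ?mulr_natl // => x _.
  by rewrite /Q big_pred0 ?add0r // => i.
have M0 : 0 < #|{: word}|%:R :> int by rewrite ltr0n; apply/card_gt0P; exists 0.
have key c : 243 * gsum c = - (#|{: word}|%:R * g3 c).
  have h0 : 3 * B 2%N c = - B 0%N c := step 0%N c isT.
  have h2 : 3 * B 4%N c = - B 2%N c := step 2%N c isT.
  have h4 : 3 * B 6%N c = - B 4%N c := step 4%N c isT.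
  have h6 : 3 * B 8%N c = - B 6%N c := step 6%N c isT.
  have h8 : 3 * B 10%N c = - B 8%N c := step 8%N c isT.
  rewrite B10 -B0; lia.
have := key 0; have := key 1; have := key (-1); rewrite /g3 /=.
move: M0; move: (_%:R : int) => M; move: (gsum _) (gsum _) (gsum _) => x y z.
by move=> *; split; lia.
Qed.

Lemma gsum_pos : 0 < \sum_(x : word) g3 (wdot x x).
Proof.
have [e _ _] := gsumE; suff -> : \sum_(x : word) g3 (wdot x x) = gsum 0 by [].
by apply: eq_bigr => x _; rewrite addr0.
Qed.

(** A word with product a with [q] is - a q plus a word orthogonal to [q], whence gsum c = G c + 2 G
    (c - 1). Solving the three equations with the ratios of [gsumE] gives G 0 = gsum 0. *)
Lemma gsum_orth_pos (q : word) : wdot q q = -1 -> 0 < \sum_(x | wdot x q == 0) g3 (wdot x x).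
Proof.
move=> qq; pose G c := \sum_(x | wdot x q == 0) g3 (wdot x x + c).
have slice (c a : 'F_3) : \sum_(x | wdot x q == a) g3 (wdot x x + c) = G (c - a * a).
  rewrite (reindex_inj (addIr ([ffun i => - a * q i] : word))) /=.
  have sc (x : word) : wdot x [ffun i => - a * q i] = - a * wdot x q.
    by rewrite mulr_sumr; apply: eq_bigr => i _; rewrite ffunE mulrCA.
  pose y : word := [ffun i => - a * q i].
  have yq : wdot y q = a by rewrite wdotC sc qq mulrNN mulr1.
  have yy : wdot y y = - (a * a) by rewrite sc yq mulNr.
  rewrite /G -/y; apply: eq_big => [x|x]; rewrite wdotDl yq -subr_eq0 addrK // => /eqP xq.
  have xy : wdot x y = 0 by rewrite sc xq mulr0.
  by rewrite !(wdotDl, wdotDr) yy (wdotC y) xy; congr g3; ring.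
have dec c : gsum c = G c + G (c - 1) + G (c - 1).
  rewrite /gsum.
  have -> : \sum_x g3 (wdot x x + c) = \sum_(a : 'F_3) \sum_(x | wdot x q == a) g3 (wdot x x + c).
    by rewrite (partition_big (fun x => wdot x q) predT).
  under eq_bigr do rewrite slice.
  rewrite !big_ord_recl big_ord0 addr0 addrA; congr (G _ + G _ + G _).
  - by rewrite -[RHS]subr0; congr (_ - _); exact/val_inj.
  - by congr (_ - _); exact/val_inj.
  - by congr (_ - _); exact/val_inj.
have [e0 e1 e2] := gsumE.
have -> : \sum_(x | wdot x q == 0) g3 (wdot x x) = G 0 by apply: eq_bigr => x _; rewrite addr0.
have := dec 0; have := dec 1; have := dec (-1); rewrite e1 e2 subrr.
have -> : (-1 : 'F_3) - 1 = 1 by exact/val_inj.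
have -> : (0 : 'F_3) - 1 = -1 by exact/val_inj.
move: e0; move: (G (-1)) (G 1) (G 0) (gsum 0) => a b c d; lia.
Qed.

(** Nonzero squares in F_3 are 1, so the norm of p - q counts disagreements, and 10 = 1 modulo 3. *)
Lemma agreements p q : (\sum_i (p i == q i))%:R = 1 - wdot (p - q) (p - q).
Proof.
have one : \sum_(i < 10) (1 : 'F_3) = 1 by rewrite sumr_const card_ord; exact/val_inj.
rewrite natr_sum -[X in X - _]one -sumrB; apply: eq_bigr => i _; rewrite !ffunE -subr_eq0.
by case: (F3_case (p i - q i)) => ->; exact/val_inj.
Qed.

Definition agr p q := (\sum_i (p i == q i))%N.

Lemma agr_le p q : (agr p q <= 10)%N.
Proof.
apply: (@leq_trans (\sum_(i < 10) 1)); last by rewrite sum_nat_const card_ord.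
by apply: leq_sum => i _; apply: leq_b1.
Qed.

Lemma agr_wdot p q : wdot (p - q) (p - q) = 1 - (agr p q %% 3)%:R.
Proof.
have -> : wdot (p - q) (p - q) = 1 - (agr p q)%:R by rewrite agreements; ring.
by congr (1 - _); apply/val_inj; rewrite /= !val_Fp_nat // modn_mod.
Qed.

Lemma agr_mod p q (r : nat) : (r < 3)%N -> wdot (p - q) (p - q) = 1 - r%:R -> (agr p q %% 3 = r)%N.
Proof.
move=> r3; rewrite agr_wdot => /(addrI _)/oppr_inj /(congr1 val).
by rewrite /= !val_Fp_nat // modn_mod (modn_small r3).
Qed.

Lemma wdot_sqrB u v : wdot (u - v) (u - v) = wdot u u - wdot u v - wdot u v + wdot v v.
Proof. by rewrite wdotBl !wdotBr (wdotC v u); ring. Qed.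

(** Polarization in characteristic three, where -2 = 1. *)
Lemma wdot_polar p0 p q : wdot (p - p0) (q - p0) =
  wdot (p - q) (p - q) - wdot (p0 - p) (p0 - p) - wdot (p0 - q) (p0 - q).
Proof.
rewrite !(wdotBl, wdotBr) (wdotC q p) (wdotC p0 p) (wdotC p0 q).
set a := wdot p q; set b := wdot p p0; set c := wdot q p0; set d := wdot p0 p0; set u := wdot p p; set v := wdot q q.
by rewrite -[LHS]mulr1 -[X in _ * X](_ : (-2)%:~R = 1); [ring|exact/val_inj].
Qed.

(** The translates p - p0 are isotropic and mutually orthogonal. A word of norm -1 orthogonal to all
    of them keeps distance norm -1 from each, that is, two agreements modulo 3; translating by p0
    gives [h]. *)
Lemma words_same (ws : seq word) :
  (forall p q, p \in ws -> q \in ws -> agr p q %% 3 = 1)%N ->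
  exists h, forall p, p \in ws -> (agr h p %% 3 = 2)%N.
Proof.
case: ws => [|p0 ws] hw; first by exists 0.
have iso p q : p \in p0 :: ws -> q \in p0 :: ws -> wdot (p - p0) (q - p0) = 0.
  move=> pw qw; have n0 u v : u \in p0 :: ws -> v \in p0 :: ws -> wdot (u - v) (u - v) = 0.
    by move=> uw vw; rewrite agr_wdot hw ?subrr.
  by rewrite wdot_polar !n0 ?mem_head // !subr0.
have [//||h [_ hh hp]] := isotropic_exists (P := predT) (ws := [seq p - p0 | p <- p0 :: ws]) _ _ gsum_pos.
  by move=> _ _ /mapP[p pw ->] /mapP[q qw ->]; apply: iso.
exists (h + p0) => p pw; apply: agr_mod => //.
have -> : h + p0 - p = h - (p - p0) by rewrite opprB addrA.
have hpp : wdot h (p - p0) = 0 by apply: hp; apply/mapP; exists p.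
have pp := iso p p pw pw; move: hpp pp; move: (p - p0) => u hu uu.
by rewrite wdotBl !wdotBr hh uu (wdotC u) hu; exact/val_inj.
Qed.

(** After translation by [p0], [W2] is isotropic, while words of [W0] and [W1] have norm -1, product
    -1 inside a class and 1 across. Subtracting [qt] on [W0] and adding it on [W1] makes all of them
    isotropic and mutually orthogonal, and orthogonal to [qt]; [h] is then sought in the orthogonal
    of [qt], where [gsum_orth_pos] applies. *)
Lemma words_three (W0 W1 W2 : seq word) p0 q0 : p0 \in W2 -> q0 \in W0 ->
  (forall p q, [|| (p \in W0) && (q \in W0), (p \in W1) && (q \in W1) | (p \in W2) && (q \in W2)] ->
     agr p q %% 3 = 1)%N ->
  (forall p q, [|| (p \in W0) && (q \in W1), (p \in W2) && (q \in W0) | (p \in W2) && (q \in W1)] ->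
     agr p q %% 3 = 2)%N ->
  exists h, (forall p, p \in W2 -> agr h p %% 3 = 2)%N /\
    (forall p, (p \in W0) || (p \in W1) -> agr h p %% 3 = 0)%N.
Proof.
move=> p0W q0W same diff.
have n0 p q : [|| (p \in W0) && (q \in W0), (p \in W1) && (q \in W1) | (p \in W2) && (q \in W2)] ->
    wdot (p - q) (p - q) = 0 by move=> /same; rewrite agr_wdot => ->; rewrite subrr.
have n1 p q : [|| (p \in W0) && (q \in W1), (p \in W2) && (q \in W0) | (p \in W2) && (q \in W1)] ->
    wdot (p - q) (p - q) = -1 by move=> /diff; rewrite agr_wdot => ->; exact/val_inj.
have nP p : p \in W2 -> wdot (p0 - p) (p0 - p) = 0 by move=> pW; rewrite n0 // p0W pW !orbT.
have nQ q : (q \in W0) || (q \in W1) -> wdot (p0 - q) (p0 - q) = -1.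
  by case/orP => qW; rewrite n1 // p0W qW !orbT.
pose t p := p - p0; pose qt := t q0.
have q0W' : (q0 \in W0) || (q0 \in W1) by rewrite q0W.
have QQ : wdot qt qt = -1.
  by rewrite /qt wdot_polar !nQ // (n0 q0 q0) ?q0W //; exact/val_inj.
have pp p q : p \in W2 -> q \in W2 -> wdot (t p) (t q) = 0.
  by move=> pW qW; rewrite wdot_polar !nP // n0 ?subr0 // pW qW !orbT.
have pq p q : p \in W2 -> (q \in W0) || (q \in W1) -> wdot (t p) (t q) = 0.
  move=> pW qW; rewrite wdot_polar nP // nQ // n1 ?subr0 ?subrr //.
  by case/orP: qW => ->; rewrite pW ?orbT.
have q00 q q' : q \in W0 -> q' \in W0 -> wdot (t q) (t q') = -1.
  by move=> qW qW'; rewrite wdot_polar !nQ ?qW ?qW' // n0 ?qW ?qW' //; exact/val_inj.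
have q11 q q' : q \in W1 -> q' \in W1 -> wdot (t q) (t q') = -1.
  by move=> qW qW'; rewrite wdot_polar !nQ ?qW ?qW' ?orbT // n0 ?qW ?qW' ?orbT //; exact/val_inj.
have q01 q q' : q \in W0 -> q' \in W1 -> wdot (t q) (t q') = 1.
  by move=> qW qW'; rewrite wdot_polar !nQ ?qW ?qW' ?orbT // n1 ?qW ?qW' ?orbT //; exact/val_inj.
pose L2 := [seq t p | p <- W2]; pose L0 := [seq t q - qt | q <- W0]; pose L1 := [seq t q + qt | q <- W1].
have LQ w : w \in L2 ++ L0 ++ L1 -> wdot w qt = 0.
  rewrite !mem_cat => /or3P[] /mapP[p pW ->].
  - exact: pq.
  - by rewrite wdotBl QQ q00 // subrr.
  - by rewrite wdotDl QQ wdotC q01 ?subrr.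
have [||| h [/eqP hQ hh hw]] := isotropic_exists (P := fun x => wdot x qt == 0) (ws := L2 ++ L0 ++ L1) _ _ _.
- by move=> w wL x /=; rewrite wdotDl (LQ w wL) addr0.
- have off w q : w \in L2 ++ L0 ++ L1 -> (q \in W0) || (q \in W1) -> wdot w (t q) = 0.
    rewrite !mem_cat => + qW => /or3P[] /mapP[p pW ->].
    + exact: pq.
    + rewrite wdotBl; case/orP: qW => qW; [rewrite (q00 p q) // (q00 q0 q) // |rewrite (q01 p q) // (q01 q0 q) //]; exact/val_inj.
    + rewrite wdotDl; case/orP: qW => qW; last by rewrite (q11 p q) // (q01 q0 q) //; exact/val_inj.
      by rewrite (wdotC (t p)) (q01 q p) // (q00 q0 q) //; exact/val_inj.
  move=> w w' wL; rewrite 2!mem_cat => /or3P[] /mapP[p pW ->].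
  + move: wL; rewrite !mem_cat wdotC => /or3P[] /mapP[u uW ->]; first exact: pp.
      by rewrite wdotBr !pq ?subr0 ?uW // q0W.
    by rewrite wdotDr !pq ?addr0 ?uW ?orbT // q0W.
  + by rewrite wdotBr off ?pW // LQ // subr0.
  + by rewrite wdotDr off ?pW ?orbT // LQ // addr0.
- exact: gsum_orth_pos.
have hq q : (q \in W0) || (q \in W1) -> wdot h (t q) = 0.
  case/orP => qW.
    rewrite -[t q](subrK qt) wdotDr hQ addr0; apply: hw; rewrite !mem_cat.
    by apply/or3P; constructor 2; apply/mapP; exists q.
  rewrite -[t q](addrK qt) wdotBr hQ subr0; apply: hw; rewrite !mem_cat.
  by apply/or3P; constructor 3; apply/mapP; exists q.
exists (h + p0); split=> p pW; apply: agr_mod => //; rewrite -addrA -[p0 - p]opprB -/(t p).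
  have hu : wdot h (t p) = 0 by rewrite hw ?mem_cat ?map_f.
  by rewrite wdot_sqrB hh hu (pp p p) //; exact/val_inj.
rewrite wdot_sqrB hh hq //.
by case/orP: pW => pW; [rewrite (q00 p p)|rewrite (q11 p p)] => //; exact/val_inj.
Qed.

End F3.

(** * Systems of disjoint triangles and their transversals *)

Section Triangles.
Variables (V : eqType) (r : rel V).
Hypothesis rC : symmetric r.

(** No edge leaves a triangle, so removing one preserves the hypothesis. Labelling the corners by
    F_3 turns a choice of one corner per triangle into a ternary word. *)
Lemma triangle_partition m (T : seq V) : uniq T -> size T = (3 * m)%N ->
  (forall a, a \in T -> exists a' a'', [/\ a' \in T, a'' \in T, uniq [:: a; a'; a''],
     [&& r a a', r a a'' & r a' a''] &
     forall b, b \in T -> b \notin [:: a; a'; a''] -> ~~ [|| r a b, r a' b | r a'' b]]) ->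
  exists x : 'I_m -> 'F_3 -> V, [/\ forall i j, x i j \in T,
    forall b, b \in T -> exists i j, b = x i j,
    forall i j j', j != j' -> r (x i j) (x i j') &
    forall i i' j j', i != i' -> x i j != x i' j' /\ ~~ r (x i j) (x i' j')].
Proof.
elim: m T => [|m IH] T uT sT hT.
  case: T uT sT {hT} => // _ _; have f0 : 'I_0 -> 'F_3 -> V by case.
  exists f0.
  by split=> [[]|b|[]|[]].
have [a aT] : exists a, a \in T by case: (T) sT => // a T' _; exists a; rewrite mem_head.
have [a' [a'' [aT' aT'' ua /and3P[r1 r2 r3] hb]]] := hT a aT.
pose T' := [seq b <- T | b \notin [:: a; a'; a'']].
have T'E b : (b \in T') = (b \notin [:: a; a'; a'']) && (b \in T) by rewrite mem_filter.
have uT' : uniq T' by rewrite filter_uniq.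
have sT' : size T' = (3 * m)%N.
  have pT : perm_eq T ([:: a; a'; a''] ++ T').
    apply: uniq_perm => //.
      rewrite cat_uniq ua uT' andbT /=; apply/hasPn => b; by rewrite T'E => /andP[].
    move=> b; rewrite mem_cat T'E; have [bA|//] := boolP (b \in [:: a; a'; a'']).
    by move: bA; rewrite !inE => /or3P[] /eqP ->.
  by have := perm_size pT; rewrite sT size_cat /= mulnS => /addnI.
have [c cT'|x [xT xS xr xn]] := IH T' uT' sT'.
  have cT : c \in T by move: cT'; rewrite T'E => /andP[].
  have cN : c \notin [:: a; a'; a''] by move: cT'; rewrite T'E => /andP[].
  have [c' [c'' [cT1 cT2 uc rc hc]]] := hT c cT.
  have := hb c cT cN; rewrite !negb_or => /and3P[n1 n2 n3].
  have [rc1 rc2 _] := and3P rc.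
  have out d : d \in T -> r c d -> d \in T'.
    move=> dT rd; rewrite T'E dT andbT; apply/negP; rewrite !inE => /or3P[] /eqP e.
    - by move: n1; rewrite rC -e rd.
    - by move: n2; rewrite rC -e rd.
    - by move: n3; rewrite rC -e rd.
  exists c', c''; split=> //; [exact: out|exact: out|].
  by move=> b; rewrite T'E => /andP[_ bT]; apply: hc.
pose y (j : 'F_3) := nth a [:: a; a'; a''] j.
have yT j : y j \in T by case: (F3_case j) => ->.
have yA j : y j \in [:: a; a'; a''] by case: (F3_case j) => ->; rewrite !inE eqxx ?orbT.
have yr j j' : j != j' -> r (y j) (y j').
  by case: (F3_case j) => ->; case: (F3_case j') => -> //= _; rewrite /y //= rC.
have xT' i j : x i j \in T by have := xT i j; rewrite T'E => /andP[].
have cross i j j' : y j != x i j' /\ ~~ r (y j) (x i j').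
  have := xT i j'; rewrite T'E => /andP[n _]; split.
    by apply: contraNneq n => <-.
  have := hb _ (xT' i j') n; rewrite !negb_or => /and3P[n1 n2 n3].
  by case: (F3_case j) => ->.
exists (fun i j => if unlift ord0 i is Some i' then x i' j else y j); split.
- by move=> i j; case: unliftP.
- move=> b bT; have [bA|bA] := boolP (b \in [:: a; a'; a'']).
    exists ord0; rewrite unlift_none; move: bA; rewrite !inE => /or3P[] /eqP ->; [exists 0|exists 1|exists (-1)] => //.
  have [|i [j ->]] := xS b; first by rewrite T'E bA.
  by exists (lift ord0 i), j; rewrite liftK.
- by move=> i j j' jj; case: unliftP => [i' _|_]; [apply: xr|apply: yr].
- move=> i i' j j'; case: unliftP => [k ->|->]; case: unliftP => [k' ->|->]; rewrite ?eqxx //.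
  + by rewrite (inj_eq lift_inj); apply: xn.
  + by move=> _; rewrite eq_sym rC; apply: cross.
Qed.

End Triangles.

Section Frame.
Context {R : realType} (n : nat).
Variables (lam : R) (X : 'I_10 -> 'F_3 -> 'rV[R]_n).
Hypothesis XX : forall i i' j j', dotp (X i j) (X i' j') =
  if i == i' then (if j == j' then 2 * lam else - lam) else 0.
Implicit Types p q : word.

Definition transversal p := \sum_i X i (p i).

Lemma frame_transversal i j p : dotp (X i j) (transversal p) = if j == p i then 2 * lam else - lam.
Proof.
rewrite dotp_sumr (bigD1 i) //= XX eqxx big1 ?addr0 // => k ki.
by rewrite XX eq_sym (negbTE ki).
Qed.

Lemma transversal_dot p q : dotp (transversal p) (transversal q) = lam * (3 * (agr p q)%:R - 10).
Proof.
have -> : dotp (transversal p) (transversal q) = \sum_i lam * (3 * (p i == q i)%:R - 1).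
  rewrite dotp_suml; apply: eq_bigr => i _; rewrite frame_transversal.
  by case: (p i == q i); rewrite /= ?mulr1n ?mulr0n; ring.
by rewrite -mulr_sumr sumrB -mulr_sumr -natr_sum sumr_const card_ord.
Qed.

Lemma agr_self p : agr p p = 10%N.
Proof. by rewrite /agr (eq_bigr (fun=> 1%N)) ?sum_nat_const ?card_ord // => i _; rewrite eqxx. Qed.

Lemma dotp_transversal z c p : (forall i, dotp z (X i (p i)) = c) -> dotp z (transversal p) = 10 * c.
Proof.
move=> h; rewrite dotp_sumr (eq_bigr (fun=> c)) // sumr_const card_ord; ring.
Qed.

End Frame.

Lemma dotp_sub0 (R : realType) n (u v : 'rV[R]_n) : dotp u u = dotp u v -> dotp v v = dotp u v -> u = v.
Proof.
move=> e1 e2; apply/eqP; rewrite -subr_eq0 -dotp_eq0.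
by rewrite !(dotpBl, dotpBr) (dotpC v u) e1 e2 !subrr.
Qed.

Lemma sum_indicator (R : realType) (T : Type) (D : seq T) (P : pred T) :
  \sum_(y <- D) (P y)%:R = (size [seq y <- D | P y])%:R :> R.
Proof. by rewrite size_filter -sum1_count natr_sum [RHS]big_mkcond; apply: eq_bigr => y _; case: (P y). Qed.

Lemma sum_mem (R : realType) (T : eqType) (D : seq T) z : uniq D -> z \in D ->
  \sum_(y <- D) (y == z)%:R = 1 :> R.
Proof. by move=> uD zD; rewrite (bigD1_seq z) //= eqxx big1 ?addr0 // => y /negbTE ->. Qed.

Lemma line_values (R : realType) (a b c : R) : a = 1 / 4 \/ a = - (3 / 4) -> b = 1 / 4 \/ b = - (3 / 4) ->
  c = 1 / 4 \/ c = - (3 / 4) -> a + b + c = 3 / 4 ->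
  [&& a != - (3 / 4), b != - (3 / 4) & c != - (3 / 4)].
Proof. by move=> [->|->] [->|->] [->|->] e; apply/and3P; split; apply/eqP; lra. Qed.

Lemma cubic_values (R : realType) (a b c : R) : a = 1 / 4 \/ a = - (3 / 4) -> b = 1 / 4 \/ b = - (3 / 4) ->
  c = 1 / 4 \/ c = - (3 / 4) -> a + b + c != - (9 / 4) ->
  (a + b + c - 3 / 4) * (a + b + c + 1 / 4) * (a + b + c + 5 / 4) = 0.
Proof.
move=> ha hb hc; have : a + b + c \in [:: 3 / 4; - (1 / 4); - (5 / 4); - (9 / 4)].
  by rewrite !inE; apply/or4P; move: ha hb hc => [->|->] [->|->] [->|->];
    [constructor 1|constructor 2|constructor 2|constructor 3|constructor 2|constructor 3|constructor 3|constructor 4];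
    apply/eqP; field.
by rewrite !inE => /or4P[] /eqP ->; rewrite ?eqxx // => _; by field.
Qed.

(** * The code of 112 points *)

Section Code112.
Context {R : realType} (D : seq 'rV[R]_21).
Hypotheses (hD : tight_code 3 (9 / 4) D) (sD : size D = 112%N).

Let norm y : y \in D -> dotp y y = 9 / 4 := tight_norm hD (y := y).

Lemma ips112 y z : y \in D -> z \in D -> y != z -> dotp y z = 1 / 4 \/ dotp y z = - (3 / 4).
Proof.
move=> yD zD yz; have [//||a [b [hab]]] := code_quadratic_eqs hD; rewrite ?sD // => e1 e2.
have e := hab y z yD zD yz.
have aE : a = - (1 / 2) by lra.
have bE : b = - (3 / 16) by lra.
have /eqP : (dotp y z - 1 / 4) * (dotp y z + 3 / 4) = 0 by rewrite -[RHS]e aE bE; field.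
by rewrite mulf_eq0 => /orP[] /eqP; [left|right]; lra.
Qed.

Lemma vals112 y z : y \in D -> z \in D -> [\/ dotp y z = 9 / 4, dotp y z = 1 / 4 | dotp y z = - (3 / 4)].
Proof.
move=> yD zD; have [->|yz] := eqVneq y z; first by constructor 1; apply: norm.
by have [] := ips112 yD zD yz; [constructor 2|constructor 3].
Qed.

Lemma eq112 y z : y \in D -> z \in D -> dotp y z = 9 / 4 -> y = z.
Proof. by move=> yD zD e; apply: dotp_sub0; rewrite e norm. Qed.

Variable o : 'rV[R]_21.
Hypothesis oD : o \in D.

Let r (a b : 'rV[R]_21) := dotp a b == - (3 / 4).
(** The neighbours of [o]. They split into ten triangles, each completing [o] to a line of four
    points with sum 0. *)
Let T := [seq y <- D | r o y].

Let TP y : (y \in T) = (dotp o y == - (3 / 4)) && (y \in D).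
Proof. by rewrite mem_filter. Qed.

Let sT : size T = 30%N.
Proof.
have : \sum_(y <- D) (dotp o y - 1 / 4) = - 28.
  rewrite (eq_bigr (fun y => - (1 / 4) + 1 * dotp o y + 0 * dotp o y ^+ 2 + 0 * dotp o y ^+ 3)); last by move=> *; ring.
  by rewrite (sum_deg3 hD) // sD; field.
rewrite (eq_big_seq (fun y => 2 * (y == o)%:R - (r o y)%:R)).
  rewrite sumrB -mulr_sumr (sum_mem _ (tight_uniq hD) oD) sum_indicator -/T => e.
  by apply/eqP; rewrite -(eqr_nat R); apply/eqP; lra.
move=> y yD; have [->|yo] := eqVneq y o.
  by rewrite /r norm // (_ : _ == _ = false) ?mulr1n ?mulr0n; [field|apply/eqP; lra].
rewrite /r; have [|->|->] := vals112 oD yD; first by move/(eq112 oD yD) => e; rewrite e eqxx in yo.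
  by rewrite (_ : _ == _ = false) ?mulr1n ?mulr0n; [field|apply/eqP; lra].
by rewrite eqxx /= ?mulr1n ?mulr0n; field.
Qed.

(** If [a] had no neighbour in [T], the square of (o + a).y would be 1/4 for every y other than [o]
    and [a], against the second moment. *)
Lemma third112 a : a \in T -> exists2 b, b \in T & r a b.
Proof.
rewrite TP => /andP[/eqP ao aD].
apply: contrapT => h.
have uu : dotp (o + a) (o + a) = 3.
  by rewrite !(dotpDl, dotpDr) !norm // (dotpC a o) ao; field.
have oa : o != a by apply: contra_eq_neq ao => <-; rewrite norm //; apply/eqP; lra.
have := sum_deg3 hD (o + a) (- (1 / 4)) 0 1 0 isT; rewrite sD uu.
pose f y : R := 2 * (y == o)%:R + 2 * (y == a)%:R.
rewrite (eq_big_seq f).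
  rewrite /f big_split /= -!mulr_sumr.
  by rewrite !sum_mem ?(tight_uniq hD) //; lra.
move=> y yD; rewrite /f dotpDl; have [yo|yo] := eqVneq y o.
  by rewrite yo (negbTE oa) norm // (dotpC a) ao /= ?mulr1n ?mulr0n; field.
have [ya|ya] := eqVneq y a; first by rewrite ya norm // ao /= ?mulr1n ?mulr0n; field.
have [|e1|e1] := vals112 oD yD; first by move/(eq112 oD yD) => e; rewrite e eqxx in yo.
  have [|e2|e2] := vals112 aD yD; first by move/(eq112 aD yD) => e; rewrite e eqxx in ya.
    by rewrite e1 e2 /= ?mulr1n ?mulr0n; field.
  by rewrite e1 e2 /= ?mulr1n ?mulr0n; field.
have [|e2|e2] := vals112 aD yD; first by move/(eq112 aD yD) => e; rewrite e eqxx in ya.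
  by rewrite e1 e2 /= ?mulr1n ?mulr0n; field.
by case: h; exists y; [rewrite TP e1 eqxx yD|rewrite /r e2].
Qed.

(* The fourth point of the line through three pairwise adjacent points is minus their sum. *)
Lemma fourth112 a b : a \in T -> b \in T -> r a b -> - (o + a + b) \in T.
Proof.
rewrite !TP => /andP[/eqP ao aD] /andP[/eqP bo bD] /eqP ab.
set w := o + a + b.
have ww : dotp w w = 9 / 4.
  by rewrite !(dotpDl, dotpDr) !norm // (dotpC a o) (dotpC b o) (dotpC b a) ao bo ab; field.
have ow : dotp o w = 3 / 4 by rewrite !dotpDr norm // ao bo; field.
have [y yD wy] : exists2 y, y \in D & dotp w y = - (9 / 4).
  apply: contrapT => h.
  (* If -9/4 were not attained, every product with [w] would be a zero of (t - 3/4)(t + 1/4)(t +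
     5/4), expanded here, whose sum over the code is -6. *)
  have := sum_deg3 hD w (- (15 / 64)) (- (13 / 16)) (3 / 4) 1 isT; rewrite sD ww.
  rewrite (eq_big_seq (fun=> 0)); first by rewrite big1 // => e; lra.
  move=> y yD; have -> : - (15 / 64) + - (13 / 16) * dotp w y + 3 / 4 * dotp w y ^+ 2 + 1 * dotp w y ^+ 3 =
    (dotp w y - 3 / 4) * (dotp w y + 1 / 4) * (dotp w y + 5 / 4) by field.
  have special z : z \in D -> dotp w z = 3 / 4 -> (dotp w z - 3 / 4) * (dotp w z + 1 / 4) * (dotp w z + 5 / 4) = 0.
    by move=> _ ->; rewrite subrr !mul0r.
  have [yo|yo] := eqVneq y o; first by apply: special => //; rewrite yo dotpC.
  have [ya|ya] := eqVneq y a.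
    by apply: special => //; rewrite ya /w !dotpDl norm // ao (dotpC b) ab; field.
  have [yb|yb] := eqVneq y b.
    by apply: special => //; rewrite yb /w !dotpDl norm // bo ab; field.
  have v z : z \in D -> y != z -> dotp z y = 1 / 4 \/ dotp z y = - (3 / 4).
    by move=> zD yz; apply: ips112 => //; rewrite eq_sym.
  have : dotp w y != - (9 / 4) by apply/eqP => e; apply: h; exists y.
  rewrite /w !dotpDl.
  exact: (cubic_values (v o oD yo) (v a aD ya) (v b bD yb)).
have wE : - w = y by apply: dotp_sub0; rewrite !(dotpNl, dotpNr) ?opprK ?ww ?wy ?norm ?opprK.
by rewrite dotpNr ow eqxx wE.
Qed.

(** A further b in [T] has products 1/4 or -3/4 with the corners of a triangle, summing to - o.b =
    3/4; so all three are 1/4 and distinct triangles are not adjacent. Adding o/3 projects [T]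
    orthogonally to [o]. *)
Lemma frame112 : exists x : 'I_10 -> 'F_3 -> 'rV[R]_21, [/\ forall i j, x i j \in T,
    forall b, b \in T -> exists i j, b = x i j,
    forall i, x i 0 + x i 1 + x i (-1) = - o &
    forall i i' j j', dotp (x i j + 3^-1 *: o) (x i' j' + 3^-1 *: o) =
      if i == i' then (if j == j' then 2 * 1 else - 1) else 0].
Proof.
have rC : symmetric r by move=> a b; rewrite /r dotpC.
have TD y : y \in T -> y \in D /\ dotp o y = - (3 / 4) by rewrite TP => /andP[/eqP].
have rne a b : a \in D -> r a b -> a != b.
  by move=> aD /eqP e; apply: contra_eq_neq e => <-; rewrite norm //; apply/eqP; lra.
have [|||x [xT xS xr xn]] := @triangle_partition _ r rC 10 T.
- by rewrite filter_uniq ?(tight_uniq hD).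
- exact: sT.
- move=> a aT; have [a' aT' ra] := third112 aT; have aT'' := fourth112 aT aT' ra.
  have [aD ao] := TD _ aT; have [aD' ao'] := TD _ aT'; have [aD'' ao''] := TD _ aT''.
  have r1 : r a (- (o + a + a')) by rewrite /r dotpNr !dotpDr norm // (dotpC a o) ao (eqP ra); apply/eqP; field.
  have r2 : r a' (- (o + a + a')).
    by rewrite /r dotpNr !dotpDr norm // (dotpC a' o) ao' (dotpC a') (eqP ra); apply/eqP; field.
  exists a', (- (o + a + a')); split=> //.
  + by rewrite /= !inE !negb_or !rne.
  + by rewrite ra r1 r2.
  move=> b bT; rewrite !inE !negb_or => /and3P[n1 n2 n3]; have [bD bo] := TD _ bT.
  have v z : z \in D -> b != z -> dotp z b = 1 / 4 \/ dotp z b = - (3 / 4).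
    by move=> zD bz; apply: ips112 => //; rewrite eq_sym.
  apply: (line_values (v _ aD n1) (v _ aD' n2) (v _ aD'' n3)).
  by rewrite dotpNl !dotpDl bo; lra.
exists x; split=> //.
- move=> i; have [a aE] : exists a, a = x i 0 + x i 1 + x i (-1) by eexists.
  rewrite -aE; have [xD0 xo0] := TD _ (xT i 0); have [xD1 xo1] := TD _ (xT i 1); have [xD2 xo2] := TD _ (xT i (-1)).
  have /eqP r01 := xr i 0 1 isT; have /eqP r02 := xr i 0 (-1) isT; have /eqP r12 := xr i 1 (-1) isT.
  have aa : dotp a a = 9 / 4.
    rewrite aE !(dotpDl, dotpDr) !norm // r01 r02 r12 (dotpC (x i 1)) r01 (dotpC (x i (-1)) (x i 0)) r02.
    by rewrite (dotpC (x i (-1))) r12; field.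
  have ao : dotp a o = - (9 / 4) by rewrite dotpC aE !dotpDr xo0 xo1 xo2; field.
  by apply: dotp_sub0; rewrite ?(dotpNl, dotpNr) ?opprK ?aa ?ao ?norm ?opprK.
move=> i i' j j'.
have [xD xo] := TD _ (xT i j); have [xD' xo'] := TD _ (xT i' j').
rewrite !(dotpDl, dotpDr) !(dotpZl, dotpZr) norm // (dotpC _ o) xo xo'.
have [<-|ii] := eqVneq i i'.
  have [<-|jj] := eqVneq j j'; first by rewrite norm //; field.
  by have /eqP -> := xr i j j' jj; field.
have [xx nr] := xn i i' j j' ii.
by have [->|e] := ips112 xD xD' xx; [field|rewrite /r e eqxx in nr].
Qed.

Lemma few_values112 : few_values 2 D.
Proof.
have [x [xT xS xs XX]] := frame112.
have TD y : y \in T -> y \in D /\ dotp o y = - (3 / 4) by rewrite TP => /andP[/eqP].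
pose X i j := x i j + 3^-1 *: o.
pose Y := transversal X.
have XXd := XX : forall i i' j j', dotp (X i j) (X i' j') = if i == i' then (if j == j' then 2 * 1 else - 1) else 0.
have YY p q : dotp (Y p) (Y q) = 3 * (agr p q)%:R - 10 by rewrite (transversal_dot XXd) mul1r.
have oX i j : dotp o (X i j) = 0.
  by rewrite dotpDr dotpZr norm // (TD _ (xT i j)).2; field.
have oY p : dotp o (Y p) = 0 by rewrite dotp_sumr big1 // => i _; apply: oX.
pose C := [seq z <- D | (z != o) && (z \notin T)].
have CP z : z \in C -> [/\ z \in D, dotp o z = 1 / 4 & z \notin T].
  rewrite mem_filter => /andP[/andP[zo zT] zD]; split=> //.
  have [|//|e] := vals112 oD zD; first by move/(eq112 oD zD) => e; rewrite e eqxx in zo.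
  by move: zT; rewrite TP e eqxx zD.
(* On each triangle the products with z sum to - o.z = -1/4, so exactly one corner is a neighbour of
   z; these corners form the word. *)
have wordP z : z \in C -> exists p : word, z = 9^-1 *: o - 3^-1 *: Y p.
  move=> zC; have [zD zo zT] := CP z zC.
  have v i j : dotp z (x i j) = 1 / 4 \/ dotp z (x i j) = - (3 / 4).
    apply: ips112 => //; first by have [] := TD _ (xT i j).
    by apply: contraNneq zT => ->.
  have ex i : exists j, dotp z (x i j) = - (3 / 4).
    have := congr1 (dotp z) (xs i); rewrite !dotpDr dotpNr (dotpC z o) zo.
    have [->|e] := v i 0; last by exists 0.
    have [->|e] := v i 1; last by exists 1.
    have [->|e] := v i (-1); last by exists (-1).
    by lra.
  have [p hp] := choice ex.
  pose q : word := [ffun i => p i]; exists q.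
  have zY : dotp z (Y q) = 10 * (- (2 / 3)).
    apply: dotp_transversal => i; rewrite ffunE dotpDr dotpZr hp (dotpC z o) zo; lra.
  have qq : dotp (Y q) (Y q) = 20 by rewrite YY agr_self; ring.
  have zz : dotp z (9^-1 *: o - 3^-1 *: Y q) = 9 / 4.
    by rewrite dotpBr !dotpZr zY (dotpC z o) zo; field.
  apply: dotp_sub0; rewrite zz; first by rewrite norm.
  by rewrite !(dotpBl, dotpBr) !(dotpZl, dotpZr) qq oY (dotpC _ o) oY norm //; lra.
have Zdot (a c : R) p q : dotp (a *: o + c *: Y p) (9^-1 *: o - 3^-1 *: Y q) = a / 4 - c / 3 * (3 * (agr p q)%:R - 10).
  by rewrite dotpBr !dotpDl !(dotpZl, dotpZr) YY oY (dotpC _ o) oY norm //; field.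
have [w hw] : exists w : 'rV[R]_21 -> word, forall z, z \in C -> z = 9^-1 *: o - 3^-1 *: Y (w z).
  have : forall z, exists p : word, z \in C -> z = 9^-1 *: o - 3^-1 *: Y p.
    by move=> z; have [/wordP[p hp]|zC] := boolP (z \in C); [exists p|exists 0].
  by move=> /choice[w hw]; exists w.
have agrE z z' : z \in C -> z' \in C -> (agr (w z) (w z') %% 3 = 1)%N.
  move=> zC zC'; have [[zD _ _] [zD' _ _]] := (CP z zC, CP z' zC').
  have := Zdot 9^-1 (- 3^-1) (w z) (w z'); rewrite scaleNr -!hw // => e.
  have h k : (agr (w z) (w z'))%:R = k%:R :> R -> (agr (w z) (w z') = k) by move/eqP; rewrite eqr_nat => /eqP.
  have [e'|e'|e'] := vals112 zD zD'; rewrite e' in e.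
  - by rewrite (h 10%N) //; lra.
  - by rewrite (h 4%N) //; lra.
  - by rewrite (h 1%N) //; lra.
have [|h hh] := @words_same [seq w z | z <- C].
  by move=> _ _ /mapP[z zC ->] /mapP[z' zC' ->]; apply: agrE.
(* The product is 1/2 at [o], 1/2 or -1/2 on [T], and 7/6 - agr/3 on [C]. When the agreement is 2
   modulo 3 the square is at least 1/4 everywhere, and |v|^2 = 7/3 makes the second moment exactly
   112/4. *)
pose v := (2 / 9) *: o + 3^-1 *: Y h.
have vv : dotp v v = 7 / 3.
  by rewrite /v !(dotpDl, dotpDr) !(dotpZl, dotpZr) YY agr_self oY (dotpC _ o) oY norm //; field.
have vge y : y \in D -> 0 <= dotp v y ^+ 2 - 1 / 4.
  move=> yD; have [->|yo] := eqVneq y o.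
    rewrite /v dotpDl !dotpZl norm // (dotpC _ o) oY; lra.
  have [yT|yT] := boolP (y \in T).
    have [i [j yE]] := xS y yT; have -> : y = X i j - 3^-1 *: o by rewrite yE /X addrK.
    rewrite /v dotpBr !dotpDl !dotpZl !dotpZr oX norm // [dotp (Y h) _]dotpC (frame_transversal XXd) [dotp (Y h) _]dotpC oY.
    by case: (j == h i); lra.
  have yC : y \in C by rewrite mem_filter yo yT.
  have e3 := hh _ (map_f w yC); rewrite (hw y yC) Zdot.
  have [m ->] : exists m, agr h (w y) = (3 * m + 2)%N by exists (agr h (w y) %/ 3)%N; lia.
  rewrite natrD natrM.
  have [->|m0] := eqVneq m 0%N; first by lra.
  have : 1 <= m%:R :> R by rewrite ler1n lt0n.
  by nra.
have v0 : v != 0 by rewrite -dotp_eq0 vv; apply/eqP; lra.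
exists v => //; exists [:: 1 / 2; - (1 / 2)] => // y yD.
have := @psumr_seq_eq0 _ _ D (fun y => dotp v y ^+ 2 - 1 / 4) vge _ y yD.
have S0 : \sum_(y <- D) (dotp v y ^+ 2 - 1 / 4) = 0.
  rewrite (eq_bigr (fun y => - (1 / 4) + 0 * dotp v y + 1 * dotp v y ^+ 2 + 0 * dotp v y ^+ 3)); last by move=> *; ring.
  by rewrite (sum_deg3 hD) // sD vv; field.
move=> /(_ S0) e; have /eqP : (dotp v y - 1 / 2) * (dotp v y + 1 / 2) = 0 by rewrite -[RHS]e; field.
by rewrite mulf_eq0 subr_eq0 addr_eq0 !inE.
Qed.

End Code112.

Section Integers.
Context {R : realType}.
Implicit Types t : R.

Lemma even_le4 t : (exists z : int, t = (2 * z)%:~R) -> t <= 4 -> -4 <= t ->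
  t \in [:: 0; 2; -2; 4; -4].
Proof.
move=> [z ->]; rewrite -[4]/(4%:~R) -[-4]/((-4)%:~R) !ler_int => h1 h2.
have : z \in [:: 0; 1; -1; 2; -2] by rewrite !inE; lia.
rewrite !inE => /orP[|/or4P[]] /eqP ->; rewrite ?mulr0 /=.
- by rewrite eqxx.
- by rewrite (_ : (2 * 1)%:~R = 2) ?eqxx ?orbT.
- by rewrite (_ : (2 * -1)%:~R = -2) ?eqxx ?orbT.
- by rewrite (_ : (2 * 2)%:~R = 4) ?eqxx ?orbT.
- by rewrite (_ : (2 * -2)%:~R = -4) ?eqxx ?orbT.
Qed.

Lemma odd_le5 t : oddr t -> t <= 5 -> -5 <= t -> t \in [:: 1; -1; 3; -3; 5; -5].
Proof.
move=> [z ->]; rewrite -[5]/(5%:~R) -[-5]/((-5)%:~R) !ler_int => h1 h2.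
have : z \in [:: 0; -1; 1; -2; 2; -3] by rewrite !inE; lia.
rewrite !inE => /orP[|/orP[|/or4P[]]] /eqP ->; rewrite ?mulr0 /=.
- by rewrite eqxx.
- by rewrite (_ : (2 * -1 + 1)%:~R = -1) ?eqxx ?orbT.
- by rewrite (_ : (2 * 1 + 1)%:~R = 3) ?eqxx ?orbT.
- by rewrite (_ : (2 * -2 + 1)%:~R = -3) ?eqxx ?orbT.
- by rewrite (_ : (2 * 2 + 1)%:~R = 5) ?eqxx ?orbT.
- by rewrite (_ : (2 * -3 + 1)%:~R = -5) ?eqxx ?orbT.
Qed.

Lemma int_quartic_ge0 t : t \is a Num.int -> 0 <= t ^+ 2 * (t ^+ 2 - 1).
Proof.
move=> /intrP[z ->]; rewrite -(rmorphXn intr) /= -[1]/(1%:~R) -intrB -intrM ler0z.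
have [->|z0] := eqVneq z 0; first by rewrite expr0n mul0r.
by apply: mulr_ge0; rewrite ?sqr_ge0 // expr2; nia.
Qed.

Lemma oddrD x y : oddr x -> oddr y -> exists z : int, x + y = (2 * z)%:~R :> R.
Proof. by move=> [a ->] [b ->]; exists (a + b + 1); rewrite -intrD; congr (_%:~R); ring. Qed.

Lemma evenrD x y : (exists z : int, x = (2 * z)%:~R :> R) -> (exists z : int, y = (2 * z)%:~R) ->
  exists z : int, x + y = (2 * z)%:~R :> R.
Proof. by move=> [a ->] [b ->]; exists (a + b); rewrite -intrD; congr (_%:~R); ring. Qed.

Lemma evenr_odd x y : (exists z : int, x = (2 * z)%:~R :> R) -> oddr y -> oddr (x + y).
Proof. by move=> [a ->] [b ->]; exists (a + b); rewrite -intrD; congr (_%:~R); ring. Qed.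

Definition sign3 (a b c : R) : Prop := (a = 1 \/ a = -1) /\ (b = 1 \/ b = -1) /\ (c = 1 \/ c = -1).

(** The indicators single out the triples of equal signs. The coefficients 1/3 and 1/5 are fitted to
    the triples of the six points e_j and - e_j, where 8 = 24/3 and 24 = 120/5. *)
Lemma count_identities (a b c : R) :
  [\/ sign3 a b c, [/\ a = 5, b = -1 & c = -1], [/\ a = -1, b = 5 & c = -1] | [/\ a = -1, b = -1 & c = 5]]
  \/ [\/ [/\ a = -5, b = 1 & c = 1], [/\ a = 1, b = -5 & c = 1] | [/\ a = 1, b = 1 & c = -5]] ->
  (a + b + c) ^+ 2 - 1 = 8 * [&& a == -1, b == -1 & c == -1]%:R + 8 * [&& a == 1, b == 1 & c == 1]%:R
     + 3^-1 * (a ^+ 2 - 1 + (b ^+ 2 - 1) + (c ^+ 2 - 1)) /\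
  (a + b + c) ^+ 3 - (a + b + c) = 24 * [&& a == 1, b == 1 & c == 1]%:R - 24 * [&& a == -1, b == -1 & c == -1]%:R
     + 5^-1 * (a ^+ 3 - a + (b ^+ 3 - b) + (c ^+ 3 - c)).
Proof.
have n1 : ((1 : R) == -1) = false by apply/eqP; lra.
have n2 : ((-1 : R) == 1) = false by apply/eqP; lra.
have n3 : ((5 : R) == 1) = false by apply/eqP; lra.
have n4 : ((5 : R) == -1) = false by apply/eqP; lra.
have n5 : ((-5 : R) == 1) = false by apply/eqP; lra.
have n6 : ((-5 : R) == -1) = false by apply/eqP; lra.
case=> [[[[->|->] [[->|->] [->|->]]]|[-> -> ->]|[-> -> ->]|[-> -> ->]]|[[-> -> ->]|[-> -> ->]|[-> -> ->]]];
  rewrite ?eqxx ?n1 ?n2 ?n3 ?n4 ?n5 ?n6 /= ?mulr1n ?mulr0n; split; by field.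
Qed.

Lemma three_signs (a b c : R) : [\/ a = 1, a = -1 | a = -5] -> [\/ b = 1, b = -1 | b = -5] ->
  [\/ c = 1, c = -1 | c = -5] -> a + b + c = 3 -> [&& a != -1, b != -1 & c != -1].
Proof. by move=> [->|->|->] [->|->|->] [->|->|->] e; apply/and3P; split; apply/eqP; lra. Qed.

End Integers.

(** * The code of 552 points *)

Section Code552.
Context {R : realType} (D : seq 'rV[R]_23).
Hypotheses (hD : tight_code 5 5 D) (sD : size D = 552%N).

Let norm y : y \in D -> dotp y y = 5 := tight_norm hD (y := y).

Lemma ips552 y z : y \in D -> z \in D -> y != z -> [\/ dotp y z = 1, dotp y z = -1 | dotp y z = -5].
Proof.
move=> yD zD; rewrite eq_sym => zy.
have e : (5 + dotp y z) * (dotp y z ^+ 2 - 1) ^+ 2 = 0.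
  apply: (code_values hD (f := fun t => (5 + t) * (t ^+ 2 - 1) ^+ 2) _ yD _ zD zy) => [t /andP[t1 _]|].
    by rewrite mulr_ge0 ?sqr_ge0 //; lra.
  rewrite (eq_bigr (fun w => 5 + 1 * dotp y w + (- 10) * dotp y w ^+ 2 + (- 2) * dotp y w ^+ 3
    + 5 * dotp y w ^+ 4 + 1 * dotp y w ^+ 5)); last by move=> *; ring.
  by rewrite (sum_deg5 hD) // sD norm //; field.
have /eqP : (5 + dotp y z) * ((dotp y z - 1) ^+ 2 * (dotp y z + 1) ^+ 2) = 0 by rewrite -[RHS]e; ring.
rewrite !mulf_eq0 !orbb => /or3P[] /eqP e'; [constructor 3|constructor 1|constructor 2]; lra.
Qed.

Lemma vals552 y a : y \in D -> a \in D -> [\/ y = a, y = - a, dotp y a = 1 | dotp y a = -1].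
Proof.
move=> yD aD; have [->|ya] := eqVneq y a; first by constructor 1.
have [e|e|e] := ips552 yD aD ya; [by constructor 3|by constructor 4|constructor 2].
by apply: dotp_sub0; rewrite !(dotpNl, dotpNr) ?opprK e ?norm ?opprK.
Qed.

Lemma odd552 y a : y \in D -> a \in D -> oddr (dotp y a).
Proof.
move=> yD aD; have [->|->|->|->] := vals552 yD aD.
- by rewrite norm //; exists 2; rewrite !(intrD, intrM); ring.
- by rewrite dotpNl norm //; exists (-3); rewrite !(intrD, intrM); ring.
- by exists 0.
- by exists (-1); rewrite !(intrD, intrM); ring.
Qed.

Lemma opp552 y : y \in D -> - y \in D.
Proof.
move=> yD; have [z zD yz] : exists2 z, z \in D & dotp y z = -5.
  apply: contrapT => h.
  have := sum_deg5 hD y 0 (-1) 0 1 0 0 isT.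
  rewrite (eq_bigr (fun z => (dotp y z - 1) * (dotp y z * (dotp y z + 1)))); last by move=> *; ring.
  rewrite (sum_code hD (f := fun t => (t - 1) * (t * (t + 1)))) //; first by rewrite !mul0r; lra.
  move=> z zD; rewrite eq_sym => yz; have [->|->|e] := ips552 yD zD yz; rewrite ?subrr ?addNr ?mul0r ?mulr0 //.
  by case: h; exists z.
suff -> : - y = z by [].
by apply: dotp_sub0; rewrite !(dotpNl, dotpNr) ?opprK yz ?norm ?opprK.
Qed.

Lemma pm552 y a : y \in D -> a \in D -> y != a -> y != - a -> dotp y a = 1 \/ dotp y a = -1.
Proof.
move=> yD aD n1 n2; have [e|e|->|->] := vals552 yD aD;
  [by rewrite e eqxx in n1|by rewrite e eqxx in n2|by left|by right].
Qed.

Lemma pm552_le y a : y \in D -> a \in D -> y != a -> y != - a -> -1 <= dotp y a <= 1.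
Proof. by move=> yD aD n1 n2; have [->|->] := pm552 yD aD n1 n2; lra. Qed.

(** Without a third point the products with u = e0 + e1 would lie in {0, 2, 4, -4}, where t (16 -
    t^2) is nonnegative. The odd moments make it vanish throughout, and then the second and fourth
    moments disagree. The next two existence lemmas follow the same pattern. *)
Lemma three552 : exists e : 'F_3 -> 'rV[R]_23, (forall j, e j \in D) /\
  forall j k, dotp (e j) (e k) = if j == k then 5 else -1.
Proof.
have [e0 e0D] : exists e0, e0 \in D by case: (D) sD => // a D' _; exists a; rewrite mem_head.
have [e1 e1D e01] : exists2 y, y \in D & dotp e0 y = -1.
  apply: contrapT => h.
  have := sum_deg5 hD e0 (-5) 4 1 0 0 0 isT; rewrite sD norm //.
  rewrite (eq_bigr (fun z => (dotp e0 z - 1) * (dotp e0 z + 5))); last by move=> *; ring.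
  rewrite (sum_code hD (f := fun t => (t - 1) * (t + 5))) //; first by lra.
  move=> z zD; rewrite eq_sym => yz; have [->|e|->] := ips552 e0D zD yz; rewrite ?subrr ?addNr ?mul0r ?mulr0 //.
  by case: h; exists z.
have [e2 e2D [e02 e12]] : exists2 y, y \in D & dotp e0 y = -1 /\ dotp e1 y = -1.
  apply: contrapT => h; pose u := e0 + e1.
  have uu : dotp u u = 8 by rewrite /u !(dotpDl, dotpDr) !norm // (dotpC e1) e01; field.
  have tv y : y \in D -> dotp u y \in [:: 0; 2; 4; -4].
    move=> yD; have [->|y0] := eqVneq y e0; first by rewrite dotpDl norm // (dotpC e1) e01 !inE (_ : 5 - 1 = 4) ?eqxx ?orbT //; field.
    have [->|y1] := eqVneq y e1; first by rewrite dotpDl norm // e01 !inE (_ : -1 + 5 = 4) ?eqxx ?orbT //; field.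
    have [->|y0'] := eqVneq y (- e0); first by rewrite dotpNr dotpDl norm // (dotpC e1) e01 !inE (_ : - (5 - 1) = -4) ?eqxx ?orbT //; field.
    have [->|y1'] := eqVneq y (- e1); first by rewrite dotpNr dotpDl norm // e01 !inE (_ : - (-1 + 5) = -4) ?eqxx ?orbT //; field.
    rewrite dotpDl !(dotpC _ y).
    have [->|a1] := pm552 yD e0D y0 y0'; have [->|a2] := pm552 yD e1D y1 y1'.
    - by rewrite !inE (_ : 1 + 1 = 2) ?eqxx ?orbT.
    - by rewrite a2 subrr !inE eqxx.
    - by rewrite a1 addNr !inE eqxx.
    - by case: h; exists y; rewrite // !(dotpC _ y).
  have z3 : \sum_(y <- D) dotp u y * (16 - dotp u y ^+ 2) = 0.
    rewrite (eq_bigr (fun w => 0 + 16 * dotp u w + 0 * dotp u w ^+ 2 + (-1) * dotp u w ^+ 3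
      + 0 * dotp u w ^+ 4 + 0 * dotp u w ^+ 5)); last by move=> *; ring.
    by rewrite (sum_deg5 hD) // !mul0r !addr0.
  have p3 y : y \in D -> 0 <= dotp u y * (16 - dotp u y ^+ 2).
    by move=> /tv; rewrite !inE => /or4P[] /eqP ->; lra.
  have all0 := psumr_seq_eq0 p3 z3.
  have := sum_deg5 hD u 0 0 (-16) 0 1 0 isT; rewrite sD uu.
  rewrite (eq_big_seq (fun=> 0)) => [|y yD]; last first.
    by transitivity (- dotp u y * (dotp u y * (16 - dotp u y ^+ 2))); [ring|rewrite all0 ?mulr0].
  rewrite big1 // => e; suff : (0 : R) = -10752 by lra.
  by rewrite [LHS]e; field.
exists (fun j => if j == 0 then e0 else if j == 1 then e1 else e2); split.
  by move=> j; case: (F3_case j) => ->.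
by move=> j k; case: (F3_case j) => ->; case: (F3_case k) => -> /=; rewrite ?norm //; rewrite dotpC.
Qed.

Variable e : 'F_3 -> 'rV[R]_23.
Hypotheses (eD : forall j, e j \in D) (ee : forall j k, dotp (e j) (e k) = if j == k then 5 else -1).

Variable E : 'rV[R]_23.
Hypothesis EDef : E = e 0 + e 1 + e (-1).
Let EE : dotp E E = 9.
Proof. by rewrite EDef !(dotpDl, dotpDr) !ee /=; ring. Qed.
Let eE j : dotp (e j) E = 3.
Proof. by rewrite EDef !dotpDr !ee; case: (F3_case j) => -> /=; ring. Qed.

(** With [E] in the role of [o], these points play the part of the neighbours in the code of 112
    points: ten triangles, each of sum - E. *)
Let T := [seq y <- D | [&& dotp y (e 0) == -1, dotp y (e 1) == -1 & dotp y (e (-1)) == -1]].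

Let TP y : reflect (y \in D /\ forall j, dotp y (e j) = -1) (y \in T).
Proof.
rewrite mem_filter; apply: (iffP andP) => -[].
  by move=> /and3P[/eqP h0 /eqP h1 /eqP h2] yD; split=> // j; case: (F3_case j) => ->.
by move=> yD h; rewrite !h !eqxx.
Qed.

Let sT : size T = 30%N.
Proof.
pose S := [seq y <- D | [&& dotp y (e 0) == 1, dotp y (e 1) == 1 & dotp y (e (-1)) == 1]].
have id y : y \in D ->
  dotp E y ^+ 2 - 1 = 8 * [&& dotp y (e 0) == -1, dotp y (e 1) == -1 & dotp y (e (-1)) == -1]%:R
    + 8 * [&& dotp y (e 0) == 1, dotp y (e 1) == 1 & dotp y (e (-1)) == 1]%:R
    + 3^-1 * (dotp (e 0) y ^+ 2 - 1 + (dotp (e 1) y ^+ 2 - 1) + (dotp (e (-1)) y ^+ 2 - 1)) /\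
  dotp E y ^+ 3 - dotp E y = 24 * [&& dotp y (e 0) == 1, dotp y (e 1) == 1 & dotp y (e (-1)) == 1]%:R
    - 24 * [&& dotp y (e 0) == -1, dotp y (e 1) == -1 & dotp y (e (-1)) == -1]%:R
    + 5^-1 * (dotp (e 0) y ^+ 3 - dotp (e 0) y + (dotp (e 1) y ^+ 3 - dotp (e 1) y) + (dotp (e (-1)) y ^+ 3 - dotp (e (-1)) y)).
  move=> yD; rewrite (dotpC E) EDef !dotpDr !(dotpC _ y); apply: count_identities.
  have [->|y0] := eqVneq y (e 0); first by left; constructor 2; rewrite !ee.
  have [->|y1] := eqVneq y (e 1); first by left; constructor 3; rewrite !ee.
  have [->|y2] := eqVneq y (e (-1)); first by left; constructor 4; rewrite !ee.
  have [->|y0'] := eqVneq y (- e 0); first by right; constructor 1; rewrite !dotpNl !ee /= ?opprK.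
  have [->|y1'] := eqVneq y (- e 1); first by right; constructor 2; rewrite !dotpNl !ee /= ?opprK.
  have [->|y2'] := eqVneq y (- e (-1)); first by right; constructor 3; rewrite !dotpNl !ee /= ?opprK.
  by left; constructor 1; split; [|split]; apply: pm552.
have S2 u : \sum_(y <- D) (dotp u y ^+ 2 - 1) = 120 * dotp u u - 552.
  rewrite (eq_bigr (fun w => -1 + 0 * dotp u w + 1 * dotp u w ^+ 2 + 0 * dotp u w ^+ 3
      + 0 * dotp u w ^+ 4 + 0 * dotp u w ^+ 5)); last by move=> *; ring.
  by rewrite (sum_deg5 hD) // sD; field.
have S3 u : \sum_(y <- D) (dotp u y ^+ 3 - dotp u y) = 0.
  rewrite (eq_bigr (fun w => 0 + (-1) * dotp u w + 0 * dotp u w ^+ 2 + 1 * dotp u w ^+ 3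
      + 0 * dotp u w ^+ 4 + 0 * dotp u w ^+ 5)); last by move=> *; ring.
  by rewrite (sum_deg5 hD) // !mul0r !addr0.
have h2 := S2 E; rewrite EE (eq_big_seq _ (fun y yD => (id y yD).1)) in h2.
have h3 := S3 E; rewrite (eq_big_seq _ (fun y yD => (id y yD).2)) in h3.
have lin2 (a b c0 c1 c2 : 'rV[R]_23 -> R) (x y : R) : \sum_(z <- D) (x * a z + x * b z + y * (c0 z + c1 z + c2 z)) =
    x * \sum_(z <- D) a z + x * \sum_(z <- D) b z
    + y * (\sum_(z <- D) c0 z + \sum_(z <- D) c1 z + \sum_(z <- D) c2 z).
  by rewrite !big_split /= -!mulr_sumr !big_split.
have lin3 (a b c0 c1 c2 : 'rV[R]_23 -> R) (x y : R) : \sum_(z <- D) (x * a z - x * b z + y * (c0 z + c1 z + c2 z)) =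
    x * \sum_(z <- D) a z - x * \sum_(z <- D) b z
    + y * (\sum_(z <- D) c0 z + \sum_(z <- D) c1 z + \sum_(z <- D) c2 z).
  by rewrite big_split sumrB /= -!mulr_sumr !big_split.
rewrite lin2 !S2 !sum_indicator -/T -/S !ee /= in h2.
rewrite lin3 !S3 !sum_indicator -/T -/S in h3.
apply/eqP; rewrite -(eqr_nat R); apply/eqP; lra.
Qed.

(** The products with E + z are even, and -4 is taken only at the points sought; if it is missing, t
    (t^2 - 4) is nonnegative. *)
Lemma second552 z : z \in T -> exists2 z', z' \in T & dotp z z' = -1.
Proof.
move=> /TP[zD ze]; apply: contrapT => h; pose u := E + z.
have zE : dotp z E = -3 by rewrite EDef !dotpDr !ze; ring.
have uu : dotp u u = 8 by rewrite /u !(dotpDl, dotpDr) (dotpC E z) EE zE norm //; ring.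
have own a : (exists j, a = e j) \/ a = z -> dotp u a = 2.
  by move=> [[j ->]|->]; rewrite /u dotpDl; [rewrite (dotpC E) eE ze; ring|rewrite (dotpC E) zE norm //; ring].
have tv y : y \in D -> dotp u y \in [:: 0; 2; -2; 4].
  move=> yD.
  have [[a ha [->|->]]|ny] := pselect (exists2 a, (exists j, a = e j) \/ a = z & y = a \/ y = - a).
  - by rewrite own // !inE eqxx ?orbT.
  - by rewrite dotpNr own // !inE eqxx ?orbT.
  have b a : (exists j, a = e j) \/ a = z -> -1 <= dotp a y <= 1.
    move=> ha; rewrite dotpC; apply: pm552_le => //; first by case: ha => [[j ->]|->].
      by apply/eqP => ya; apply: ny; exists a => //; left.
    by apply/eqP => ya; apply: ny; exists a => //; right.
  have b0 := b (e 0) (or_introl (ex_intro _ 0 erefl)).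
  have b1 := b (e 1) (or_introl (ex_intro _ 1 erefl)).
  have b2 := b (e (-1)) (or_introl (ex_intro _ (-1) erefl)).
  have b3 := b z (or_intror erefl).
  have uE : dotp u y = dotp (e 0) y + dotp (e 1) y + (dotp (e (-1)) y + dotp z y) by rewrite /u EDef !dotpDl; ring.
  have ev : exists t : int, dotp u y = (2 * t)%:~R.
    by rewrite uE; apply: evenrD; apply: oddrD; apply: odd552.
  have t1 : dotp u y <= 4 by lra.
  have t2 : -4 <= dotp u y by lra.
  have := even_le4 ev t1 t2; rewrite !inE => /orP[->//|/or4P[->|->|->|/eqP e4]]; rewrite ?orbT //.
  case: h; exists y; last by lra.
  by apply/TP; split=> // j; rewrite dotpC; case: (F3_case j) => ->; lra.
have z3 : \sum_(y <- D) dotp u y * (dotp u y ^+ 2 - 4) = 0.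
  rewrite (eq_bigr (fun w => 0 + (-4) * dotp u w + 0 * dotp u w ^+ 2 + 1 * dotp u w ^+ 3
    + 0 * dotp u w ^+ 4 + 0 * dotp u w ^+ 5)); last by move=> *; ring.
  by rewrite (sum_deg5 hD) // !mul0r !addr0.
have p3 y : y \in D -> 0 <= dotp u y * (dotp u y ^+ 2 - 4).
  by move=> /tv; rewrite !inE => /or4P[] /eqP ->; lra.
have all0 := psumr_seq_eq0 p3 z3.
have := sum_deg5 hD u 0 0 (-4) 0 1 0 isT; rewrite sD uu.
rewrite (eq_big_seq (fun=> 0)) => [|y yD]; last first.
  by transitivity (dotp u y * (dotp u y * (dotp u y ^+ 2 - 4))); [ring|rewrite all0 ?mulr0].
rewrite big1 // => e'; suff : (0 : R) = 768 by lra.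
by rewrite [LHS]e'; field.
Qed.

(** The products with u = E + z + z', of norm 5, are odd; if -5 is missing, t (t^2 - 1)(t^2 - 9) is
    nonnegative on them. *)
Lemma third552 z z' : z \in T -> z' \in T -> dotp z z' = -1 -> - (E + z + z') \in T.
Proof.
move=> /TP[zD ze] /TP[zD' ze'] zz; pose u := E + z + z'.
have zE : dotp z E = -3 by rewrite EDef !dotpDr !ze; ring.
have zE' : dotp z' E = -3 by rewrite EDef !dotpDr !ze'; ring.
have uu : dotp u u = 5.
  by rewrite /u !(dotpDl, dotpDr) (dotpC E z) (dotpC E z') (dotpC z' z) EE zE zE' zz !norm //; ring.
have own a : [\/ exists j, a = e j, a = z | a = z'] -> dotp u a = 1.
  move=> [[j ->]|->|->]; rewrite /u !dotpDl.
  - by rewrite (dotpC E) eE ze ze'; ring.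
  - by rewrite (dotpC E) (dotpC z' z) zE zz norm //; ring.
  - by rewrite (dotpC E) zE' zz norm //; ring.
have [y yD uy] : exists2 y, y \in D & dotp u y = -5.
  apply: contrapT => h.
  have tv y : y \in D -> dotp u y \in [:: 1; -1; 3; -3; 5].
    move=> yD.
    have [[a ha [->|->]]|ny] := pselect (exists2 a, [\/ exists j, a = e j, a = z | a = z'] & y = a \/ y = - a).
    - by rewrite own // !inE eqxx ?orbT.
    - by rewrite dotpNr own // !inE eqxx ?orbT.
    have b a : [\/ exists j, a = e j, a = z | a = z'] -> -1 <= dotp a y <= 1.
      move=> ha; rewrite dotpC; apply: pm552_le => //; first by case: ha => [[j ->]|->|->].
        by apply/eqP => ya; apply: ny; exists a => //; left.
      by apply/eqP => ya; apply: ny; exists a => //; right.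
    have b0 := b (e 0) (Or31 _ _ (ex_intro _ 0 erefl)).
    have b1 := b (e 1) (Or31 _ _ (ex_intro _ 1 erefl)).
    have b2 := b (e (-1)) (Or31 _ _ (ex_intro _ (-1) erefl)).
    have b3 := b z (Or32 _ _ erefl).
    have b4 := b z' (Or33 _ _ erefl).
    have uE : dotp u y = dotp (e 0) y + dotp (e 1) y + (dotp (e (-1)) y + dotp z y) + dotp z' y.
      by rewrite /u EDef !dotpDl; ring.
    have ev : oddr (dotp u y).
      by rewrite uE; apply: evenr_odd; [apply: evenrD; apply: oddrD|]; apply: odd552.
    have t1 : dotp u y <= 5 by lra.
    have t2 : -5 <= dotp u y by lra.
    have := odd_le5 ev t1 t2; rewrite !inE => /orP[->//|/orP[->|/or4P[->|->|->|/eqP e4]]]; rewrite ?orbT //.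
    by case: h; exists y.
  have z3 : \sum_(y <- D) dotp u y * ((dotp u y ^+ 2 - 1) * (dotp u y ^+ 2 - 9)) = 0.
    rewrite (eq_bigr (fun w => 0 + 9 * dotp u w + 0 * dotp u w ^+ 2 + (-10) * dotp u w ^+ 3
      + 0 * dotp u w ^+ 4 + 1 * dotp u w ^+ 5)); last by move=> *; ring.
    by rewrite (sum_deg5 hD) // !mul0r !addr0.
  have p3 y : y \in D -> 0 <= dotp u y * ((dotp u y ^+ 2 - 1) * (dotp u y ^+ 2 - 9)).
    by move=> /tv; rewrite !inE => /orP[|/or4P[]] /eqP ->; lra.
  have all0 := psumr_seq_eq0 p3 z3.
  have := sum_deg5 hD u 9 0 (-10) 0 1 0 isT; rewrite sD uu.
  rewrite (eq_big_seq (fun=> 0)) => [|y yD]; last first.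
    have u0 : dotp u y != 0.
      by have := tv y yD; rewrite !inE => /orP[|/or4P[]] /eqP ->; apply/eqP; lra.
    by apply: (mulfI u0); rewrite mulr0; transitivity (dotp u y * ((dotp u y ^+ 2 - 1) * (dotp u y ^+ 2 - 9))); [ring|exact: all0].
  rewrite big1 // => e'; suff : (0 : R) = 768 by lra.
  by rewrite [LHS]e'; field.
have wE : - u = y by apply: dotp_sub0; rewrite !(dotpNl, dotpNr) ?opprK ?uu ?uy ?norm ?opprK.
apply/TP; rewrite -/u; split; first by rewrite wE.
by move=> j; rewrite dotpNl own //; constructor 1; exists j.
Qed.

Lemma frame552 : exists x : 'I_10 -> 'F_3 -> 'rV[R]_23, [/\ forall i j, x i j \in T,
    forall b, b \in T -> exists i j, b = x i j,
    forall i, x i 0 + x i 1 + x i (-1) = - E &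
    forall i i' j j', dotp (x i j + 3^-1 *: E) (x i' j' + 3^-1 *: E) =
      if i == i' then (if j == j' then 2 * 2 else - 2) else 0].
Proof.
pose r (a b : 'rV[R]_23) := dotp a b == -1.
have rC : symmetric r by move=> a b; rewrite /r dotpC.
have TE y : y \in T -> dotp y E = -3 by move=> /TP[_ ye]; rewrite EDef !dotpDr !ye; ring.
have TD y : y \in T -> y \in D by move=> /TP[].
have rne a b : a \in D -> r a b -> a != b.
  by move=> aD /eqP ab; apply: contra_eq_neq ab => <-; rewrite norm //; apply/eqP; lra.
have [|||x [xT xS xr xn]] := @triangle_partition _ r rC 10 T.
- by rewrite filter_uniq ?(tight_uniq hD).
- exact: sT.
- move=> a aT; have [a' aT' ra] := second552 aT; have aT'' := third552 aT aT' ra.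
  have [aD aD' aD''] := And3 (TD _ aT) (TD _ aT') (TD _ aT'').
  have r1 : r a (- (E + a + a')) by rewrite /r dotpNr !dotpDr norm // TE // ra; apply/eqP; ring.
  have r2 : r a' (- (E + a + a')).
    by rewrite /r dotpNr !dotpDr norm // TE // (dotpC a') ra; apply/eqP; ring.
  exists a', (- (E + a + a')); split=> //.
  + by rewrite /= !inE !negb_or !rne // /r ra.
  + by rewrite {1}/r ra eqxx r1 r2.
  move=> b bT; rewrite !inE !negb_or => /and3P[n1 n2 n3]; have bD := TD _ bT.
  have v z : z \in D -> b != z -> [\/ dotp z b = 1, dotp z b = -1 | dotp z b = -5].
    by move=> zD bz; apply: ips552 => //; rewrite eq_sym.
  apply: (three_signs (v _ aD n1) (v _ aD' n2) (v _ aD'' n3)).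
  by rewrite dotpNl !dotpDl (dotpC E) TE //; lra.
exists x; split=> //.
- move=> i; have [a aE] : exists a, a = x i 0 + x i 1 + x i (-1) by eexists.
  rewrite -aE; have /eqP r01 := xr i 0 1 isT; have /eqP r02 := xr i 0 (-1) isT; have /eqP r12 := xr i 1 (-1) isT.
  have aa : dotp a a = 9.
    rewrite aE !(dotpDl, dotpDr) !norm ?TD // r01 r02 r12 (dotpC (x i 1)) r01 (dotpC (x i (-1)) (x i 0)) r02.
    by rewrite (dotpC (x i (-1))) r12; ring.
  have ao : dotp a E = -9 by rewrite aE !dotpDl !TE //; ring.
  by apply: dotp_sub0; rewrite ?(dotpNl, dotpNr) ?opprK ?aa ?ao ?EE ?opprK.
move=> i i' j j'; have xD := TD _ (xT i j); have xD' := TD _ (xT i' j').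
rewrite !(dotpDl, dotpDr) !(dotpZl, dotpZr) EE (dotpC E) !TE //.
have [<-|ii] := eqVneq i i'.
  have [<-|jj] := eqVneq j j'; first by rewrite norm //; lra.
  by have /eqP -> := xr i j j' jj; lra.
have [xx nr] := xn i i' j j' ii.
have [->|e1|e1] := ips552 xD xD' xx; first by lra.
  by rewrite /r e1 eqxx in nr.
have xN : x i j = - x i' j' by apply: dotp_sub0; rewrite !(dotpNl, dotpNr) ?opprK e1 ?norm ?opprK.
have := TE _ (xT i j); rewrite xN dotpNl TE //; lra.
Qed.

Lemma few_values552 : few_values 3 D.
Proof.
have [x [xT xS xs XX]] := frame552.
have TE y : y \in T -> dotp y E = -3 by move=> /TP[_ ye]; rewrite EDef !dotpDr !ye; ring.
pose X i j := x i j + 3^-1 *: E.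
pose Y := transversal X.
have XXd := XX : forall i i' j j', dotp (X i j) (X i' j') = if i == i' then (if j == j' then 2 * 2 else - 2) else 0.
have YY p q : dotp (Y p) (Y q) = 2 * (3 * (agr p q)%:R - 10) by rewrite (transversal_dot XXd).
have eX k i j : dotp (e k) (X i j) = 0.
  by have /TP[_ xe] := xT i j; rewrite dotpDr dotpZr eE dotpC xe; lra.
have eY k p : dotp (e k) (Y p) = 0 by rewrite dotp_sumr big1 // => i _; apply: eX.
have EX i j : dotp E (X i j) = 0 by rewrite EDef !dotpDl !eX !addr0.
have EY p : dotp E (Y p) = 0 by rewrite EDef !dotpDl !eY !addr0.
(* Up to sign every code point is some [e j], lies in [T], or lies in some [W j]; a point of [W j]
   is determined by [j] and a word. *)
pose W j := [seq z <- D | [forall k, dotp z (e k) == if k == j then 1 else -1]].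
have WP j z : reflect (z \in D /\ forall k, dotp z (e k) = if k == j then 1 else -1) (z \in W j).
  rewrite mem_filter; apply: (iffP andP) => [[/forallP h zD]|[zD h]]; split=> //.
    by move=> k; apply/eqP.
  by apply/forallP => k; rewrite h.
have WE j z : z \in W j -> dotp z E = -1.
  by move=> /WP[_ h]; rewrite EDef !dotpDr !h; case: (F3_case j) => -> /=; ring.
pose Z j p := 3^-1 *: e j - (2 / 9) *: E - 3^-1 *: Y p.
have Zv j p (v : 'rV[R]_23) : dotp v (Z j p) = 3^-1 * dotp v (e j) - 2 / 9 * dotp v E - 3^-1 * dotp v (Y p).
  by rewrite /Z !dotpBr !dotpZr.
have Ze j p k : dotp (Z j p) (e k) = 3^-1 * dotp (e k) (e j) - 2 / 3.
  by rewrite dotpC Zv eE eY; lra.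
have ZE j p : dotp (Z j p) E = -1 by rewrite dotpC Zv EY EE (dotpC E) eE; lra.
have ZY j p q : dotp (Z j p) (Y q) = - (2 / 3) * (3 * (agr q p)%:R - 10).
  by rewrite dotpC Zv YY !(dotpC (Y q)) eY EY; lra.
have wordP j z : z \in W j -> exists p : word, z = Z j p.
  move=> zW; have /WP[zD ze] := zW.
  have v i k : [\/ dotp z (x i k) = 1, dotp z (x i k) = -1 | dotp z (x i k) = -5].
    have /TP[xD xe] := xT i k; apply: ips552 => //.
    by apply/eqP => zx; have := ze j; rewrite eqxx zx xe; lra.
  have v5 i k : dotp z (x i k) != -5.
    have /TP[xD xe] := xT i k; apply/eqP => e5.
    have zN : z = - x i k by apply: dotp_sub0; rewrite !(dotpNl, dotpNr) ?opprK e5 ?norm ?opprK.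
    have [k' kj] : exists k', k' != j by exists (j + 1); case: (F3_case j) => ->.
    by have := ze k'; rewrite (negbTE kj) zN dotpNl xe; lra.
  have {v5}v i k : dotp z (x i k) = 1 \/ dotp z (x i k) = -1.
    by have [h|h|/eqP h] := v i k; [left|right|rewrite (negbTE (v5 i k)) in h].
  have ex i : exists k, dotp z (x i k) = -1.
    have := congr1 (dotp z) (xs i); rewrite !dotpDr dotpNr (WE j) //.
    have [->|h] := v i 0; last by exists 0.
    have [->|h] := v i 1; last by exists 1.
    have [->|h] := v i (-1); last by exists (-1).
    by lra.
  have [p hp] := choice ex.
  pose q : word := [ffun i => p i]; exists q.
  have zY : dotp z (Y q) = 10 * (- (4 / 3)).
    apply: dotp_transversal => i; rewrite ffunE dotpDr dotpZr hp (WE j) //; lra.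
  have zz : dotp z (Z j q) = 5 by rewrite Zv ze eqxx (WE j) // zY; lra.
  apply: dotp_sub0; rewrite zz; first by rewrite norm.
  by rewrite [LHS]Zv Ze ZE ZY ee eqxx agr_self; lra.
have Zdot j k p q : dotp (Z j p) (Z k q) = (dotp (e j) (e k) + 6 * (agr q p)%:R - 20) / 9.
  by rewrite Zv Ze ZE ZY (dotpC (e k)); lra.
have [w hw] : exists w : 'rV[R]_23 -> word, forall z j, z \in W j -> z = Z j (w z).
  have : forall z, exists p : word, forall j, z \in W j -> z = Z j p.
    move=> z; have [[j zj]|h] := pselect (exists j, z \in W j); last first.
      by exists 0 => j zj; case: h; exists j.
    have [p hp] := wordP j z zj; exists p => k zk; suff -> : k = j by [].
    have /WP[_ hj] := zj; have /WP[_ hk] := zk.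
    by apply/eqP; have := hk k; rewrite hj eqxx; case: eqP => // _; lra.
  by move=> /choice[w hw]; exists w.
have cast (m k : nat) : m%:R = k%:R :> R -> m = k by move/eqP; rewrite eqr_nat => /eqP.
have agrE j k z z' : z \in W j -> z' \in W k -> (agr (w z) (w z') %% 3 = if j == k then 1 else 2)%N.
  move=> zj zk; have /WP[zD _] := zj; have /WP[zD' _] := zk.
  have := Zdot j k (w z) (w z'); rewrite -(hw z j) // -(hw z' k) // ee => e1.
  have -> : agr (w z) (w z') = agr (w z') (w z) by apply: eq_bigr => i _; rewrite eq_sym.
  have := agr_le (w z') (w z); rewrite -(ler_nat R) => le10.
  have [zz|zz|zz|zz] : [\/ dotp z z' = 5, dotp z z' = 1, dotp z z' = -1 | dotp z z' = -5].
    have [->|zz] := eqVneq z z'; first by constructor 1; rewrite norm.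
    by have [] := ips552 zD zD' zz; [constructor 2|constructor 3|constructor 4].
  - rewrite zz in e1; case: (j == k) e1 => e1; [rewrite (cast (agr (w z') (w z)) 10%N) //; lra|exfalso; lra].
  - rewrite zz in e1; case: (j == k) e1 => e1; [rewrite (cast (agr (w z') (w z)) 4%N) //; lra|rewrite (cast (agr (w z') (w z)) 5%N) //; lra].
  - rewrite zz in e1; case: (j == k) e1 => e1; [rewrite (cast (agr (w z') (w z)) 1%N) //; lra|rewrite (cast (agr (w z') (w z)) 2%N) //; lra].
  - have a0 := ler0n R (agr (w z') (w z)); exfalso; rewrite zz in e1; case: (j == k) e1 => e1; lra.
(* The class [t] is chosen nonempty. If both other classes are empty [words_same] suffices;
   otherwise [k] is a nonempty one and [words_three] applies. *)
have [t [h [h2 h0]]] : exists t : 'F_3, exists h : word,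
    (forall z, z \in W t -> agr h (w z) %% 3 = 2)%N /\
    (forall k z, k != t -> z \in W k -> agr h (w z) %% 3 = 0)%N.
  have [[t [z2 zt]]|no] := pselect (exists t z, z \in W t); last first.
    by exists 0, 0; split=> [z zW|k z _ zW]; case: no; [exists 0, z|exists k, z].
  exists t; have [[k [z0 [kt zk]]]|no] := pselect (exists k z, k != t /\ z \in W k); last first.
    have [|h hh] := @words_same [seq w z | z <- W t].
      by move=> _ _ /mapP[z zW ->] /mapP[z' zW' ->]; rewrite (agrE t t) // eqxx.
    exists h; split=> [z zW|k z kt zW]; first by apply/hh/map_f.
    by case: no; exists k, z.
  have [l [lt lk al]] : exists l : 'F_3, [/\ l != t, l != k & forall j, [|| j == t, j == k | j == l]].
    exists (- t - k); move: kt; case: (F3_case t) => ->; case: (F3_case k) => -> // _;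
      by split=> // j; case: (F3_case j) => ->.
  pose Wl j := [seq w z | z <- W j].
  have [||||h [hh1 hh2]] := @words_three (Wl k) (Wl l) (Wl t) (w z2) (w z0).
  - exact: map_f.
  - exact: map_f.
  - move=> p q /or3P[] /andP[/mapP[z zW ->] /mapP[z' zW' ->]]; by rewrite (agrE _ _ _ _ zW zW') eqxx.
  - move=> p q /or3P[] /andP[/mapP[z zW ->] /mapP[z' zW' ->]]; rewrite (agrE _ _ _ _ zW zW').
    + by rewrite eq_sym (negbTE lk).
    + by rewrite eq_sym (negbTE kt).
    + by rewrite eq_sym (negbTE lt).
  exists h; split=> [z zW|j z jt zW]; first by apply/hh1/map_f.
  apply: hh2; have := al j; rewrite (negbTE jt) /= => /orP[] /eqP je; rewrite je in zW; apply/orP; [left|right]; exact: map_f.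
(* The products are 0 at [e t], 1 at the other two, and 0 or -1 on [T]. On [W j] they are (2 -
   agr)/3 for j = t and 1 - agr/3 otherwise, which is why [h] needs the residues 2 and 0. The norm
   5/3 equates the second and fourth moments. *)
pose v := (5 / 18) *: E - 6^-1 *: e t + 6^-1 *: Y h.
have vd y : dotp v y = 5 / 18 * dotp E y - 6^-1 * dotp (e t) y + 6^-1 * dotp (Y h) y.
  by rewrite /v dotpDl dotpBl !dotpZl.
have vv : dotp v v = 5 / 3.
  rewrite vd (dotpC E) (dotpC (e t)) (dotpC (Y h)) !vd EE (dotpC E) !eE ee eqxx YY agr_self.
  by rewrite !(dotpC (Y h)) eY EY; lra.
have vY y : y \in D -> dotp v y \is a Num.int.
  have key z : z \in D -> [\/ exists j, z = e j, z \in T | exists j, z \in W j] -> dotp v z \is a Num.int.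
    move=> zD [[j ->]|zT|[j zW]].
    - rewrite vd (dotpC E) eE (dotpC (Y h)) eY ee; case: eqP => _.
        by rewrite (_ : _ + _ = 0) ?rpred0 //; lra.
      by rewrite (_ : _ + _ = 1) ?rpred1 //; lra.
    - have [i [j zE]] := xS z zT; have /TP[_ ze] := zT.
      rewrite vd (dotpC E) TE // (dotpC (e t)) ze.
      have -> : z = X i j - 3^-1 *: E by rewrite zE /X addrK.
      rewrite dotpBr dotpZr [dotp (Y h) E]dotpC EY [dotp (Y h) _]dotpC (frame_transversal XXd).
      case: (j == h i); first by rewrite (_ : _ + _ = 0) ?rpred0 //; lra.
      by rewrite (_ : _ + _ = -1) ?rpredN ?rpred1 //; lra.
    have /WP[_ ze] := zW; rewrite vd (dotpC E) (WE j) // (dotpC (e t)) ze (hw z j zW) (dotpC (Y h)) ZY.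
    have [tj|tj] := eqVneq t j.
      have e3 := h2 z; rewrite tj in e3; have {}e3 := e3 zW.
      have [m ->] : exists m, agr h (w z) = (3 * m + 2)%N by exists (agr h (w z) %/ 3)%N; lia.
      by rewrite natrD natrM (_ : _ + _ = - m%:R) ?rpredN ?rpred_nat //; lra.
    have e3 := h0 j z; rewrite eq_sym tj in e3; have {}e3 := e3 isT zW.
    have [m ->] : exists m, agr h (w z) = (3 * m)%N by exists (agr h (w z) %/ 3)%N; lia.
    suff -> : 5 / 18 * -1 - 6^-1 * -1 + 6^-1 * (- (2 / 3) * (3 * (3 * m)%:R - 10)) = 1 - m%:R :> R by rewrite rpredB ?rpred1 ?rpred_nat.
    rewrite (natrM _ 3 m); set q := (m%:R : R).
    by lra.
  have cover z : z \in D -> (forall j, z != e j) -> (forall j, z != - e j) ->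
      [\/ z \in T, - z \in T, exists j, z \in W j | exists j, - z \in W j].
    move=> zD n1 n2; have s j := pm552 zD (eD j) (n1 j) (n2 j).
    have zND := opp552 zD.
    have [s0|s0] := s 0; have [s1|s1] := s 1; have [s2|s2] := s (-1).
    - by constructor 2; apply/TP; split=> // k; rewrite dotpNl; case: (F3_case k) => ->; rewrite ?s0 ?s1 ?s2.
    - by constructor 4; exists (-1); apply/WP; split=> // k; rewrite dotpNl; case: (F3_case k) => -> /=; rewrite ?s0 ?s1 ?s2 ?opprK.
    - by constructor 4; exists 1; apply/WP; split=> // k; rewrite dotpNl; case: (F3_case k) => -> /=; rewrite ?s0 ?s1 ?s2 ?opprK.
    - by constructor 3; exists 0; apply/WP; split=> // k; case: (F3_case k) => -> /=.
    - by constructor 4; exists 0; apply/WP; split=> // k; rewrite dotpNl; case: (F3_case k) => -> /=; rewrite ?s0 ?s1 ?s2 ?opprK.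
    - by constructor 3; exists 1; apply/WP; split=> // k; case: (F3_case k) => -> /=.
    - by constructor 3; exists (-1); apply/WP; split=> // k; case: (F3_case k) => -> /=.
    - by constructor 1; apply/TP; split=> // k; case: (F3_case k) => ->.
  move=> yD; have yND := opp552 yD.
  have [[j ->]|n1] := pselect (exists j, y = e j); first by apply: key => //; constructor 1; exists j.
  have [[j ->]|n2] := pselect (exists j, y = - e j).
    by rewrite dotpNr rpredN; apply: key => //; constructor 1; exists j.
  have [||yT|yT|yW|yW] := cover y yD.
  - by move=> j; apply/eqP => ye; apply: n1; exists j.
  - by move=> j; apply/eqP => ye; apply: n2; exists j.
  - by apply: key => //; constructor 2.
  - by rewrite -[y]opprK dotpNr rpredN; apply: key => //; constructor 2.
  - by apply: key => //; constructor 3.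
  - by rewrite -[y]opprK dotpNr rpredN; apply: key => //; constructor 3.
exists v; first by rewrite -dotp_eq0 vv; apply/eqP; lra.
exists [:: 0; 1; -1] => // y yD.
have S0 : \sum_(y <- D) (dotp v y ^+ 2 * (dotp v y ^+ 2 - 1)) = 0.
  rewrite (eq_bigr (fun w => 0 + 0 * dotp v w + (-1) * dotp v w ^+ 2 + 0 * dotp v w ^+ 3
    + 1 * dotp v w ^+ 4 + 0 * dotp v w ^+ 5)); last by move=> *; ring.
  by rewrite (sum_deg5 hD) // sD vv; field.
have e0 := psumr_seq_eq0 (fun y yD => int_quartic_ge0 (vY y yD)) S0 yD.
have /eqP : (dotp v y * dotp v y) * ((dotp v y - 1) * (dotp v y + 1)) = 0 by rewrite -[RHS]e0; ring.
by rewrite !mulf_eq0 orbb subr_eq0 addr_eq0 !inE.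
Qed.

End Code552.

(** * Binary words and the code of 891 points *)

Section Binary.

Definition bword := {ffun 'I_21 -> 'F_2}.
Implicit Types x z s : bword.

Definition wt x := (\sum_i (x i != 0%R))%N.
Definition bmul x z : bword := [ffun i => x i * z i].
Definition bdot x z : 'F_2 := \sum_i x i * z i.

Lemma F2_case (a : 'F_2) : a = 0 \/ a = 1.
Proof. by case: a => [[|[|//]] ?]; [left|right]; apply/val_inj. Qed.

Lemma F2_addxx (a : 'F_2) : a + a = 0.
Proof. by case: (F2_case a) => ->; exact/val_inj. Qed.

Lemma bword_addxx x : x + x = 0.
Proof. by apply/ffunP => i; rewrite !ffunE F2_addxx. Qed.

Lemma bdotC x z : bdot x z = bdot z x.
Proof. by apply: eq_bigr => i _; rewrite mulrC. Qed.

Lemma bdotDl x y z : bdot (x + y) z = bdot x z + bdot y z.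
Proof. by rewrite -big_split; apply: eq_bigr => i _; rewrite ffunE mulrDl. Qed.

Lemma bdotDr x y z : bdot z (x + y) = bdot z x + bdot z y.
Proof. by rewrite !(bdotC z) bdotDl. Qed.

Lemma bdot_odd x z : (bdot x z == 1) = odd (wt (bmul x z)).
Proof.
have -> : bdot x z = (wt (bmul x z))%:R.
  by rewrite natr_sum; apply: eq_bigr => i _; rewrite ffunE; case: (F2_case (x i * z i)) => ->.
by rewrite -val_eqE /= val_Fp_nat // modn2; case: odd.
Qed.

Lemma bdot0_even x z : bdot x z = 0 -> ~~ odd (wt (bmul x z)).
Proof. by rewrite -bdot_odd => ->. Qed.

Lemma wtD x z : (wt (x + z)%R + 2 * wt (bmul x z) = wt x + wt z)%N.
Proof.
rewrite /wt big_distrr -!big_split; apply: eq_bigr => i _; rewrite !ffunE.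
by case: (F2_case (x i)) => ->; case: (F2_case (z i)) => ->.
Qed.

(** The real part of i^k, negative only for k = 2 modulo 4. Summed over all words by weight it is
    the real part of (1 + i)^21, namely -1024. *)
Definition g4 (k : nat) : int := if (k %% 4 == 0)%N then 1 else if (k %% 4 == 2)%N then -1 else 0.

Lemma g4_2 k : g4 (k + 2) = - g4 k.
Proof. by rewrite /g4 -(modnDml k 2); have := ltn_pmod k (isT : (0 < 4)%N); case: (k %% 4)%N => [|[|[|[|]]]]. Qed.

Lemma g4_mod k l : (k = l %[mod 4])%N -> g4 k = g4 l.
Proof. by rewrite /g4 => ->. Qed.

Let Q (k : nat) x := (\sum_(i < 21 | (i < k)%N) (x i != 0%R))%N.
Let B k c : int := \sum_(x : bword) g4 (Q k x + c).

Let Q_S (k : 'I_21) x : Q k.+1 x = (Q k x + (x k != 0%R))%N.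
Proof.
rewrite /Q (bigD1 k) //= addnC; congr (_ + _)%N; apply: eq_bigl => i.
by rewrite ltnS ltn_neqAle andbC.
Qed.

Let B_S (k : 'I_21) c : 2 * B k.+1 c = B k c + B k c.+1.
Proof.
pose e : bword := [ffun i => (i == k)%:R].
have Qe x : Q k (x + e) = Q k x.
  apply: eq_bigr => i ik; rewrite !ffunE; have [ike|_] := eqVneq i k; last by rewrite addr0.
  by rewrite ike ltnn in ik.
have ek x : (x + e) k = x k + 1 by rewrite !ffunE eqxx.
have E1 : B k.+1 c = \sum_(x : bword) g4 (Q k.+1 (x + e) + c).
  by rewrite /B (reindex_inj (addIr e)).
have -> : 2 * B k.+1 c = B k.+1 c + \sum_(x : bword) g4 (Q k.+1 (x + e) + c).
  by rewrite -E1; ring.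
rewrite /B -!big_split; apply: eq_bigr => x _ /=.
rewrite !Q_S Qe ek; case: (F2_case (x k)) => -> /=; rewrite addn0 addn1 addSnnS //.
by rewrite addrC.
Qed.

(** Letter by letter as for [gsumE]: four letters contribute (1 + i)^4 = -4, which reads -1/4 in [B]
    because it always sums over full words. *)
Lemma g4_sum : \sum_(x : bword) g4 (wt x) < 0.
Proof.
have B2 k c : B k (c + 2) = - B k c.
  by rewrite -sumrN; apply: eq_bigr => x _; rewrite addnA g4_2.
have step (k : nat) c : (k < 20)%N -> 2 * B k.+2 c = B k c.+1.
  move=> k20; have := B_S (Ordinal (k20 : (k.+1 < 21)%N)) c; have := B_S (Ordinal (leqW k20)) c.
  have := B_S (Ordinal (leqW k20)) c.+1; have := B2 k c; rewrite addn2 => /=; lia.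
have four (k : nat) c : (k < 18)%N -> 4 * B k.+4 c = - B k c.
  move=> k18; have := step k.+2 c; have := step k c.+1; have := B2 k c; rewrite addn2.
  by move=> h1 /(_ ltac:(lia)) h2 /(_ ltac:(lia)) h3; lia.
have B0 c : B 0%N c = #|{: bword}|%:R * g4 c.
  rewrite /B (eq_bigr (fun _ => g4 c)) ?sumr_const ?mulr_natl // => x _.
  by rewrite /Q big_pred0 ?add0n // => i.
have M0 : 0 < #|{: bword}|%:R :> int by rewrite ltr0n; apply/card_gt0P; exists 0.
have -> : \sum_(x : bword) g4 (wt x) = B 21%N 0%N.
  by apply: eq_bigr => x _; rewrite addn0; congr g4; apply: eq_bigl => i; rewrite ltn_ord.
have key c : 1024 * B 20%N c = - (#|{: bword}|%:R * g4 c).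
  have h0 : 4 * B 4%N c = - B 0%N c := four 0%N c isT.
  have h2 : 4 * B 8%N c = - B 4%N c := four 4%N c isT.
  have h4 : 4 * B 12%N c = - B 8%N c := four 8%N c isT.
  have h6 : 4 * B 16%N c = - B 12%N c := four 12%N c isT.
  have h8 : 4 * B 20%N c = - B 16%N c := four 16%N c isT.
  by rewrite -B0; lia.
have h : 2 * B 21%N 0%N = B 20%N 0%N + B 20%N 1%N := B_S (Ordinal (isT : (20 < 21)%N)) 0%N.
have := key 0%N; have := key 1%N; rewrite /g4 /= => k1 k0; lia.
Qed.

(** Adding [z] changes the weight of x by wt z minus twice the overlap. If x is not orthogonal to
    [z] the overlap is odd, so [g4] changes sign and these x cancel. *)
Lemma even_restrict (P : pred bword) z : (wt z %% 4 = 0)%N -> bdot z z = 0 ->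
  (forall x, P (x + z) = P x) ->
  \sum_(x | P x && (bdot x z == 0)) g4 (wt x) = \sum_(x | P x) g4 (wt x).
Proof.
move=> z4 zz Pz; rewrite [RHS](bigID (fun x => bdot x z == 0)) /=.
rewrite -[LHS]addr0; congr (_ + _); apply/esym.
have e : \sum_(x | P x && (bdot x z != 0)) g4 (wt x) = - \sum_(x | P x && (bdot x z != 0)) g4 (wt x).
  rewrite {1}(reindex_inj (addIr z)) /= -sumrN; apply: eq_big => x.
    by rewrite Pz bdotDl zz addr0.
  rewrite bdotDl zz addr0 => /andP[_ xz].
  have o : odd (wt (bmul x z)) by rewrite -bdot_odd; case: (F2_case (bdot x z)) xz => ->.
  rewrite -g4_2; apply: g4_mod; have := wtD x z; move: (wt _) (wt _) (wt _) (wt _) z4 o => a b c d; lia.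
move: e; set u := \sum_(x | _) _ => e; lia.
Qed.

Lemma binary_exists (Z : seq bword) : (forall z, z \in Z -> wt z %% 4 = 0)%N ->
  (forall z z', z \in Z -> z' \in Z -> bdot z z' = 0) ->
  exists s, (wt s %% 4 = 2)%N /\ forall z, z \in Z -> bdot s z = 0.
Proof.
move=> hZ hZZ.
have E : \sum_(x | all (fun z => bdot x z == 0) Z) g4 (wt x) = \sum_x g4 (wt x).
  elim: Z hZ hZZ => [|z Z IH] hZ hZZ; first by apply: eq_bigl.
  rewrite -IH; last first.
  - by move=> u u' uZ uZ'; apply: hZZ; rewrite inE (uZ, uZ') orbT.
  - by move=> u uZ; apply: hZ; rewrite inE uZ orbT.
  rewrite -[RHS](@even_restrict _ z) ?hZ ?hZZ ?mem_head //.
    by apply: eq_bigl => x /=; rewrite andbC.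
  move=> x; apply: eq_in_all => u uZ.
  by rewrite bdotDl (hZZ z u) ?addr0 ?mem_head // inE uZ orbT.
apply: contrapT => h; have := g4_sum; rewrite -E; apply/negP; rewrite -leNgt.
apply: sumr_ge0 => x /allP xZ; rewrite /g4; case: ifP => // _; case: eqP => // e.
by case: h; exists x; split=> // z /xZ /eqP.
Qed.

Definition sg (R : realType) (a : 'F_2) : R := if a == 0 then 1 else -1.

Lemma sgM R (a b : 'F_2) : sg R a * sg R b = sg R (a + b).
Proof. by rewrite /sg; case: (F2_case a) => ->; case: (F2_case b) => -> /=; ring. Qed.

Lemma signed_sum (R : realType) x z :
  \sum_i (z i != 0)%:R * sg R (x i) = (wt z)%:R - 2 * (wt (bmul x z))%:R.
Proof.
rewrite !natr_sum mulr_sumr -sumrB; apply: eq_bigr => i _; rewrite /sg ffunE.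
by case: (F2_case (x i)) => ->; case: (F2_case (z i)) => -> /=; rewrite ?mulr1n ?mulr0n; ring.
Qed.

Lemma sign_sum (R : realType) x : \sum_i sg R (x i) = 21 - 2 * (wt x)%:R.
Proof.
have -> : \sum_i sg R (x i) = \sum_i (1 - 2 * (x i != 0)%:R).
  by apply: eq_bigr => i _; rewrite /sg; case: (F2_case (x i)) => -> /=; rewrite ?mulr1n ?mulr0n; ring.
by rewrite sumrB -mulr_sumr -natr_sum sumr_const card_ord.
Qed.

End Binary.

Lemma pair_partition (V : eqType) (f : V -> V) m (T : seq V) : involutive f -> uniq T -> size T = m.*2 ->
  (forall a, a \in T -> f a \in T /\ f a != a) ->
  exists x : 'I_m -> V, [/\ forall i, x i \in T,
    forall b, b \in T -> exists i, b = x i \/ b = f (x i) &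
    forall i j, i != j -> x i != x j /\ x i != f (x j)].
Proof.
move=> ff; elim: m T => [|m IH] T uT sT hT.
  case: T uT sT {hT} => // _ _; have x0 : 'I_0 -> V by case.
  by exists x0; split=> [[]|b|[]].
have [a aT] : exists a, a \in T by case: (T) sT => // a T' _; exists a; rewrite mem_head.
have [faT fa] := hT a aT.
pose T' := [seq b <- T | b \notin [:: a; f a]].
have T'E b : (b \in T') = (b \notin [:: a; f a]) && (b \in T) by rewrite mem_filter.
have ua : uniq [:: a; f a] by rewrite /= inE eq_sym fa.
have sT' : size T' = m.*2.
  have pT : perm_eq T ([:: a; f a] ++ T').
    apply: uniq_perm => //.
      by rewrite cat_uniq ua filter_uniq // andbT /=; apply/hasPn => b; rewrite T'E => /andP[].
    move=> b; rewrite mem_cat T'E; have [bA|//] := boolP (b \in [:: a; f a]).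
    by move: bA; rewrite !inE => /orP[] /eqP ->.
  by have := perm_size pT; rewrite sT size_cat /= doubleS => -[].
have [|b|x [xT xS xn]] := IH T' _ sT'; first by rewrite filter_uniq.
  rewrite !T'E !inE !negb_or => /andP[/andP[n1 n2] bT]; have [-> ->] := hT b bT.
  by rewrite (inj_eq (inv_inj ff)) n1 (inv_eq ff) n2.
have xN i : x i != a /\ x i != f a by have := xT i; rewrite T'E !inE negb_or => /andP[/andP[]].
exists (fun i => if unlift ord0 i is Some i' then x i' else a); split.
- by move=> i; case: unliftP => // i' _; have := xT i'; rewrite T'E => /andP[].
- move=> b bT; have [bA|bA] := boolP (b \in [:: a; f a]).
    by exists ord0; rewrite unlift_none; move: bA; rewrite !inE => /orP[] /eqP ->; [left|right].
  have [|i hi] := xS b; first by rewrite T'E bA.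
  by exists (lift ord0 i); rewrite liftK.
- move=> i j; case: unliftP => [k ->|->]; case: unliftP => [l ->|->]; rewrite ?eqxx //.
  + by rewrite (inj_eq lift_inj); apply: xn.
  + by have [n1 n2] := xN l => _; split; rewrite eq_sym // (inv_eq ff).
Qed.

(** Parseval's identity. As many orthogonal nonzero vectors as the dimension form a basis because a
    one-sided inverse of a square matrix is two-sided. *)
Lemma orth_frame (R : realType) n (b : 'I_n -> 'rV[R]_n) (d : 'I_n -> R) : (forall i, d i != 0) ->
  (forall i j, dotp (b i) (b j) = if i == j then d i else 0) ->
  forall u v, dotp u v = \sum_i dotp u (b i) * dotp v (b i) / d i.
Proof.
move=> d0 hb u v.
pose B := \matrix_(i < n) b i; pose C := \matrix_(i < n, j < n) (b j 0 i / d j).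
have BC : B *m C = 1%:M.
  apply/matrixP => i j; rewrite !mxE.
  have -> : \sum_k B i k * C k j = dotp (b i) (b j) / d j.
    by rewrite /dotp mulr_suml; apply: eq_bigr => k _; rewrite !mxE mulrA.
  by rewrite hb; case: eqP => [->|_]; rewrite ?divff ?mul0r.
have CB := mulmx1C BC.
have vE : v = \sum_i (dotp v (b i) / d i) *: b i.
  have -> : \sum_i (dotp v (b i) / d i) *: b i = v *m C *m B.
    apply/rowP => k; rewrite summxE !mxE; apply: eq_bigr => i _; rewrite !mxE; congr (_ * _).
    by rewrite /dotp mulr_suml; apply: eq_bigr => j _; rewrite !mxE mulrA.
  by rewrite -mulmxA CB mulmx1.
rewrite {1}vE dotp_sumr; apply: eq_bigr => i _; rewrite dotpZr; ring.
Qed.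

Lemma sum_two_values (R : realType) (p q : R) : p \in [:: 2 / 3; - (1 / 3); - (4 / 3)] -> q \in [:: 2 / 3; - (1 / 3); - (4 / 3)] ->
  [/\ p + q = 4 / 3 -> p = 2 / 3 /\ q = 2 / 3,
   p + q = 1 / 3 -> (p = 2 / 3) \/ (p = - (1 / 3)) &
   p + q != - (8 / 3) -> (p + q - 4 / 3) * (p + q - 1 / 3) * ((p + q + 2 / 3) * (p + q + 5 / 3)) = 0].
Proof.
move=> hp hq; split.
- by move: hp hq; rewrite !inE => /or3P[] /eqP -> /or3P[] /eqP -> e; split; lra.
- move: hp hq; rewrite !inE => /or3P[] /eqP -> /or3P[] /eqP -> e; first [by left|by right|exfalso; lra].
have : p + q \in [:: 4 / 3; 1 / 3; - (2 / 3); - (5 / 3); - (8 / 3)].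
  rewrite !inE; move: hp hq; rewrite !inE => /or3P[] /eqP -> /or3P[] /eqP ->; apply/or4P;
  first [by constructor 1; apply/eqP; lra|by constructor 2; apply/eqP; lra|by constructor 3; apply/eqP; lra|
    constructor 4; apply/orP; first [by left; apply/eqP; lra|by right; apply/eqP; lra]].
rewrite !inE => /or4P[|||/orP[]] /eqP ->; rewrite ?eqxx // => _; lra.
Qed.

Lemma odd_sub1 (p m : nat) : (p + 1 = 2 * m)%N -> odd p. Proof. lia. Qed.

Lemma odd_sub3 (p m : nat) : (p + 3 = 2 * m)%N -> odd p. Proof. lia. Qed.

(** The value of the final vector of the 891 code at a point of [U]: this is where the parity
    condition on the sign word comes from. [int_mod4] plays this role for [W]. *)
Lemma int_odd (R : realType) (m : nat) : odd m -> 3 / 8 * (2 / 3) + 4^-1 * (5%:R - 2 * m%:R) \is a @Num.int R.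
Proof.
move=> om; have -> : m = (2 * m./2 + 1)%N by lia.
have -> : 3 / 8 * (2 / 3) + 4^-1 * (5%:R - 2 * (2 * m./2 + 1)%N%:R) = 1 - (m./2)%:R :> R by rewrite natrD natrM; lra.
by rewrite rpredB ?rpred1 ?rpred_nat.
Qed.

Lemma int_mod4 (R : realType) (m : nat) : (m %% 4 = 2)%N ->
  3 / 8 * - (1 / 3) + 4^-1 * ((21 - 2 * m%:R) / 2) \is a @Num.int R.
Proof.
move=> om; have -> : m = (4 * (m %/ 4) + 2)%N by lia.
move: (m %/ 4)%N => q.
have -> : 3 / 8 * - (1 / 3) + 4^-1 * ((21 - 2 * (4 * q + 2)%N%:R) / 2) = 2 - q%:R :> R by rewrite natrD natrM; lra.
by rewrite rpredB ?rpred_nat.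
Qed.

(** * The code of 891 points *)

Section Code891.
Context {R : realType} (D : seq 'rV[R]_22).
Hypotheses (hD : tight_code 5 (8 / 3) D) (sD : size D = 891%N).

Let norm y : y \in D -> dotp y y = 8 / 3 := tight_norm hD (y := y).

Let ips3 : seq R := [:: 2 / 3; - (1 / 3); - (4 / 3)].

(** Three interior zeros would need degree 6 in [code_values]. Instead the monic cubic vanishing on
    the products is found from its sums against 1, t and t^2. *)
Lemma ips891 y z : y \in D -> z \in D -> y != z -> dotp y z \in ips3.
Proof.
move=> yD zD yz; have [//|a [b [c habc]]] := code_cubic hD.
have S k : \sum_(z <- D) dotp y z ^+ k * (dotp y z ^+ 3 - a * dotp y z ^+ 2 + b * dotp y z - c)
    = (8 / 3) ^+ k * ((8 / 3) ^+ 3 - a * (8 / 3) ^+ 2 + b * (8 / 3) - c).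
  rewrite (sum_code hD (f := fun t => t ^+ k * (t ^+ 3 - a * t ^+ 2 + b * t - c)) yD) //.
  by move=> w wD; rewrite eq_sym => yw; rewrite habc ?mulr0.
have S0 := S 0%N; have S1 := S 1%N; have S2 := S 2%N.
rewrite (eq_bigr (fun w => - c + b * dotp y w + (- a) * dotp y w ^+ 2 + 1 * dotp y w ^+ 3
  + 0 * dotp y w ^+ 4 + 0 * dotp y w ^+ 5)) in S0; last by move=> *; ring.
rewrite (eq_bigr (fun w => 0 + (- c) * dotp y w + b * dotp y w ^+ 2 + (- a) * dotp y w ^+ 3
  + 1 * dotp y w ^+ 4 + 0 * dotp y w ^+ 5)) in S1; last by move=> *; ring.
rewrite (eq_bigr (fun w => 0 + 0 * dotp y w + (- c) * dotp y w ^+ 2 + b * dotp y w ^+ 3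
  + (- a) * dotp y w ^+ 4 + 1 * dotp y w ^+ 5)) in S2; last by move=> *; ring.
rewrite !(sum_deg5 hD) // sD norm // in S0 S1 S2.
have m4 : 891%:R * 3 / (22 * (22 + 2)) * (8 / 3) ^+ 2 * (8 / 3) ^+ 2 = 256 :> R by field.
rewrite m4 in S0 S1 S2.
have aE : a = -1 by lra.
have bE : b = - (2 / 3) by lra.
have cE : c = 8 / 27 by lra.
have /eqP : (dotp y z - 2 / 3) * ((dotp y z + 1 / 3) * (dotp y z + 4 / 3)) = 0.
  by rewrite -[RHS](habc y z yD zD yz) aE bE cE; field.
by rewrite !mulf_eq0 subr_eq0 !addr_eq0 !inE.
Qed.

Lemma vals891 y z : y \in D -> z \in D -> [\/ y = z, dotp y z = 2 / 3, dotp y z = - (1 / 3) | dotp y z = - (4 / 3)].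
Proof.
move=> yD zD; have [->|yz] := eqVneq y z; first by constructor 1.
by have := ips891 yD zD yz; rewrite !inE => /or3P[] /eqP ->; [constructor 2|constructor 3|constructor 4].
Qed.

Variable o : 'rV[R]_22.
Hypothesis oD : o \in D.

Let T := [seq y <- D | dotp o y == - (4 / 3)].

Let TP y : reflect (y \in D /\ dotp o y = - (4 / 3)) (y \in T).
Proof. by rewrite mem_filter andbC; apply: (iffP andP) => -[yD /eqP]. Qed.

Lemma quadratic891 (p q : R) : \sum_(y <- D) (dotp o y - p) * (dotp o y - q) = 288 + 891 * (p * q).
Proof.
rewrite (eq_bigr (fun w => p * q + (- (p + q)) * dotp o w + 1 * dotp o w ^+ 2 + 0 * dotp o w ^+ 3
  + 0 * dotp o w ^+ 4 + 0 * dotp o w ^+ 5)); last by move=> *; ring.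
by rewrite (sum_deg5 hD) // sD norm //; field.
Qed.

Let sT : size T = 42%N.
Proof.
have := quadratic891 (2 / 3) (- (1 / 3)).
rewrite (eq_big_seq (fun y => 6 * (y == o)%:R + 2 * (dotp o y == - (4 / 3))%:R)).
  rewrite big_split /= -!mulr_sumr (sum_mem _ (tight_uniq hD) oD) sum_indicator -/T => e.
  by apply/eqP; rewrite -(eqr_nat R); apply/eqP; lra.
have n1 : ((8 / 3 : R) == - (4 / 3)) = false by apply/eqP; lra.
have n2 : ((2 / 3 : R) == - (4 / 3)) = false by apply/eqP; lra.
have n3 : ((- (1 / 3) : R) == - (4 / 3)) = false by apply/eqP; lra.
move=> y yD; have [->|yo] := eqVneq y o; first by rewrite norm // n1 /= ?mulr1n ?mulr0n; field.
have [e|->|->|->] := vals891 oD yD; first by rewrite e eqxx in yo.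
- by rewrite n2 /= ?mulr1n ?mulr0n; field.
- by rewrite n3 /= ?mulr1n ?mulr0n; field.
- by rewrite eqxx /= ?mulr1n ?mulr0n; field.
Qed.

(** If no code point were opposite to w = o + a, all products with [w] would be zeros of (t - 4/3)(t
    - 1/3)(t + 2/3)(t + 5/3), whose sum over the code is 24. *)
Lemma antipode891 a : a \in T -> - (o + a) \in T.
Proof.
move=> /TP[aD oa]; set w := o + a.
have ww : dotp w w = 8 / 3 by rewrite /w !(dotpDl, dotpDr) !norm // (dotpC a) oa; field.
have ow : dotp o w = 4 / 3 by rewrite /w !dotpDr norm // oa; field.
have [y yD wy] : exists2 y, y \in D & dotp w y = - (8 / 3).
  apply: contrapT => h.
  have := sum_deg5 hD w (40 / 81) (- (22 / 27)) (- (7 / 3)) (2 / 3) 1 0 isT; rewrite sD ww.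
  rewrite (eq_big_seq (fun=> 0)) => [|y yD]; last first.
    transitivity ((dotp w y - 4 / 3) * (dotp w y - 1 / 3) * ((dotp w y + 2 / 3) * (dotp w y + 5 / 3))).
      by field.
    have [->|yo] := eqVneq y o; first by rewrite dotpC ow subrr !mul0r.
    have [->|ya] := eqVneq y a.
      by rewrite (_ : dotp w a = 4 / 3) ?subrr ?mul0r // /w dotpDl oa norm //; field.
    have oy : o != y by rewrite eq_sym.
    have ay : a != y by rewrite eq_sym.
    have [_ _] := sum_two_values (ips891 oD yD oy) (ips891 aD yD ay).
    by rewrite -dotpDl -/w; apply; apply/eqP => e; apply: h; exists y.
  rewrite big1 // => e; suff : (0 : R) = 24 by lra.
  by rewrite [LHS]e; field.
have wE : - w = y by apply: dotp_sub0; rewrite !(dotpNl, dotpNr) ?opprK ?ww ?wy ?norm ?opprK.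
by apply/TP; rewrite dotpNr ow wE.
Qed.

(** The products of a point x of [T] with the two members of another pair sum to - o.x = 4/3, so
    both are 2/3. Adding o/2 projects orthogonally to [o] and makes the two members of a pair
    opposite. *)
Lemma pairs891 : exists x : 'I_21 -> 'rV[R]_22, [/\ forall i, x i \in T,
  forall b, b \in T -> exists i, b = x i \/ b = - (o + x i) &
  forall i j, dotp (x i + 2^-1 *: o) (x j + 2^-1 *: o) = if i == j then 2 else 0].
Proof.
have [|a aT|x [xT xS xn]] := @pair_partition _ (fun b => - (o + b)) 21 T _ (filter_uniq _ (tight_uniq hD)) sT.
- by move=> b; rewrite opprD opprK addrC addrA addNr add0r || (rewrite opprD opprK addKr).
- have aT' := antipode891 aT; split=> //; have /TP[aD oa] := aT.
  apply/eqP => e; have : dotp (- (o + a)) a = dotp a a by rewrite e.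
  by rewrite dotpNl dotpDl oa !norm //; lra.
exists x; split=> // i j.
have /TP[xD xo] := xT i; have /TP[xD' xo'] := xT j.
rewrite !(dotpDl, dotpDr) !(dotpZl, dotpZr) norm // (dotpC (x i) o) xo xo'.
have [<-|ij] := eqVneq i j; first by rewrite norm //; lra.
have [n1 n2] := xn i j ij; have /TP[xD'' _] := antipode891 (xT j).
have [h _ _] := sum_two_values (ips891 xD xD' n1) (ips891 xD xD'' n2).
have [|-> _] := h; last by lra.
by rewrite dotpNr dotpDr (dotpC (x i) o) xo; lra.
Qed.

Lemma nonempty891 : exists2 w, w \in D & dotp o w = - (1 / 3).
Proof.
apply: contrapT => h; have := quadratic891 (2 / 3) (- (4 / 3)).
rewrite (sum_code hD (f := fun t => (t - 2 / 3) * (t - - (4 / 3))) oD); first by lra.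
move=> z zD; rewrite eq_sym => oz; have := ips891 oD zD oz; rewrite !inE => /or3P[] /eqP e.
- by rewrite e subrr mul0r.
- by case: h; exists z.
- by rewrite e subrr mulr0.
Qed.

Let even_dot x z : (wt x %% 4 = 0)%N -> (wt z %% 4 = 0)%N -> (wt (x + z)%R %% 4 = 0)%N -> bdot x z = 0.
Proof.
move=> x4 z4 xz4; have e := wtD x z; have : ~~ odd (wt (bmul x z)) by lia.
by rewrite -bdot_odd; case: (F2_case (bdot x z)) => ->.
Qed.

Let bdot1 x z : odd (wt (bmul x z)) -> bdot x z = 1.
Proof. by rewrite -bdot_odd => /eqP. Qed.

Let wt0 : wt 0 = 0%N.
Proof. by rewrite /wt big1 // => i _; rewrite ffunE. Qed.

(* The sign pattern sought: relative to the word [A0], the words become doubly even,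
   and adjoining the sums [S z + S0] and the complement of [S0] keeps the system doubly even. *)
Let sign_pattern (K : eqType) (W U : seq K) (A N S : K -> bword) w0 : w0 \in W ->
  (forall z z', z \in W -> z' \in W -> wt (A z + A z')%R %% 4 = 0)%N ->
  (forall z w, z \in U -> w \in W -> bdot (N z + A w) (S z) = 1) ->
  (forall z, z \in U -> wt (S z) = 5%N) ->
  (forall z z', z \in U -> z' \in U -> odd (wt (bmul (S z) (S z')))) ->
  exists t : bword, (forall z, z \in W -> wt (t + A z)%R %% 4 = 2)%N /\
    forall z, z \in U -> bdot (t + N z) (S z) = 1.
Proof.
move=> w0W AA NA S5 SS.
have cc (a b c : bword) : a + c + (b + c) = a + b by rewrite addrACA bword_addxx addr0.
pose LA := [seq A z + A w0 | z <- W].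
have LA4 x : x \in LA -> (wt x %% 4 = 0)%N by move=> /mapP[z zW ->]; apply: AA.
have LAA x y : x \in LA -> y \in LA -> bdot x y = 0.
  move=> xL yL; apply: even_dot; [exact: LA4|exact: LA4|].
  move: xL yL => /mapP[z zW ->] /mapP[z' zW' ->].
  by rewrite addrACA bword_addxx addr0 AA.
have AS x z : x \in LA -> z \in U -> bdot x (S z) = 0.
  move=> /mapP[w wW ->] zU.
  have := NA z w zU wW; have := NA z w0 zU w0W; rewrite !bdotDl => e1 e2.
  have -> : bdot (A w) (S z) + bdot (A w0) (S z) =
     (bdot (N z) (S z) + bdot (A w) (S z)) + (bdot (N z) (S z) + bdot (A w0) (S z)).
    by rewrite addrACA F2_addxx add0r.
  by rewrite e1 e2 F2_addxx.
pose one : bword := [ffun=> 1].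
have one_mul x : bmul x one = x by apply/ffunP => i; rewrite !ffunE mulr1.
have oneD x : bdot x one = 0 <-> ~~ odd (wt x).
  by rewrite -[in odd _](one_mul x) -bdot_odd; case: (F2_case (bdot x one)) => ->.
have mul_one x : bmul one x = x by apply/ffunP => i; rewrite !ffunE mul1r.
have wone : wt one = 21%N by rewrite /wt (eq_bigr (fun=> 1%N)) ?sum_nat_const ?card_ord // => i _; rewrite ffunE.
have one4 z : z \in U -> (wt (one + S z)%R %% 4 = 0)%N.
  by move=> zU; have := wtD one (S z); rewrite mul_one S5 // wone; move: (wt _) => a; lia.
have SS4 z z' : z \in U -> z' \in U -> (wt (S z + S z')%R %% 4 = 0)%N.
  by move=> zU zU'; have := wtD (S z) (S z'); have := SS z z' zU zU'; rewrite !S5 //; lia.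
have [t [t2 tA tS]] : exists t, [/\ (wt t %% 4 = 2)%N, forall x, x \in LA -> bdot t x = 0 &
    forall z, z \in U -> bdot t (S z) = 0].
  have [[u0 uU]|no] := pselect (exists u0, u0 \in U); last first.
    have [t [t2 tA]] := binary_exists LA4 LAA; exists t; split=> // z zU; by case: no; exists z.
  pose LS := (one + S u0) :: [seq S z + S u0 | z <- U].
  have LS4 x : x \in LS -> (wt x %% 4 = 0)%N.
    by rewrite inE => /predU1P[->|/mapP[z zU ->]]; [apply: one4|apply: SS4].
  have LSS x y : x \in LS -> y \in LS -> bdot x y = 0.
    move=> xL yL; apply: even_dot; [exact: LS4|exact: LS4|].
    move: xL yL; rewrite !inE => /predU1P[->|/mapP[z zU ->]] /predU1P[->|/mapP[z' zU' ->]];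
      rewrite cc ?bword_addxx ?wt0 //; [exact: one4|by rewrite addrC one4|exact: SS4].
  have LAS x y : x \in LA -> y \in LS -> bdot x y = 0.
    move=> xL; rewrite inE => /predU1P[->|/mapP[z zU ->]]; rewrite bdotDr !AS // addr0 //.
    by apply/oneD; have := LA4 x xL; clear; lia.
  have [||t [t2 tL]] := @binary_exists (LA ++ LS).
  - by move=> x; rewrite mem_cat => /orP[/LA4|/LS4].
  - move=> x y; rewrite !mem_cat => /orP[] xL /orP[] yL; [exact: LAA|exact: LAS| |exact: LSS].
    by rewrite bdotC LAS.
  have tone : bdot t one = 0 by apply/oneD; move: t2; clear; lia.
  have tu : bdot t (S u0) = 0.
    by have := tL (one + S u0); rewrite mem_cat inE eqxx orbT bdotDr tone add0r; apply.
  exists t; split=> // [x xL|z zU]; first by apply: tL; rewrite mem_cat xL.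
  have := tL (S z + S u0); rewrite bdotDr tu addr0; apply.
  by rewrite mem_cat inE; apply/orP; right; apply/orP; right; apply/mapP; exists z.
exists (t + A w0); split=> z zW.
  have zL : A z + A w0 \in LA by apply/mapP; exists z.
  have := wtD t (A z + A w0); have := LA4 _ zL; have := tA _ zL => /bdot0_even.
  have -> : t + A w0 + A z = t + (A z + A w0) by rewrite -addrA (addrC (A w0)).
  by move: (wt _) (wt _) (wt (bmul _ _)) (wt t) t2; clear => a b c d; lia.
by rewrite -addrA (addrC (A w0)) bdotDl tS // NA // add0r.
Qed.

Lemma few_values891 : few_values 3 D.
Proof.
have [x [xT xS XX]] := pairs891.
pose X i := x i + 2^-1 *: o.
have oX i : dotp o (X i) = 0.
  by have /TP[_ ox] := xT i; rewrite dotpDr dotpZr norm // ox; lra.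
(* Together [o] and the 21 vectors [X i] form an orthogonal basis of the 22-dimensional space. *)
have pars (u v : 'rV[R]_22) : dotp u v = 3 / 8 * (dotp u o * dotp v o) + 2^-1 * \sum_i dotp u (X i) * dotp v (X i).
  pose b (i : 'I_22) := if unlift ord0 i is Some j then X j else o.
  pose d (i : 'I_22) : R := if unlift ord0 i is Some j then 2 else 8 / 3.
  rewrite (@orth_frame R 22 b d).
  - rewrite big_ord_recl /b /d unlift_none [X in _ = _ + X]mulr_sumr; congr (_ + _); first by field.
    by apply: eq_bigr => i _; rewrite liftK; field.
  - by move=> i; rewrite /d; case: unliftP => *; apply/eqP; lra.
  move=> i j; rewrite /b /d; case: unliftP => [k ->|->]; case: unliftP => [l ->|->].
  - by rewrite (inj_eq lift_inj) XX.
  - by rewrite dotpC oX eq_sym (negbTE (neq_lift _ _)).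
  - by rewrite oX (negbTE (neq_lift _ _)).
  - by rewrite eqxx norm.
pose W := [seq z <- D | dotp o z == - (1 / 3)]; pose U := [seq z <- D | dotp o z == 2 / 3].
have WP z : z \in W -> z \in D /\ dotp z o = - (1 / 3).
  by rewrite mem_filter dotpC => /andP[/eqP].
have UP z : z \in U -> z \in D /\ dotp z o = 2 / 3.
  by rewrite mem_filter dotpC => /andP[/eqP].
(* Points of [W] have frame products 1/2 or -1/2, with signs recorded by [A]; points of [U] have 0,
   1 or -1, with support [S] and signs [N]. *)
pose A z : bword := [ffun i => if dotp z (x i) == 2 / 3 then 0 else 1].
pose S z : bword := [ffun i => if dotp z (x i) == - (1 / 3) then 0 else 1].
pose N z : bword := [ffun i => if dotp z (x i) == - (4 / 3) then 1 else 0].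
have n12 : ((- (1 / 3) : R) == 2 / 3) = false by apply/eqP; lra.
have n13 : ((- (1 / 3) : R) == - (4 / 3)) = false by apply/eqP; lra.
have n21 : ((2 / 3 : R) == - (1 / 3)) = false by apply/eqP; lra.
have n23 : ((2 / 3 : R) == - (4 / 3)) = false by apply/eqP; lra.
have n31 : ((- (4 / 3) : R) == - (1 / 3)) = false by apply/eqP; lra.
have neT z a : z \in D -> a \in T -> dotp z o != - (4 / 3) -> z != a.
  by move=> zD /TP[_ oa]; apply: contra_neq => ->; rewrite dotpC.
have WX z i : z \in W -> dotp z (X i) = sg R (A z i) / 2.
  move=> /WP[zD zo]; have zT : dotp z o != - (4 / 3) by rewrite zo n13.
  have aT := xT i; have aT' := antipode891 aT; have /TP[aD _] := aT; have /TP[aD' _] := aT'.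
  have [_ h _] := sum_two_values (ips891 zD aD (neT z _ zD aT zT)) (ips891 zD aD' (neT z _ zD aT' zT)).
  rewrite /X dotpDr dotpZr zo ffunE /sg.
  have [|->|->] := h; first by rewrite dotpNr dotpDr zo; lra.
    by rewrite eqxx /=; lra.
  by rewrite n12 /=; lra.
have UX z i : z \in U -> dotp z (X i) = (S z i != 0)%:R * sg R (N z i).
  move=> /UP[zD zo]; have zT : dotp z o != - (4 / 3) by rewrite zo n23.
  have aT := xT i; have /TP[aD _] := aT.
  have := ips891 zD aD (neT z _ zD aT zT).
  rewrite /X dotpDr dotpZr zo !ffunE /sg !inE => /or3P[] /eqP ->.
  - by rewrite n21 n23 /= ?mulr1n ?mulr0n; lra.
  - by rewrite eqxx n13 /= ?mulr1n ?mulr0n; lra.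
  - by rewrite eqxx n31 /= ?mulr1n ?mulr0n; lra.
move: A S N WX UX => A S N WX UX.
have cast (m k : nat) : m%:R = k%:R :> R -> m = k by move/eqP; rewrite eqr_nat => /eqP.
have signA (s : bword) z : z \in W -> \sum_i sg R (s i) * dotp z (X i) = (21 - 2 * (wt (s + A z)%R)%:R) / 2.
  move=> zW; rewrite -sign_sum mulr_suml; apply: eq_bigr => i _.
  by rewrite WX // mulrA sgM ffunE.
have signU (s : bword) z : z \in U -> \sum_i sg R (s i) * dotp z (X i) = (wt (S z))%:R - 2 * (wt (bmul (s + N z) (S z)))%:R.
  move=> zU; rewrite -signed_sum; apply: eq_bigr => i _.
  by rewrite UX // mulrCA sgM ffunE.
have AA z z' : z \in W -> z' \in W -> (wt (A z + A z')%R %% 4 = 0)%N.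
  move=> zW zW'; have [zD zo] := WP z zW; have [zD' zo'] := WP z' zW'.
  have [->|zz] := eqVneq z z'; first by rewrite bword_addxx wt0.
  have := pars z z'; rewrite zo zo'.
  have -> : \sum_i dotp z (X i) * dotp z' (X i) = 2^-1 * \sum_i sg R (A z i) * dotp z' (X i).
    by rewrite mulr_sumr; apply: eq_bigr => i _; rewrite (WX z) //; ring.
  rewrite signA // => e.
  have := ips891 zD zD' zz; rewrite !inE => /or3P[] /eqP e'; rewrite e' in e.
  - by rewrite (cast (wt (A z + A z')) 8%N) //; lra.
  - by rewrite (cast (wt (A z + A z')) 12%N) //; lra.
  - by rewrite (cast (wt (A z + A z')) 16%N) //; lra.
have S5 z : z \in U -> wt (S z) = 5%N.
  move=> zU; have [zD zo] := UP z zU.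
  have := pars z z; rewrite zo norm //.
  have -> : \sum_i dotp z (X i) * dotp z (X i) = (wt (S z))%:R.
    rewrite natr_sum; apply: eq_bigr => i _; rewrite UX // mulrACA sgM F2_addxx /sg eqxx mulr1.
    by case: (_ != _); rewrite /= ?mulr1n ?mulr0n ?mulr1 ?mulr0.
  by move=> e; apply: cast; lra.
have NA z w : z \in U -> w \in W -> bdot (N z + A w) (S z) = 1.
  move=> zU wW; have [zD zo] := UP z zU; have [wD wo] := WP w wW; apply: bdot1.
  have := pars w z; rewrite wo zo.
  have -> : \sum_i dotp w (X i) * dotp z (X i) = 2^-1 * \sum_i sg R (A w i) * dotp z (X i).
    by rewrite mulr_sumr; apply: eq_bigr => i _; rewrite (WX w) //; ring.
  rewrite signU // S5 // (addrC (N z)) => e.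
  have wz : w != z by apply/eqP => wz; move: wo; rewrite wz zo; lra.
  have := ips891 wD zD wz; rewrite !inE => /or3P[] /eqP e'; rewrite e' in e.
  - by rewrite (cast (wt (bmul (A w + N z) (S z))) 1%N) //; lra.
  - by rewrite (cast (wt (bmul (A w + N z) (S z))) 3%N) //; lra.
  - by rewrite (cast (wt (bmul (A w + N z) (S z))) 5%N) //; lra.
have SS z z' : z \in U -> z' \in U -> odd (wt (bmul (S z) (S z'))).
  move=> zU zU'; have [zD zo] := UP z zU; have [zD' zo'] := UP z' zU'.
  have := pars z z'; rewrite zo zo'.
  have -> : \sum_i dotp z (X i) * dotp z' (X i) =
      (wt (bmul (S z) (S z')))%:R - 2 * (wt (bmul (N z + N z') (bmul (S z) (S z'))))%:R.
    rewrite -signed_sum; apply: eq_bigr => i _; rewrite !UX // mulrACA sgM !ffunE.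
    by case: (F2_case (S z i)) => ->; case: (F2_case (S z' i)) => -> /=; rewrite ?mulr1n ?mulr0n ?mulr0 ?mul0r ?mulr1.
  move: (wt _) (wt _) => m p e.
  have [zz|zz|zz|zz] : [\/ dotp z z' = 8 / 3, dotp z z' = 2 / 3, dotp z z' = - (1 / 3) | dotp z z' = - (4 / 3)].
    have [->|zz] := eqVneq z z'; first by constructor 1; rewrite norm.
    by have := ips891 zD zD' zz; rewrite !inE => /or3P[] /eqP ->; [constructor 2|constructor 3|constructor 4].
  - suff -> : p = (2 * m + 5)%N by rewrite oddD oddM.
    by apply: cast; rewrite natrD natrM; lra.
  - suff -> : p = (2 * m + 1)%N by rewrite oddD oddM.
    by apply: cast; rewrite natrD natrM; lra.
  - by apply: (@odd_sub1 _ m); apply: cast; rewrite natrD natrM; lra.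
  - by apply: (@odd_sub3 _ m); apply: cast; rewrite natrD natrM; lra.
have [w0 w0D w0o] := nonempty891.
have w0W : w0 \in W by rewrite mem_filter w0o eqxx.
have [t [tA tS]] := sign_pattern w0W AA NA S5 SS.
(* Chosen to have product 1 with [o] and products 1/2 or -1/2, with signs [t], on the frame. The two
   conditions on [t] are what makes the products with [W] and [U] integers, and the norm 3 equates
   the second and fourth moments. *)
pose v := (3 / 8) *: o + 4^-1 *: \sum_i sg R (t i) *: X i.
have vo : dotp v o = 1.
  rewrite /v dotpDl !dotpZl norm // dotp_suml big1 ?mulr0 ?addr0; first by field.
  by move=> i _; rewrite dotpZl dotpC oX mulr0.
have vX i : dotp v (X i) = sg R (t i) / 2.
  rewrite /v dotpDl !dotpZl oX mulr0 add0r dotp_suml (bigD1 i) //= big1 => [|j ji].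
    by rewrite dotpZl XX eqxx; lra.
  by rewrite dotpZl XX (negbTE ji) mulr0.
have vu u : dotp v u = 3 / 8 * dotp u o + 4^-1 * \sum_i sg R (t i) * dotp u (X i).
  rewrite pars vo mul1r; congr (_ + _); rewrite !mulr_sumr; apply: eq_bigr => i _.
  by rewrite vX; lra.
have vv : dotp v v = 3.
  rewrite vu vo.
  have -> : \sum_i sg R (t i) * dotp v (X i) = 21 / 2.
    rewrite (eq_bigr (fun=> 2^-1)); first by rewrite sumr_const card_ord; lra.
    by move=> i _; rewrite vX mulrA sgM F2_addxx /sg eqxx mul1r.
  by lra.
have vI y : y \in D -> dotp v y \is a Num.int.
  move=> yD.
  have vx i : dotp v (x i) = 0 \/ dotp v (x i) = -1.
    have -> : x i = X i - 2^-1 *: o by rewrite addrK.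
    rewrite dotpBr dotpZr vo vX /sg; by case: (t i == 0); [left|right]; lra.
  have [->|oy|oy|oy] := vals891 yD oD.
  - by rewrite vo rpred1.
  - have yU : y \in U by rewrite mem_filter dotpC oy eqxx.
    by have := tS y yU => /eqP; rewrite bdot_odd vu oy signU // S5 //; apply: int_odd.
  - have yW : y \in W by rewrite mem_filter dotpC oy eqxx.
    by rewrite vu oy signA //; apply: int_mod4; exact: tA.
  have yT : y \in T by apply/TP; rewrite dotpC.
  have [i [->|->]] := xS y yT.
    by have [->|->] := vx i; rewrite ?rpredN ?rpred0 ?rpred1.
  by rewrite dotpNr dotpDr vo rpredN rpredD ?rpred1 //; have [->|->] := vx i; rewrite ?rpredN ?rpred0 ?rpred1.
exists v; first by rewrite -dotp_eq0 vv; apply/eqP; lra.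
exists [:: 0; 1; -1] => // y yD.
have S0 : \sum_(y <- D) (dotp v y ^+ 2 * (dotp v y ^+ 2 - 1)) = 0.
  rewrite (eq_bigr (fun w => 0 + 0 * dotp v w + (-1) * dotp v w ^+ 2 + 0 * dotp v w ^+ 3
    + 1 * dotp v w ^+ 4 + 0 * dotp v w ^+ 5)); last by move=> *; ring.
  by rewrite (sum_deg5 hD) // sD vv; field.
have e0 := psumr_seq_eq0 (fun y yD => int_quartic_ge0 (vI y yD)) S0 yD.
have /eqP : (dotp v y * dotp v y) * ((dotp v y - 1) * (dotp v y + 1)) = 0 by rewrite -[RHS]e0; ring.
by rewrite !mulf_eq0 orbb subr_eq0 addr_eq0 !inE.
Qed.

End Code891.

(** * Regular polygons *)

Section Polygon.
Context {R : realType}.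

Definition vec (a : R) : 'rV[R]_2 := \row_(i < 2) (if i == 0 then cos a else sin a).

Lemma dotp_vec a b : dotp (vec a) (vec b) = cos (a - b).
Proof. by rewrite /dotp !big_ord_recl big_ord0 !mxE /= addr0 cosB. Qed.

Lemma unit_vec (y : 'rV[R]_2) : dotp y y = 1 -> exists a, y = vec a.
Proof.
rewrite /dotp !big_ord_recl big_ord0 addr0; set i1 := lift ord0 ord0; set c := y 0 ord0; set s := y 0 i1 => e.
have c1 : -1 <= c <= 1.
  have : c ^+ 2 <= 1 by have := sqr_ge0 s; rewrite !expr2; lra.
  by move=> h; apply/andP; split; nra.
have ca : cos (acos c) = c by rewrite acosK // in_itv.
have sa : sin (acos c) = `|s|.
  rewrite sin_acos // -sqrtr_sqr; congr Num.sqrt; rewrite !expr2; lra.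
have ext a : cos a = c -> sin a = s -> y = vec a.
  move=> ea eb; apply/rowP => i; rewrite !mxE; case: (unliftP ord0 i) => [j|] -> /=.
    by rewrite (ord1 j) eb.
  by rewrite ea.
have [s0|s0] := leP 0 s; first by exists (acos c); apply: ext => //; rewrite sa ger0_norm.
by exists (- acos c); apply: ext; rewrite ?cosN ?sinN // sa ltr0_norm // opprK.
Qed.

Fixpoint cheb (m : nat) : {poly R} :=
  match m with 0 => 1 | m'.+1 => match m' with 0 => 'X | m''.+1 => 'X *+ 2 * cheb m' - cheb m'' end end.

Lemma size_cheb m : size (cheb m) = m.+1.
Proof.
suff: size (cheb m) = m.+1 /\ size (cheb m.+1) = m.+2 by case.
elim: m => [|m [IH1 IH2]]; first by rewrite size_poly1 size_polyX.
split=> //; rewrite -[cheb m.+2]/('X *+ 2 * cheb m.+1 - cheb m).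
have X2 : size ('X *+ 2 : {poly R}) = 2 by rewrite -scaler_nat size_scale ?size_polyX // pnatr_eq0.
have c0 : cheb m.+1 != 0 by rewrite -size_poly_eq0 IH2.
have s : size ('X *+ 2 * cheb m.+1) = m.+3.
  by rewrite size_mul ?X2 ?IH2 // -size_poly_eq0 X2.
by rewrite size_polyDl s // size_polyN IH1; lia.
Qed.

Lemma cheb_cos m a : (cheb m).[cos a] = cos (m%:R * a).
Proof.
suff: (cheb m).[cos a] = cos (m%:R * a) /\ (cheb m.+1).[cos a] = cos (m.+1%:R * a) by case.
elim: m => [|m [IH1 IH2]]; first by rewrite hornerC hornerX mul0r cos0 mul1r.
split=> //; rewrite -[cheb m.+2]/('X *+ 2 * cheb m.+1 - cheb m).
rewrite hornerD hornerN hornerM hornerMn hornerX IH1 IH2.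
have -> : m%:R * a = m.+1%:R * a - a by rewrite -[m.+1]addn1 natrD; ring.
have -> : m.+2%:R * a = m.+1%:R * a + a by rewrite -[m.+2]addn1 natrD; ring.
by rewrite cosB cosD; ring.
Qed.

(** The real part of z^M - 1 = (z - 1)(1 + z + ... + z^(M-1)) for z = e^(ia). *)
Lemma geometric_cos M (a : R) : cos (M%:R * a) - 1 =
  (cos a - 1) * (\sum_(j < M) cos (j%:R * a)) - sin a * (\sum_(j < M) sin (j%:R * a)).
Proof.
elim: M => [|M IH]; first by rewrite !big_ord0 mul0r cos0; ring.
rewrite !big_ord_recr /= !mulrDr opprD addrACA -IH.
by rewrite -[M.+1]addn1 natrD mulrDl mul1r cosD; ring.
Qed.

Section Design.
Variables (tau : nat) (C : seq 'rV[R]_2).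
Hypotheses (C0 : (0 < size C)%N) (hC : spherical_design tau C).

(** Turning the direction by pi/m changes the sign of every term, while the sum over a design is the
    same for all directions. *)
Lemma design_cos_sum (m : nat) b : (0 < m <= tau)%N ->
  \sum_(y <- C) (cheb m).[dotp (vec b) y] = 0.
Proof.
move=> /andP[m0 mt].
have v1 a : dotp (vec a) (vec a) = 1 by rewrite dotp_vec subrr cos0.
have S a : \sum_(y <- C) (cheb m).[dotp (vec a) y] = (size C)%:R * Emom 2 (cheb m).
  by rewrite (sum_poly _ C0 hC) // size_cheb.
have e : \sum_(y <- C) (cheb m).[dotp (vec (b + pi / m%:R)) y] = - \sum_(y <- C) (cheb m).[dotp (vec b) y].
  rewrite -sumrN; apply: eq_big_seq => y yC.
  have [a ->] := unit_vec (design_unit hC yC); rewrite !dotp_vec !cheb_cos.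
  have -> : m%:R * (b + pi / m%:R - a) = m%:R * (b - a) + pi.
    by rewrite !(mulrBr, mulrDr) [m%:R * (pi / _)]mulrC divfK ?pnatr_eq0 -?lt0n // addrAC.
  by rewrite cosDpi.
by move: e; rewrite !S => e; lra.
Qed.

(** With M = 2k, the squared modulus of the sum of e^(ij psi) over j < M totals M^2 over the code,
    since the frequencies j - l are at most [tau] in absolute value. The point [y0], at psi = 0,
    accounts for all of it, so the other geometric sums vanish and M psi is a multiple of 2 pi.
    Turning [y0] by half a step, pi/(2k), changes cos (k psi) into sin (k psi), which is 0. *)
Lemma zero_polygon k : uniq C -> tau = k.*2.-1 -> size C = k.*2 -> (0 < k)%N ->
  exists2 x, dotp x x = 1 & forall y, y \in C -> (cheb k).[dotp x y] = 0.
Proof.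
move=> uC tE sC k0.
have [y0 y0C] : exists y, y \in C by case: (C) C0 => // y C' _; exists y; rewrite mem_head.
have [b y0E] := unit_vec (design_unit hC y0C).
have [ang [hang ang0]] : exists ang : 'rV[R]_2 -> R, (forall y, y \in C -> y = vec (ang y)) /\ ang y0 = b.
  have : forall y, exists a, (y \in C -> y = vec a) /\ (y = y0 -> a = b).
    move=> y; have [->|n] := eqVneq y y0; first by exists b.
    have [yC|_] := boolP (y \in C); last by exists 0; split=> // e; rewrite e eqxx in n.
    have [a e] := unit_vec (design_unit hC yC); exists a; split=> // e'.
    by rewrite e' eqxx in n.
  by move=> /choice[ang h]; exists ang; split=> [y|]; [case: (h y)|case: (h y0) => _; apply].
pose psi y := b - ang y.
have S0 (m : nat) : (0 < m <= tau)%N -> \sum_(y <- C) cos (m%:R * psi y) = 0.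
  move=> mt; rewrite -[RHS](design_cos_sum b mt); apply: eq_big_seq => y yC.
  by rewrite {2}(hang y yC) dotp_vec cheb_cos.
pose M := k.*2.
pose Cs y := \sum_(j < M) cos (j%:R * psi y); pose Sn y := \sum_(j < M) sin (j%:R * psi y).
have fejer : \sum_(y <- C) (Cs y ^+ 2 + Sn y ^+ 2) = M%:R ^+ 2.
  have -> : \sum_(y <- C) (Cs y ^+ 2 + Sn y ^+ 2) =
     \sum_(j < M) \sum_(l < M) \sum_(y <- C) cos (j%:R * psi y - l%:R * psi y).
    rewrite [RHS](eq_bigr (fun j : 'I_M => \sum_(y <- C) \sum_(l < M) cos (j%:R * psi y - l%:R * psi y))); last first.
      by move=> j _; rewrite exchange_big.
    rewrite [RHS]exchange_big /=; apply: eq_bigr => y _.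
    rewrite !expr2 {1}/Cs {1}/Sn !mulr_suml -big_split; apply: eq_bigr => j _ /=.
    rewrite !mulr_sumr -big_split; apply: eq_bigr => l _ /=.
    by rewrite cosB.
  rewrite (eq_bigr (fun _ : 'I_M => M%:R)); first by rewrite sumr_const card_ord expr2 mulr_natr.
  move=> j _; rewrite (bigD1 j) //= [X in _ + X]big1 => [|l lj].
    rewrite addr0 (eq_bigr (fun=> 1)); last by move=> y _; rewrite subrr cos0.
    by rewrite /M -sC -sum1_size natr_sum.
  have d (p q : 'I_M) : (p < q)%N -> \sum_(y <- C) cos (q%:R * psi y - p%:R * psi y) = 0.
    move=> pq; rewrite -[RHS](S0 (q - p)%N); last first.
      have qM : (q < k.*2)%N := ltn_ord q.
      move: pq qM tE k0; move: (q : nat) (p : nat); clear; lia.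
    by apply: eq_bigr => y _; rewrite natrB ?mulrBl // ltnW.
  have := lj; rewrite neq_ltn => /orP[lt|gt]; first exact: d.
  by rewrite -[RHS](d _ _ gt); apply: eq_bigr => y _; rewrite -opprB cosN.

have psi0 : psi y0 = 0 by rewrite /psi ang0 subrr.
have y0val : Cs y0 ^+ 2 + Sn y0 ^+ 2 = M%:R ^+ 2.
  rewrite /Cs /Sn psi0 (eq_bigr (fun=> 1)) => [|j _]; last by rewrite mulr0 cos0.
  rewrite [in X in _ + X]big1 => [|j _]; last by rewrite mulr0 sin0.
  by rewrite sumr_const card_ord expr0n addr0.
have null y : y \in C -> y != y0 -> Cs y = 0 /\ Sn y = 0.
  move=> yC yy0; move: fejer; rewrite (big_rem y0) //= y0val -[RHS]addr0 => /addrI e.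
  have yr : y \in rem y0 C by rewrite (mem_rem_uniq _ uC) inE yy0.
  have := psumr_seq_eq0 (fun y _ => addr_ge0 (sqr_ge0 (Cs y)) (sqr_ge0 (Sn y))) e yr.
  by move/eqP; rewrite paddr_eq0 ?sqr_ge0 // !sqrf_eq0 => /andP[/eqP -> /eqP ->].
have cM y : y \in C -> cos (M%:R * psi y) = 1.
  move=> yC; have [->|yy0] := eqVneq y y0; first by rewrite psi0 mulr0 cos0.
  have [c s] := null y yC yy0; apply/eqP; rewrite -subr_eq0 geometric_cos.
  by rewrite -/(Cs y) -/(Sn y) c s !mulr0 subr0.
have sk y : y \in C -> sin (k%:R * psi y) = 0.
  move=> /cM; rewrite (_ : M%:R * psi y = k%:R * psi y + k%:R * psi y); last first.
    by rewrite /M -addnn natrD mulrDl.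
  rewrite cosD => e; apply/eqP; rewrite -sqrf_eq0; apply/eqP.
  by have := cos2Dsin2 (k%:R * psi y); rewrite !expr2 in e *; lra.
exists (vec (b - pi / 2 / k%:R)); first by rewrite dotp_vec subrr cos0.
move=> y yC; rewrite (hang y yC) dotp_vec cheb_cos.
have -> : k%:R * (b - pi / 2 / k%:R - ang y) = k%:R * psi y - pi / 2.
  by rewrite /psi !mulrBr [k%:R * (pi / 2 / _)]mulrC divfK ?pnatr_eq0 -?lt0n // addrAC.
by rewrite cosB cos_pihalf sin_pihalf sk // mulr0 mul0r addr0.
Qed.

End Design.
End Polygon.

(** * Assembly over the list of parameters *)

Lemma few_values_size891 (R : realType) (D : seq 'rV[R]_22) : tight_code 5 (8 / 3) D -> size D = 891%N -> few_values 3 D.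
Proof.
move=> hD sD; have [z zD] : exists z, z \in D by case: (D) sD => // z D' _; exists z; rewrite mem_head.
exact: (few_values891 hD sD zD).
Qed.

Lemma few_values_size112 (R : realType) (D : seq 'rV[R]_21) : tight_code 3 (9 / 4) D -> size D = 112%N -> few_values 2 D.
Proof.
move=> hD sD; have [z zD] : exists z, z \in D by case: (D) sD => // z D' _; exists z; rewrite mem_head.
exact: (few_values112 hD sD zD).
Qed.

Lemma few_values_size552 (R : realType) (D : seq 'rV[R]_23) : tight_code 5 5 D -> size D = 552%N -> few_values 3 D.
Proof.
move=> hD sD; have [e [eD ee]] := three552 hD sD.
exact: (few_values552 hD sD eD ee (erefl _)).
Qed.

Lemma few_values_rescale (R : realType) n N tau k (s : R) (C : seq 'rV[R]_n) : (2 <= n)%N -> (0 < N)%N -> 0 < s ->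
  sharp_code N tau C -> (forall D : seq 'rV[R]_n, tight_code tau s D -> size D = N -> few_values k D) -> few_values k C.
Proof.
move=> n2 N0 s0 hC h; have sC : size C = N by case: hC => _ [].
apply: (@few_values_scale _ _ _ s) => //; apply: h; last by rewrite size_map.
by apply: tight_code_scale; rewrite ?sC.
Qed.

Lemma sharp_zero (R : realType) n N tau (C : seq 'rV[R]_n) (P : {poly R}) : (2 <= n)%N ->
  sharp_params n N tau -> sharp_code N tau C -> (0 < size C)%N ->
  is_jacobi n 0 (~~ odd tau) (tau.+1)./2 P ->
  exists2 x, dotp x x = 1 & forall y, y \in C -> (('X + 1) ^+ (~~ odd tau) * P).[dotp x y] = 0.
Proof.
move=> n2 pars sh C0 hP; have [uC [sC [hC ips]]] := sh.
have even : ~~ odd tau -> exists2 x, dotp x x = 1 & forall y, y \in C -> (('X + 1) ^+ (~~ odd tau) * P).[dotp x y] = 0.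
  by move=> ot; apply: zero_antipode.
have few : odd tau -> few_values (tau.+1)./2 C ->
    exists2 x, dotp x x = 1 & forall y, y \in C -> (('X + 1) ^+ (~~ odd tau) * P).[dotp x y] = 0.
  by move=> ot; apply: zero_few_values.
have N0 : (0 < N)%N by rewrite -sC.
(* In each use below, [s] is a scale at which all products of code points, norms included, are
   congruent modulo 1. *)
have resc s : 0 < s -> odd tau -> (forall D : seq 'rV[R]_n, tight_code tau s D -> size D = N -> few_values (tau.+1)./2 D) ->
    exists2 x, dotp x x = 1 & forall y, y \in C -> (('X + 1) ^+ (~~ odd tau) * P).[dotp x y] = 0.
  by move=> s0 ot h; apply: few => //; apply: (few_values_rescale n2 N0 s0 sh).
move: pars => [[nE [k [k0 [NE tE]]]]|[[_ [k [k0 [_ tE]]]]|[[tE /andP[_ Nn]]|[[_ tE]|[[NE tE]|pars]]]]].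
- subst n; have [x x1 hx] := zero_polygon C0 hC uC tE (etrans sC NE) k0.
  have ot : odd tau by rewrite tE -[k]prednK // doubleS /= odd_double.
  have kE : (tau.+1)./2 = k by rewrite tE prednK ?double_gt0 // doubleK.
  exists x => //; apply: (jacobi_vanish n2 C0 hC hP (Q := cheb k)) => //.
    by rewrite size_cheb kE.
  by move=> y yC; rewrite ot expr0 mul1r hx.
- by apply: even; rewrite tE odd_double.
- by apply: few; rewrite tE //; apply: (few_values_simplex n2 C0 hC); rewrite ?tE ?sC.
- by apply: even; rewrite tE.
- subst tau; apply: (resc 1) => // D hD sD; apply: (few_values_cross (leq_trans _ n2) hD) => //; by rewrite sD.
clear few C0 sC.
repeat case: pars => pars; case: pars => *; subst n N tau.
- by apply: (resc 5) => // D; apply: few_values16.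
- exact: even.
- by apply: (resc 3) => // D; apply: few_values56.
- by apply: (resc (9 / 4)) => [||D]; [lra| |apply: few_values_size112].
- by apply: (resc (3^-1 + 2)) => [||D]; [lra| |apply: few_values162].
- by apply: (resc (5^-1 + 2)) => [||D]; [lra| |apply: few_values100].
- exact: even.
- by apply: (resc (8 / 3)) => [||D]; [lra| |apply: few_values_size891].
- by apply: (resc 5) => // D; apply: few_values_size552.
- by apply: (resc 3) => // D; apply: few_values4600.
Qed.

Unset Implicit Arguments. Set Strict Implicit.

Theorem theorem3p1 (R : realType) (n N tau : nat) (C : seq 'rV[R]_n)
    (P : {poly R}) (alpha : seq R) :
  (2 <= n)%N ->
  sharp_params n N tau ->
  sharp_code N tau C ->
  (* tau = 2k - 1 + eps with eps in {0,1} *)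
  let k := (tau.+1)./2 in
  let eps : nat := ~~ odd tau in
  (* P = P_k^{(0,eps)}, the normalized Jacobi polynomial *)
  is_jacobi n 0 eps k P ->
  (* alpha = increasing enumeration of the zeros of (1+t)^eps P_k^{(0,eps)}(t) *)
  sorted <%R alpha ->
  (forall t : R, root (('X + 1) ^+ eps * P) t = (t \in alpha)) ->
  (* rho_i = int l_i dmu_n *)
  let rho := fun i : nat => mu_integral n (lagrange_basis alpha i) in
  exists xt : 'rV[R]_n, @sphere R n xt /\
    (forall t : R, (t \in [seq dotp xt y | y <- C]) = (t \in alpha)) /\
    (forall i : nat, (i < size alpha)%N ->
       (count (fun y => dotp xt y == alpha`_i) C)%:R = N%:R * rho i) /\
    (forall h : R -> \bar R,
       (forall t : R, -1 <= t <= 1 -> (0 <= h t)%E) ->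
       {within `[-1, 1], continuous h} ->
       (forall t : R, -1 < t < 1 -> h t \is a fin_num) ->
       let g := fun t : R => fine (h t) in
       (forall (j : nat) (t : R), (j <= tau)%N -> -1 < t < 1 ->
          derivable (derive1n j g) t 1) ->
       (forall t : R, -1 < t < 1 -> 0 <= derive1n tau.+1 g t) ->
       ereal_inf [set (\sum_(y <- C) h (dotp x y))%E | x in @sphere R n]
         = (N%:R%:E * \sum_(i < size alpha) (rho i)%:E * h alpha`_i)%E /\
       (\sum_(y <- C) h (dotp xt y))%E
         = ereal_inf [set (\sum_(y <- C) h (dotp x y))%E | x in @sphere R n]).
Proof.
move=> n2 pars sh k eps hP sa ra rho; have [_ [sC [hC _]]] := sh.
have N0 : (0 < N)%N.
  case: pars => [[_ [m [m0 [-> _]]]]|[[_ [m [_ [-> _]]]]|[[_ /andP[N2 _]]|[[-> _]|[[-> _]|pars]]]]] //.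
  - by rewrite double_gt0.
  - exact: ltnW.
  - by rewrite double_gt0 ltnW.
  by repeat case: pars => pars; case: pars => _ -> _.
have C0 : (0 < size C)%N by rewrite sC.
have [x x1 hx] := sharp_zero n2 pars sh C0 hP.
exists x; split; first exact: x1.
by have := conclusion n2 C0 hC (proj1 hP) x1 hx sa ra; rewrite sC.
Qed.
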